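(* Let $E$ be a real JB$^*$-triple. Then a subspace of $E$ is an $M$-ideal of $E$ if and only if it is a triple ideal of $E$.
   Context: A real JB$^*$-triple is a norm-closed real subspace $E$ of a complex JB$^*$-triple with $\{E,E,E\}\subseteq E$, equipped with the restricted triple product. A triple ideal of $E$ is a norm-closed subspace $I$ with $\{E,E,I\}+\{E,I,E\}\subseteq I$. A projection $Q$ on a Banach space $X$ is an $L$-projection if $\|x\|=\|Qx\|+\|x-Qx\|$ for all $x\in X$. A closed subspace $M$ of a Banach space $V$ is an $M$-ideal if its polar $M^{\circ}=\{\varphi\in V^*:\varphi|_M\equiv 0\}$ is the image of an $L$-projection on $V^*$. *)

(* Defs.v *)
From mathcomp Require Import all_boot all_order all_algebra.
From mathcomp Require Import all_classical all_reals all_analysis.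
From mathcomp Require Import complex.
Set Implicit Arguments. Unset Strict Implicit. Unset Printing Implicit Defensive.
Import Order.TTheory GRing.Theory Num.Theory.
Import numFieldTopology.Exports numFieldNormedType.Exports.
Local Open Scope classical_set_scope.
Local Open Scope ring_scope.
Local Open Scope complex_scope.

Section JB.
Variable R : realType.
Variable V : completeNormedModType R[i].

Definition rnorm (x : V) : R := complex.Re `|x|.

Definition is_cfunctional (f : V -> R[i]) : Prop :=
  (forall (l : R[i]) (y z : V), f (l *: y + z) = l * f y + f z) /\ continuous (f : V -> R[i]^o).

(* Hermitian bounded operator (Lumer / Bonsall--Duncan): the spatial
   numerical range V(T) = { f (T x) : ||x|| = 1, f in V*, ||f|| = 1 = f x }
   consists of real numbers.  ("||f|| = 1 = f x" with ||x|| = 1 is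
   written as: ||f|| <= 1 and f x = 1.) *)
Definition hermitian (T : V -> V) : Prop :=
  forall (x : V) (f : V -> R[i]), `|x| = 1 -> is_cfunctional f ->
    (forall y, `|f y| <= `|y|) -> f x = 1 -> f (T x) \is Num.real.

Definition spectrum (T : V -> V) : set R[i] :=
  [set l | ~ bijective (fun x => T x - l *: x)].

Definition Lop (tp : V -> V -> V -> V) (a b : V) : V -> V := fun x => tp a b x.

Definition is_JBstar_triple (tp : V -> V -> V -> V) : Prop :=
  [/\
      (forall a b c, tp a b c = tp c b a),
      (forall (l : R[i]) a a' b c, tp (l *: a + a') b c = l *: tp a b c + tp a' b c),
      (forall (l : R[i]) a b b' c, tp a (l *: b + b') c = l^* *: tp a b c + tp a b' c),
      (continuous (fun p : (V * V * V)%type => tp p.1.1 p.1.2 p.2)) &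
   [/\
      (forall a b x y z, tp a b (tp x y z) =
          tp (tp a b x) y z - tp x (tp b a y) z + tp x y (tp a b z)),
      (forall a, hermitian (Lop tp a a) /\
                 (forall l, spectrum (Lop tp a a) l -> 0 <= l)) &
      (forall a, `|tp a a a| = `|a| ^+ 3)]].

Definition real_subspace (S : set V) : Prop :=
  [/\ S 0, (forall x y, S x -> S y -> S (x + y)) &
      (forall (r : R) x, S x -> S (r%:C *: x))].

Definition is_real_JBstar_triple (tp : V -> V -> V -> V) (E : set V) : Prop :=
  [/\ is_JBstar_triple tp, real_subspace E, closed E &
      (forall a b c, E a -> E b -> E c -> E (tp a b c))].

Definition is_triple_ideal (tp : V -> V -> V -> V) (E I : set V) : Prop :=
  [/\ real_subspace I, I `<=` E, closed I,
      (forall a b c, E a -> E b -> I c -> I (tp a b c)) &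
      (forall a b c, E a -> I b -> E c -> I (tp a b c))].

(* The dual E* of the real Banach space E: continuous real-linear
   functionals on E.  Each functional is represented canonically by a
   function V -> R vanishing outside E. *)
Definition dual (E : set V) : set (V -> R) :=
  [set phi | [/\ (forall x, ~ E x -> phi x = 0),
     (forall x y, E x -> E y -> phi (x + y) = phi x + phi y),
     (forall (r : R) x, E x -> phi (r%:C *: x) = r * phi x) &
     {within E, continuous phi}]].

Definition dnorm (E : set V) (phi : V -> R) : R :=
  sup [set `|phi x| | x in [set x | E x /\ rnorm x <= 1]].

Definition is_L_projection (E : set V) (Q : (V -> R) -> (V -> R)) : Prop :=
  [/\ (forall phi, dual E phi -> dual E (Q phi)),
      (forall (r : R) phi psi, dual E phi -> dual E psi ->
          Q (r *: phi + psi) = r *: Q phi + Q psi),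
      (forall phi, dual E phi -> Q (Q phi) = Q phi) &
      (forall phi, dual E phi ->
          dnorm E phi = dnorm E (Q phi) + dnorm E (phi - Q phi))].

Definition polar (E M : set V) : set (V -> R) :=
  [set phi | dual E phi /\ (forall m, M m -> phi m = 0)].

Definition is_M_ideal (E M : set V) : Prop :=
  [/\ real_subspace M, M `<=` E, closed M &
      exists Q, is_L_projection E Q /\ Q @` (dual E) = polar E M].

End JB.

(* Main.v *)
(* Write L(a,b) x = {a,b,x} and Q(z) x = {z,x,z}. Since L(z,z) is hermitian with
   nonnegative spectrum, e^(-tL(z,z)) is a contraction for t >= 0, and the Jordan
   identity gives e^(tL(z,z)) {a,b,c} = {e^(tL) a, e^(-tL) b, e^(tL) c}. The norm
   identity |{z,z,z}| = |z|^3, iterated along z, z^3, z^9, ..., turns these into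
   the estimate |z + t(z - z^3)| <= 1 + O(t^2) on the unit ball. It follows that a
   functional f of norm one with f(z) close to 1 satisfies, uniformly,
   f(b) ~ f(L(z,z) b) ~ f(Q(z) b); call this (K).

   M-ideal => ideal: for m in M, and f in the polar of M almost normed by x, some
   q in x + M has |q|, |q+m|, |q-m| <= 1 + e; (K) at these three points forces f
   to vanish on {m,m,b} and {m,b,m}, and cubes are dense in M.

   Ideal => M-ideal: for e in I and t large, z = e^(-tL(e,e)) x lies in x + I and is
   almost orthogonal to e^3, so |e^3 + z| <= 1 + small. Hence
   |g + p| = |g| + |p| for p in the polar of I and g the norm-preserving extension
   of a functional on I. Killing x modulo I against several e at once, (K) shows
   that this extension is unique and depends linearly on the functional. *)
From HB Require Import structures.
Require Import Defs.
From mathcomp Require Import all_boot all_order all_algebra.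
From mathcomp Require Import all_classical all_reals all_analysis.
From mathcomp Require Import complex.
From mathcomp Require Import ring lra zify.
Set Implicit Arguments. Unset Strict Implicit. Unset Printing Implicit Defensive.
Import Order.TTheory GRing.Theory Num.Theory.
Import numFieldTopology.Exports numFieldNormedType.Exports.
Local Open Scope classical_set_scope.
Local Open Scope ring_scope.
Local Open Scope complex_scope.

(** * Real-linear functionals *)

(** The heart is (K), which must be uniform in f, z and b; neither the bidual nor its tripotents
    enter, only inequalities with explicit errors. Let y = z^(3^k). The cubic estimate carries f z
    near 1 over to f y near 1, and for large k, independent of z, y is almost fixed by L(z,z). Since
    Q(y) (b - L(z,z) b) = {y - L(z,z) y, b, y}, the map Q(y) almost kills b - L(z,z) b, and a
    functional almost normed by y is small where Q(y) is small; hence f b is close to f (L(z,z) b).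
    The comparison with Q(z) b comes from the hermitian operator i (L(z,b) - L(b,z)), which makes
    the norm of z + s (L(z,z) b - Q(z) b) at most 1 + O(s^2). Multiplication by i does not preserve
    the real subspace E. All norm estimates therefore take place in V, and functionals on E are
    extended to V by Hahn-Banach without increase of norm; [norming] records that the norm is still
    approached inside E. *)

Section Norm.
Variable R : realType.
Variable V : completeNormedModType R[i].
Implicit Types x y z : V.

Definition absc (c : R[i]) : R := complex.Re `|c|.

Lemma abscE (c : R[i]) : `|c| = (absc c)%:C.
Proof. by rewrite /absc RRe_real ?normr_real. Qed.

Lemma absc_real (r : R) : absc r%:C = `|r|.
Proof. by rewrite /absc normc_def /= expr0n addr0 sqrtr_sqr. Qed.

Lemma absc_ge0 c : 0 <= absc c.
Proof. by rewrite -lecR -abscE normr_ge0. Qed.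

Lemma abscM c d : absc (c * d) = absc c * absc d.
Proof. by apply: complexI; rewrite -abscE normrM !abscE rmorphM. Qed.

Lemma absc1 : absc 1 = 1.
Proof. by apply: complexI; rewrite -abscE normr1. Qed.

Lemma absci : absc 'i = 1.
Proof. by rewrite /absc normc_def /= expr0n expr1n add0r sqrtr1. Qed.

Lemma abscX c n : absc (c ^+ n) = absc c ^+ n.
Proof. by apply: complexI; rewrite -abscE normrX abscE rmorphXn. Qed.

Lemma abscV c : absc c^-1 = (absc c)^-1.
Proof. by apply: complexI; rewrite -abscE normfV abscE fmorphV. Qed.

Lemma absc_nat n : absc n%:R = n%:R.
Proof. by apply: complexI; rewrite -abscE normr_nat rmorph_nat. Qed.

Lemma Re_le_absc c : complex.Re c <= absc c.
Proof.
rewrite (le_trans (ler_norm _))// -lecR -abscE; exact: normc_ge_Re.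
Qed.

Lemma rnormE x : `|x| = (rnorm x)%:C.
Proof. by rewrite /rnorm RRe_real ?normr_real. Qed.

Lemma rnorm_ge0 x : 0 <= rnorm x.
Proof. by rewrite -lecR -rnormE normr_ge0. Qed.

Lemma rnorm0 : rnorm (0 : V) = 0.
Proof. by apply: complexI; rewrite -rnormE normr0. Qed.

Lemma rnorm0_eq0 x : rnorm x = 0 -> x = 0.
Proof. by move=> x0; apply: normr0_eq0; rewrite rnormE x0. Qed.

Lemma rnorm_gt0 x : x != 0 -> 0 < rnorm x.
Proof.
move=> x0; rewrite lt_def rnorm_ge0 andbT.
by apply: contra_neq x0; exact: rnorm0_eq0.
Qed.

Lemma rnormD x y : rnorm (x + y) <= rnorm x + rnorm y.
Proof. by have := ler_normD x y; rewrite !rnormE -rmorphD lecR. Qed.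

Lemma rnormZ (c : R[i]) x : rnorm (c *: x) = absc c * rnorm x.
Proof. by apply: complexI; rewrite -rnormE normrZ rmorphM rnormE abscE. Qed.

Lemma rnormZr (r : R) x : rnorm (r%:C *: x) = `|r| * rnorm x.
Proof. by rewrite rnormZ absc_real. Qed.

Lemma rnormN x : rnorm (- x) = rnorm x.
Proof. by apply: complexI; rewrite -!rnormE normrN. Qed.

Lemma rnormB x y : rnorm (x - y) <= rnorm x + rnorm y.
Proof. by rewrite -(rnormN y) rnormD. Qed.

Lemma rdistC x y : rnorm (x - y) = rnorm (y - x).
Proof. by rewrite -rnormN opprB. Qed.

Lemma rdist_triangle y x z : rnorm (x - z) <= rnorm (x - y) + rnorm (y - z).
Proof. by rewrite -[x - z](subrKA y) rnormD. Qed.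

Lemma rnorm_sum (I : Type) (s : seq I) (P : pred I) (F : I -> V) :
  rnorm (\sum_(i <- s | P i) F i) <= \sum_(i <- s | P i) rnorm (F i).
Proof.
elim/big_ind2: _ => [|x a y b xa yb|//]; first by rewrite rnorm0.
exact: le_trans (rnormD _ _) (lerD xa yb).
Qed.

Lemma rnorm_le0 x : (forall e : R, 0 < e -> rnorm x <= e) -> x = 0.
Proof.
move=> h; apply: rnorm0_eq0; apply/eqP; rewrite eq_le rnorm_ge0 andbT.
by apply/ler_addgt0Pl => e e0; rewrite addr0 h.
Qed.

Lemma closed_rnorm (E : set V) x : closed E ->
  (forall e : R, 0 < e -> exists2 y, E y & rnorm (x - y) <= e) -> E x.
Proof.
move=> cE h; apply: cE => B /nbhs_normP[e e0 eB].
have eE : e = (complex.Re e)%:C by rewrite RRe_real // gtr0_real.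
have e0' : 0 < complex.Re e by move: e0; rewrite /= {1}eE ltcR.
have [y Ey xy] := h (complex.Re e / 2) (divr_gt0 e0' (ltr0n _ 2)).
exists y; split => //; apply: eB; rewrite /= rnormE eE ltcR.
by apply: le_lt_trans xy _; lra.
Qed.

Lemma rnorm_complete (u : nat -> V) (d : nat -> R) :
  (forall n k, rnorm (u (n + k)%N - u n) <= d n) ->
  (forall e : R, 0 < e -> exists n, d n <= e) ->
  exists l, forall n, rnorm (l - u n) <= d n.
Proof.
move=> ud d0.
have cvgu : cvg (u @ \oo).
  apply: cauchy_cvg; apply: cauchy_exP => e e0.
  have eE : e = (complex.Re e)%:C by rewrite RRe_real // gtr0_real.
  have e0' : 0 < complex.Re e by move: e0; rewrite {1}eE ltcR.
  have [n dn] := d0 (complex.Re e / 2) (divr_gt0 e0' (ltr0n _ 2)).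
  exists (u n); exists n => // k /= nk.
  rewrite -ball_normE /= rnormE rdistC eE ltcR.
  rewrite -(subnKC nk); apply: le_lt_trans (ud _ _) _.
  by apply: le_lt_trans dn _; lra.
exists (lim (u @ \oo)) => n; rewrite -lecR -rnormE.
have [dn0|dn0] := leP 0 (d n); last first.
  by have := le_lt_trans (le_trans (rnorm_ge0 _) (ud n 0%N)) dn0; rewrite ltxx.
apply/ler_addgt0Pl => e e0.
have /cvgrPdist_lt/(_ e e0)[m _ hm] := cvgu.
have := hm (n + m)%N (leq_addl _ _) => /= h1.
rewrite -[lim _ - _](subrKA (u (n + m)%N)).
apply: le_trans (ler_normD _ _) _; apply: lerD; first exact: ltW.
by rewrite rnormE lecR ud.
Qed.

End Norm.

(** * Hahn-Banach for real-linear functionals *)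

Section RealFunctionals.
Variable R : realType.
Variable W : lmodType R[i].
Implicit Types (S : set W) (f g p : W -> R).

Definition real_sub S :=
  [/\ S 0, forall x y, S x -> S y -> S (x + y)
    & forall (r : R) x, S x -> S (r%:C *: x)].

Definition real_linear_on S f :=
  (forall x y, S x -> S y -> f (x + y) = f x + f y) /\
  (forall (r : R) x, S x -> f (r%:C *: x) = r * f x).

Definition sublinear p :=
  (forall x y, p (x + y) <= p x + p y) /\
  (forall (r : R) x, 0 <= r -> p (r%:C *: x) = r * p x).

Lemma real_subN S x : real_sub S -> S x -> S (- x).
Proof.
by case=> _ _ SZ Sx; rewrite -scaleN1r -(rmorphN1 (real_complex R)); apply: SZ.
Qed.

Lemma real_subB S x y : real_sub S -> S x -> S y -> S (x - y).
Proof. by move=> SS Sx Sy; case: (SS) => _ SD _; apply: SD (real_subN SS Sy). Qed.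

Section On.
Variables (S : set W) (f : W -> R).
Hypotheses (SS : real_sub S) (fS : real_linear_on S f).

Lemma rlin0 : f 0 = 0.
Proof. by case: SS fS => S0 _ _ [_ fZ]; rewrite -(scale0r 0) (fZ 0 0 S0) mul0r. Qed.

Lemma rlinN x : S x -> f (- x) = - f x.
Proof.
by case: fS => _ fZ Sx; rewrite -scaleN1r -(rmorphN1 (real_complex R)) fZ// mulN1r.
Qed.

Lemma rlinB x y : S x -> S y -> f (x - y) = f x - f y.
Proof.
by move=> Sx Sy; case: fS => fD _; rewrite fD ?rlinN//; apply: real_subN.
Qed.
End On.

Section HahnBanach.
Variables (p : W -> R) (S : set W) (f : W -> R).
Hypotheses (ps : sublinear p) (SS : real_sub S) (fS : real_linear_on S f).
Hypothesis fp : forall x, S x -> f x <= p x.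

(* A partial extension of f is encoded by its graph. *)
Let dominated (G : set (W * R)) :=
  [/\ forall u, G u -> u.2 <= p u.1,
      forall u v, G u -> G v -> G (u.1 + v.1, u.2 + v.2) &
      forall (r : R) u, G u -> G (r%:C *: u.1, r * u.2)].

Let graph0 : set (W * R) := [set u | S u.1 /\ u.2 = f u.1].

Let P (G : set (W * R)) := G = set0 \/ (dominated G /\ graph0 `<=` G).

Let domP0 : dominated graph0.
Proof.
case: SS fS => S0 SD SZ [fD fZ]; split.
- by move=> [x a] [/= Sx ->]; exact: fp.
- by move=> [x a] [y b] [/= Sx ->] [/= Sy ->]; split; [exact: SD|rewrite fD].
- by move=> r [x a] [/= Sx ->]; split; [exact: SZ|rewrite fZ].
Qed.

Let chainP (F : set (set (W * R))) :
  F `<=` P -> total_on F subset -> P (\bigcup_(X in F) X).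
Proof.
move=> FP Ft.
have [[G FG /= Gn0]|noG] := pselect (exists2 G, F G & G <> set0); last first.
  left; rewrite -subset0 => u [G FG Gu]; apply: noG; exists G => // G0.
  by rewrite G0 in Gu.
right; split; last first.
  by case: (FP _ FG) => // -[_ sG] u /sG Gu; exists G.
have dom X u : F X -> X u -> dominated X.
  by move=> FX Xu; case: (FP _ FX) => [X0|[]//]; rewrite X0 in Xu.
split.
- by move=> u [X FX Xu]; have [/(_ _ Xu)] := dom _ _ FX Xu.
- move=> u v [X FX Xu] [Y FY Yv]; have [XY|YX] := Ft _ _ FX FY.
  + by exists Y => //; have [_ + _] := dom _ _ FY Yv; apply; [exact: XY|].
  + by exists X => //; have [_ + _] := dom _ _ FX Xu; apply; [|exact: YX].
- by move=> r u [X FX Xu]; exists X => //; have [_ _] := dom _ _ FX Xu; apply.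
Qed.

Theorem hahn_banach : exists g,
  [/\ real_linear_on setT g, forall x, g x <= p x & forall x, S x -> g x = f x].
Proof.
have [pD pZ] := ps.
have [G [PG Gmax]] := Zorn_bigcup chainP.
have S00 : graph0 (0, f 0) by case: SS => S0 _ _.
have [dG sG] : dominated G /\ graph0 `<=` G.
  case: PG => // G0; exfalso; apply: (Gmax graph0); last by right; split.
  by rewrite G0; split=> [u []|/(_ _ S00)].
have [Gp GD GZ] := dG.
have f00 : f 0 = 0 by exact: (rlin0 SS fS).
have G00 : G (0, 0) by have := sG _ S00; rewrite f00.
have p0 : p 0 = 0 by rewrite -(scale0r 0) (pZ 0 0 (lexx _)) mul0r.
have GN u : G u -> G (- u.1, - u.2).
  by move=> /(GZ (-1)); rewrite rmorphN1 scaleN1r mulN1r.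
(* Domination by p already makes the graph single valued: G contains (0, a - b) and (0, b - a), and
   p 0 = 0. *)
have Guniq x a b : G (x, a) -> G (x, b) -> a = b.
  move=> Ga Gb; apply/eqP; rewrite -subr_eq0; apply/eqP.
  have /= h1 := Gp _ (GD _ _ Ga (GN _ Gb)); have /= h2 := Gp _ (GD _ _ Gb (GN _ Ga)).
  by move: h1 h2; rewrite subrr p0; lra.
have Gtot x : exists a, G (x, a).
  apply: contrapT => nx.
  have key u v : G u -> G v -> u.2 - p (u.1 - x) <= p (v.1 + x) - v.2.
    move=> Gu Gv; have /= h := Gp _ (GD _ _ Gu Gv).
    have := pD (u.1 - x) (v.1 + x); rewrite addrACA addNr addr0; lra.
  pose A := [set u.2 - p (u.1 - x) | u in G].
  have A0 : A !=set0 by exists (0 - p (0 - x)); exists (0, 0).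
  have Aub u : G u -> ubound A (p (u.1 + x) - u.2).
    by move=> Gu _ [v Gv <-]; exact: key.
  (* The value of the extension at x; any number between the two families compared in [key] would
     serve. *)
  pose c := sup A.
  have hA : has_sup A by split => //; eexists; exact: Aub G00.
  have c1 u : G u -> u.2 - p (u.1 - x) <= c.
    by move=> Gu; apply: ub_le_sup; [case: hA|exists u].
  have c2 u : G u -> c <= p (u.1 + x) - u.2.
    by move=> Gu; apply: ge_sup => //; exact: Aub.
  pose H : set (W * R) := [set w | exists u (t : R),
     [/\ G u, w.1 = u.1 + t%:C *: x & w.2 = u.2 + t * c]].
  apply: (Gmax H).
    split=> [u Gu|h]; first by exists u, 0; rewrite scale0r mul0r !addr0.
    apply: nx; exists c; apply: h; exists (0, 0), 1.
    by rewrite scale1r mul1r !add0r.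
  right; split; last first.
    move=> w /sG Gw; exists w, 0; rewrite scale0r mul0r !addr0; split => //.
  split.
  - move=> [_ _] /= [u [t [Gu /= -> ->]]].
    have [t0|t0|->] := ltrgt0P t; last by rewrite scale0r mul0r !addr0; exact: Gp.
    + have /= := c2 _ (GZ t^-1 _ Gu).
      have -> : u.1 + t%:C *: x = t%:C *: ((t^-1)%:C *: u.1 + x).
        by rewrite scalerDr scalerA -rmorphM divff ?gt_eqF// scale1r.
      rewrite (pZ _ _ (ltW t0)) => h.
      have : t * c <= t * (p ((t^-1)%:C *: u.1 + x) - t^-1 * u.2) by rewrite ler_pM2l.
      by rewrite mulrBr mulrA divff ?gt_eqF// mul1r; lra.
    + have Nt0 : 0 < - t by lra.
      have /= := c1 _ (GZ (- t)^-1 _ Gu).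
      have -> : u.1 + t%:C *: x = (- t)%:C *: (((- t)^-1)%:C *: u.1 - x).
        rewrite scalerBr scalerA -rmorphM divff ?gt_eqF// scale1r.
        by rewrite rmorphN scaleNr opprK.
      rewrite (pZ _ _ (ltW Nt0)) => h.
      have : - t * ((- t)^-1 * u.2 - p (((- t)^-1)%:C *: u.1 - x)) <= - t * c.
        by rewrite ler_pM2l.
      by rewrite mulrBr mulrA divff ?gt_eqF// mul1r; lra.
  - move=> [_ _] [_ _] /= [u [t [Gu /= -> ->]]] [v [s [Gv /= -> ->]]].
    exists (u.1 + v.1, u.2 + v.2), (t + s); split; [exact: GD| |].
      by rewrite rmorphD scalerDl addrACA.
    by rewrite /= mulrDl addrACA.
  - move=> r [_ _] /= [u [t [Gu /= -> ->]]].
    exists (r%:C *: u.1, r * u.2), (r * t); split; [exact: GZ| |].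
      by rewrite scalerDr scalerA rmorphM.
    by rewrite mulrDr mulrA.
have [g gG] := choice Gtot.
exists g; split.
- split=> [x y _ _|r x _]; apply: (Guniq _ _ _ (gG _)).
    exact: GD (gG x) (gG y).
  exact: GZ (gG x).
- by move=> x; exact: Gp (gG x).
- by move=> x Sx; apply: (Guniq _ _ _ (gG x)); apply: sG; split.
Qed.
End HahnBanach.

(** Hahn-Banach on the real line through x0. For x0 = 0 the coordinate [c] is not determined, but it
    occurs only in the product with p x0 = 0. *)
Lemma support_functional p x0 : sublinear p -> exists g,
  [/\ real_linear_on setT g, forall x, g x <= p x & g x0 = p x0].
Proof.
move=> ps; have [pD pZ] := ps.
have p0 : p 0 = 0 by rewrite -(scale0r 0) (pZ 0 0 (lexx _)) mul0r.
pose c (x : W) := xget 0 [set t : R | x = t%:C *: x0].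
pose S := [set x | exists t : R, x = t%:C *: x0].
have SS : real_sub S.
  split; [by exists 0; rewrite scale0r| |].
  - by move=> _ _ [t ->] [s ->]; exists (t + s); rewrite rmorphD scalerDl.
  - by move=> r _ [t ->]; exists (r * t); rewrite scalerA -rmorphM.
have cE (t : R) : c (t%:C *: x0) * p x0 = t * p x0.
  have : t%:C *: x0 = (c (t%:C *: x0))%:C *: x0.
    exact: (@xgetPex _ 0 [set s : R | t%:C *: x0 = s%:C *: x0] (ex_intro _ t erefl)).
  have [->|x00] := eqVneq x0 0; first by rewrite p0 !mulr0.
  move/eqP; rewrite -subr_eq0 -scalerBl scaler_eq0 (negPf x00) orbF subr_eq0.
  by move=> /eqP/complexI <-.
have [|x [t ->]|g [gl gp gf]] := @hahn_banach p S (fun x => c x * p x0) ps SS.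
- split=> [_ _ [t ->] [s ->]|r _ [t ->]].
    by rewrite -scalerDl -rmorphD !cE mulrDl.
  by rewrite scalerA -rmorphM !cE mulrA.
- rewrite cE; have [t0|t0] := leP 0 t; first by rewrite pZ.
  have := pD (t%:C *: x0) ((- t)%:C *: x0).
  have Nt0 : 0 <= - t by lra.
  by rewrite -scalerDl -rmorphD subrr scale0r p0 (pZ _ _ Nt0) mulNr subr_ge0.
- exists g; split => //; rewrite -{1}(scale1r x0) gf; last by exists 1.
  by have := cE 1; rewrite rmorph1 mul1r.
Qed.

End RealFunctionals.

(* Identities in a module reduce to ring identities in its idealization
   K (+) M, where the ring tactic applies. *)
Section Idealization.
Variables (K : comNzRingType) (M : lmodType K).

Definition idealization : Type := (K * M)%type.
HB.instance Definition _ := GRing.Zmodule.copy idealization (K * M)%type.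

Let mul (u v : idealization) : idealization :=
  (u.1 * v.1, u.1 *: v.2 + v.1 *: u.2).
Let one : idealization := (1, 0).

Let mulC : commutative mul.
Proof. by move=> u v; rewrite /mul mulrC addrC. Qed.
Let mulA : associative mul.
Proof.
move=> u v w; rewrite /mul /= mulrA !scalerDr !scalerA addrA.
by congr (_, _ + _ + _); congr (_ *: _); rewrite mulrC.
Qed.
Let mul1 : left_id one mul.
Proof. by case=> a x; rewrite /mul /= mul1r scale1r scaler0 addr0. Qed.
Let mulDl : left_distributive mul +%R.
Proof.
by move=> u v w; rewrite /mul /= mulrDl scalerDl scalerDr addrACA.
Qed.
Let one_neq0 : one != 0.
Proof. by apply/eqP => -[/eqP]; rewrite oner_eq0. Qed.
HB.instance Definition _ :=
  GRing.Zmodule_isComNzRing.Build idealization mulA mulC mul1 mulDl one_neq0.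

Definition ideal_vec (x : M) : idealization := (0, x).
Definition ideal_scal (a : K) : idealization := (a, 0).

Let ideal_vec_additive : zmod_morphism ideal_vec.
Proof. by move=> x y; rewrite /ideal_vec; congr pair; rewrite /= subr0. Qed.
HB.instance Definition _ :=
  GRing.isZmodMorphism.Build M idealization ideal_vec ideal_vec_additive.

Let ideal_scal_additive : zmod_morphism ideal_scal.
Proof. by move=> x y; rewrite /ideal_scal; congr pair; rewrite /= subr0. Qed.
Let ideal_scal_multiplicative : monoid_morphism ideal_scal.
Proof. by split=> // x y; congr pair; rewrite /= !scaler0 addr0. Qed.
HB.instance Definition _ :=
  GRing.isZmodMorphism.Build K idealization ideal_scal ideal_scal_additive.
HB.instance Definition _ :=
  GRing.isMonoidMorphism.Build K idealization ideal_scal ideal_scal_multiplicative.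

Lemma ideal_vecZ a x : ideal_vec (a *: x) = ideal_scal a * ideal_vec x.
Proof. by congr pair; rewrite /= ?mulr0// scale0r addr0. Qed.

Lemma ideal_vecD x y : ideal_vec (x + y) = ideal_vec x + ideal_vec y.
Proof. exact: raddfD. Qed.

Lemma ideal_vecN x : ideal_vec (- x) = - ideal_vec x.
Proof. exact: raddfN. Qed.

Lemma ideal_vecMn x n : ideal_vec (x *+ n) = ideal_vec x *+ n.
Proof. exact: raddfMn. Qed.

Lemma ideal_vec0 : ideal_vec 0 = 0. Proof. by []. Qed.

Lemma ideal_vec_inj : injective ideal_vec. Proof. by move=> x y []. Qed.

End Idealization.

Ltac vring := apply: ideal_vec_inj;
  rewrite ?(ideal_vecD, ideal_vecN, ideal_vec0, ideal_vecMn, ideal_vecZ); ring.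

(** * Exponentials of bounded operators *)

Section ExpSums.
Variable R : realType.
Implicit Types r s : R.

Definition exp_sum r n : R := \sum_(0 <= k < n) r ^+ k / k`!%:R.
Definition exp_tail r n : R := expR r - exp_sum r n.

Lemma exp_sum_ge0 r n : 0 <= r -> 0 <= exp_sum r n.
Proof. by move=> r0; apply: sumr_ge0 => k _; rewrite divr_ge0// exprn_ge0. Qed.

Lemma exp_sum_le r n : 0 <= r -> exp_sum r n <= expR r.
Proof.
move=> r0; apply: (nondecreasing_cvgn_le (u_ := series (exp_coeff r))).
  apply/nondecreasing_seqP => k; rewrite -subr_ge0 /series /=.
  by rewrite big_nat_recr//= addrAC subrr add0r exp_coeff_ge0.
exact: is_cvg_series_exp_coeff.
Qed.

Lemma exp_tail_ge0 r n : 0 <= r -> 0 <= exp_tail r n.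
Proof. by move=> r0; rewrite subr_ge0 exp_sum_le. Qed.

Lemma exp_tail_cvg r (e : R) : 0 < e ->
  exists m, forall n, (m <= n)%N -> `|exp_tail r n| <= e.
Proof.
move=> e0; have /cvgrPdist_le/(_ e e0)[m _ h] := is_cvg_series_exp_coeff r.
by exists m => n /h.
Qed.

Lemma exp_sum_split r n m : exp_sum r (n + m) - exp_sum r n =
  \sum_(n <= k < n + m) r ^+ k / k`!%:R.
Proof.
by rewrite /exp_sum (big_cat_nat (leq0n n) (leq_addr m n)) /= addrAC subrr add0r.
Qed.

(** Since k! <= (m + k)!, the term of index m + k is at most r^m times the term of index k. *)
Lemma exp_tail_le r m : 0 <= r -> exp_tail r m <= r ^+ m * expR r.
Proof.
move=> r0; apply/ler_addgt0Pr => e e0.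
have [k /(_ (m + k)%N) h] := exp_tail_cvg r e0.
have {h} h : exp_tail r (m + k) <= e by rewrite (le_trans (ler_norm _))// h// leq_addl.
rewrite /exp_tail -[expR r - _](subrKA (exp_sum r (m + k))) addrC lerD//.
rewrite exp_sum_split -[X in index_iota X](add0n m) big_addn addKn.
apply: (@le_trans _ _ (r ^+ m * exp_sum r k)); last first.
  by rewrite ler_wpM2l ?exprn_ge0// exp_sum_le.
rewrite mulr_sumr; apply: ler_sum => i _.
rewrite exprD [r ^+ i * _]mulrC -mulrA ler_wpM2l ?exprn_ge0//.
rewrite ler_wpM2l ?exprn_ge0// lef_pV2 ?posrE ?ltr0n ?fact_gt0//.
by rewrite ler_nat leq_fact// leq_addr.
Qed.

End ExpSums.

Lemma big_antidiagonal (M : zmodType) (F : nat -> nat -> M) n :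
  \sum_(0 <= k < n) \sum_(0 <= i < k.+1) F i (k - i)%N =
  \sum_(0 <= i < n) \sum_(0 <= j < n - i) F i j.
Proof.
elim: n => [|n IHn]; first by rewrite !big_geq.
rewrite big_nat_recr//= IHn.
have -> : \sum_(0 <= i < n) \sum_(0 <= j < n - i) F i j =
    \sum_(0 <= i < n.+1) \sum_(0 <= j < n - i) F i j.
  by rewrite [RHS]big_nat_recr//= subnn [X in _ + X]big_geq// addr0.
rewrite -big_split/=; apply: eq_big_nat => i /andP[_ ilen].
by rewrite subSn// big_nat_recr.
Qed.

Lemma exp_binomial (K : numFieldType) (x y : K) k :
  \sum_(0 <= i < k.+1) x ^+ i / i`!%:R * (y ^+ (k - i) / (k - i)`!%:R) =
  (x + y) ^+ k / k`!%:R.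
Proof.
rewrite addrC exprDn mulr_suml big_mkord; apply: eq_bigr => -[i /= ik] _.
have f0 m : m`!%:R != 0 :> K by rewrite pnatr_eq0 -lt0n fact_gt0.
rewrite -mulr_natr -(bin_fact (ik : (i <= k)%N)) !natrM.
have C0 : 'C(k, i)%:R != 0 :> K by rewrite pnatr_eq0 -lt0n bin_gt0.
by field; rewrite !f0 C0.
Qed.

Section OperatorExponential.
Variable R : realType.
Variable V : completeNormedModType R[i].
Implicit Types (T : V -> V) (M : R) (w : R[i]) (x y : V).
Local Notation N := (@rnorm R V).

Definition bounded_op T M := [/\ forall c x y, T (c *: x + y) = c *: T x + T y,
  0 <= M & forall x, N (T x) <= M * N x].

Section Bop.
Variables (T : V -> V) (M : R).
Hypothesis TM : bounded_op T M.

Lemma bopD x y : T (x + y) = T x + T y.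
Proof. by case: TM => TL _ _; have := TL 1 x y; rewrite !scale1r. Qed.

Lemma bop0 : T 0 = 0.
Proof. by apply: (addrI (T 0)); rewrite -bopD !addr0. Qed.

Lemma bopZ c x : T (c *: x) = c *: T x.
Proof. by case: TM => TL _ _; have := TL c x 0; rewrite addr0 bop0 addr0. Qed.

Lemma bopN x : T (- x) = - T x.
Proof. by rewrite -scaleN1r bopZ scaleN1r. Qed.

Lemma bopB x y : T (x - y) = T x - T y.
Proof. by rewrite bopD bopN. Qed.

Lemma bop_sum (I : Type) (s : seq I) (F : I -> V) :
  T (\sum_(i <- s) F i) = \sum_(i <- s) T (F i).
Proof.
elim: s => [|i s IHs]; first by rewrite !big_nil bop0.
by rewrite !big_cons bopD IHs.
Qed.

Lemma bop_bound x : N (T x) <= M * N x. Proof. by case: TM. Qed.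

Lemma bop_ge0 : 0 <= M. Proof. by case: TM. Qed.

Lemma bop_iter k : bounded_op (iter k T) (M ^+ k).
Proof.
have M0 := bop_ge0; elim: k => [|k [IL _ IB]].
  by split => // x; rewrite expr0 mul1r.
split => [c x y||x /=].
- by rewrite !iterS IL bopD bopZ.
- exact: exprn_ge0.
- by rewrite exprS -mulrA (le_trans (bop_bound _))// ler_wpM2l.
Qed.

Lemma bop_shift (c : R) : bounded_op (fun x => T x + c%:C *: x) (M + `|c|).
Proof.
split=> [a x y||x]; first by rewrite bopD bopZ; vring.
  by rewrite addr_ge0// bop_ge0.
by rewrite (le_trans (rnormD _ _))// mulrDl rnormZr lerD2r bop_bound.
Qed.
End Bop.

Definition pexp T w n x : V := \sum_(0 <= k < n) (w ^+ k / k`!%:R) *: iter k T x.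

(** The limit is taken by choice so that the exponential is total in T; for a bounded T the limit
    exists by [opexpP] and the default 0 plays no part. *)
Definition opexp T w x : V := xget 0 [set l | forall e : R, 0 < e ->
  exists m, forall n, (m <= n)%N -> N (l - pexp T w n x) <= e].

Section Exp.
Variables (T : V -> V) (M : R).
Hypothesis TM : bounded_op T M.
Let r w := absc w * M.

Let r_ge0 w : 0 <= r w.
Proof. by rewrite mulr_ge0 ?absc_ge0 ?(bop_ge0 TM). Qed.

Lemma pexp_term w k x :
  N ((w ^+ k / k`!%:R) *: iter k T x) <= r w ^+ k / k`!%:R * N x.
Proof.
rewrite rnormZ abscM abscX abscV absc_nat /r exprMn.
rewrite [X in _ <= X * _]mulrAC -[X in _ <= X]mulrA ler_wpM2l//.
  by rewrite divr_ge0// exprn_ge0// absc_ge0.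
exact: bop_bound (bop_iter TM k) x.
Qed.

Lemma pexp_bound w n x : N (pexp T w n x) <= exp_sum (r w) n * N x.
Proof.
rewrite (le_trans (rnorm_sum _ _ _))// mulr_suml.
by apply: ler_sum => k _; exact: pexp_term.
Qed.

Lemma pexp_linear w n c x y :
  pexp T w n (c *: x + y) = c *: pexp T w n x + pexp T w n y.
Proof.
rewrite /pexp scaler_sumr -big_split/=; apply: eq_bigr => k _.
by have [-> _ _] := bop_iter TM k; vring.
Qed.

(** Term by term the series is dominated by the scalar series of exp(|w| M), whose tail thus serves
    as a modulus of convergence. *)
Lemma opexpP w n x :
  N (opexp T w x - pexp T w n x) <= exp_tail (r w) n * N x.
Proof.
have tl0 := exp_tail_ge0 _ (r_ge0 w).
have [l hl] : exists l, forall n, N (l - pexp T w n x) <= exp_tail (r w) n * N x.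
  apply: rnorm_complete => [{}n k|e e0].
    rewrite /pexp (big_cat_nat (leq0n n) (leq_addr k n)) /= addrAC subrr add0r.
    rewrite (le_trans (rnorm_sum _ _ _))//.
    apply: (@le_trans _ _ ((exp_sum (r w) (n + k) - exp_sum (r w) n) * N x)).
      rewrite exp_sum_split mulr_suml; apply: ler_sum => j _.
      exact: pexp_term.
    by rewrite ler_wpM2r ?rnorm_ge0// lerD2r exp_sum_le.
  have N1 : 0 < N x + 1 by rewrite ltr_wpDl ?rnorm_ge0.
  have [m /(_ m (leqnn m)) hm] := exp_tail_cvg (r w) (divr_gt0 e0 N1).
  exists m; apply: (@le_trans _ _ (exp_tail (r w) m * (N x + 1))).
    by rewrite ler_wpM2l// lerDl.
  by rewrite -ler_pdivlMr// (le_trans (ler_norm _)).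
have lim_l e : 0 < e -> exists m, forall n, (m <= n)%N -> N (l - pexp T w n x) <= e.
  move=> e0; have N1 : 0 < N x + 1 by rewrite ltr_wpDl ?rnorm_ge0.
  have [m hm] := exp_tail_cvg (r w) (divr_gt0 e0 N1).
  exists m => k /hm hk; apply: le_trans (hl k) _.
  apply: (@le_trans _ _ (exp_tail (r w) k * (N x + 1))).
    by rewrite ler_wpM2l// lerDl.
  by rewrite -ler_pdivlMr// (le_trans (ler_norm _)).
suff -> : opexp T w x = l by exact: hl.
rewrite /opexp; apply: xget_unique => // l' hl'; apply/eqP; rewrite -subr_eq0.
apply/eqP; apply: rnorm_le0 => e e0.
have e20 : 0 < e / 2 by lra.
have [m1 h1] := lim_l _ e20; have [m2 h2] := hl' _ e20.
have := h1 _ (leq_addr m2 m1); have := h2 _ (leq_addl m1 m2).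
have := rdist_triangle (pexp T w (m1 + m2) x) l' l.
rewrite (rdistC (pexp _ _ _ _) l); lra.
Qed.

Lemma opexp_lim w x e : 0 < e ->
  exists m, forall n, (m <= n)%N -> N (opexp T w x - pexp T w n x) <= e.
Proof.
move=> e0; have N1 : 0 < N x + 1 by rewrite ltr_wpDl ?rnorm_ge0.
have [m hm] := exp_tail_cvg (r w) (divr_gt0 e0 N1).
exists m => k /hm hk; apply: le_trans (opexpP w k x) _.
apply: (@le_trans _ _ (exp_tail (r w) k * (N x + 1))).
  by rewrite ler_wpM2l ?exp_tail_ge0// lerDl.
by rewrite -ler_pdivlMr// (le_trans (ler_norm _)).
Qed.

Lemma opexp_uniq w x l :
  (forall e : R, 0 < e -> exists m, forall n, (m <= n)%N -> N (l - pexp T w n x) <= e) ->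
  l = opexp T w x.
Proof.
move=> hl; apply/eqP; rewrite -subr_eq0; apply/eqP; apply: rnorm_le0 => e e0.
have e20 : 0 < e / 2 by lra.
have [m1 h1] := opexp_lim w x e20; have [m2 h2] := hl _ e20.
have := h1 _ (leq_addr m2 m1); have := h2 _ (leq_addl m1 m2).
have := rdist_triangle (pexp T w (m1 + m2) x) l (opexp T w x).
rewrite (rdistC (pexp _ _ _ _) (opexp _ _ _)); lra.
Qed.

Lemma opexp_bop w : bounded_op (opexp T w) (expR (r w)).
Proof.
split => [c x y||x]; last 1 first.
- have := opexpP w 0 x.
  by rewrite /pexp big_geq// subr0 /exp_tail /exp_sum big_geq// subr0.
- symmetry; apply: opexp_uniq => e e0.
  have c1 : 0 < absc c + 1 by rewrite ltr_wpDl ?absc_ge0.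
  have e1 : 0 < e / 2 / (absc c + 1) by rewrite !divr_gt0.
  have e2 : 0 < e / 2 by lra.
  have [m1 h1] := opexp_lim w x e1; have [m2 h2] := opexp_lim w y e2.
  exists (m1 + m2)%N => n nm.
  have /h1 {}h1 : (m1 <= n)%N by apply: leq_trans nm; exact: leq_addr.
  have /h2 {}h2 : (m2 <= n)%N by apply: leq_trans nm; exact: leq_addl.
  rewrite pexp_linear.
  have -> : c *: opexp T w x + opexp T w y - (c *: pexp T w n x + pexp T w n y) =
    c *: (opexp T w x - pexp T w n x) + (opexp T w y - pexp T w n y) by vring.
  apply: le_trans (rnormD _ _) _; rewrite rnormZ.
  have : absc c * N (opexp T w x - pexp T w n x) <= e / 2.
    move: h1; rewrite ler_pdivlMr// mulrC => h1; apply: le_trans h1.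
    by rewrite ler_wpM2r ?rnorm_ge0// lerDl.
  lra.
- exact: expR_ge0.
Qed.

Lemma opexp_0 x : opexp T 0 x = x.
Proof.
symmetry; apply: opexp_uniq => e e0; exists 1%N => -[//|n] _.
rewrite /pexp big_nat_recl//= expr0 divr1 scale1r big1 ?addr0 ?subrr ?rnorm0 ?ltW//.
by move=> k _; rewrite expr0n /= mul0r scale0r.
Qed.

(** S is only additive: linearity is replaced by a condition on single terms, so that the
    conjugate-linear [quad z] is covered along with linear maps. *)
Lemma opexp_comm (S : V -> V) (K : R) w w' x : 0 <= K ->
  (forall y z, S (y + z) = S y + S z) -> (forall y, N (S y) <= K * N y) ->
  (forall k y, S ((w ^+ k / k`!%:R) *: iter k T y) =
               (w' ^+ k / k`!%:R) *: iter k T (S y)) ->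
  S (opexp T w x) = opexp T w' (S x).
Proof.
move=> K0 SD SK SZ.
have S0 : S 0 = 0 by apply: (addrI (S 0)); rewrite -SD !addr0.
have SN y : S (- y) = - S y by apply: (addrI (S y)); rewrite -SD !subrr S0.
have Sp n : S (pexp T w n x) = pexp T w' n (S x).
  rewrite /pexp; elim: n => [|n IHn]; first by rewrite !big_geq.
  by rewrite !big_nat_recr//= SD IHn SZ.
apply: opexp_uniq => e e0.
have K1 : 0 < K + 1 by lra.
have [m h] := opexp_lim w x (divr_gt0 e0 K1).
exists m => n /h; rewrite -Sp -SN -SD ler_pdivlMr// mulrC => hn.
apply: le_trans (SK _) _; apply: le_trans hn.
by rewrite ler_wpM2r ?rnorm_ge0// lerDl.
Qed.

Lemma opexpT w x : T (opexp T w x) = opexp T w (T x).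
Proof.
apply: opexp_comm (bop_ge0 TM) (bopD TM) (bop_bound TM) _ => k y.
by rewrite (bopZ TM) -iterSr.
Qed.

Lemma opexp_iter w k x : iter k T (opexp T w x) = opexp T w (iter k T x).
Proof. by elim: k => //= k ->; rewrite opexpT. Qed.

Lemma opexp_first_order w x :
  N (opexp T w x - x - w *: T x) <= r w ^+ 2 * expR (r w) * N x.
Proof.
have := opexpP w 2 x.
rewrite /pexp big_nat_recr//= big_nat1 expr0 divr1 scale1r expr1 divr1 opprD addrA.
by move=> /le_trans; apply; rewrite ler_wpM2r ?rnorm_ge0// exp_tail_le.
Qed.

(** The difference is the sum over the square of indices minus the triangle i + j < n. Its norm is
    at most the same expression for the scalar series, where the square is a product of two partial
    sums and hence at most [expR (r w + r w')]. *)
Lemma pexpM w w' n x :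
  N (pexp T w n (pexp T w' n x) - pexp T (w + w') n x) <= exp_tail (r w + r w') n * N x.
Proof.
pose a (u : R[i]) k := u ^+ k / k`!%:R.
pose b (u : R[i]) k : R := r u ^+ k / k`!%:R.
pose F i j := (a w i * a w' j) *: iter (i + j) T x.
have -> : pexp T w n (pexp T w' n x) = \sum_(0 <= i < n) \sum_(0 <= j < n) F i j.
  apply: eq_bigr => i _; rewrite (bop_sum (bop_iter TM i)) scaler_sumr.
  apply: eq_bigr => j _; rewrite (bopZ (bop_iter TM i)) scalerA /F.
  by rewrite iterD.
have -> : pexp T (w + w') n x = \sum_(0 <= i < n) \sum_(0 <= j < n - i) F i j.
  rewrite -(big_antidiagonal F); apply: eq_bigr => k _.
  rewrite -exp_binomial scaler_suml; apply: eq_big_nat => i /andP[_ ik].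
  by rewrite /F subnKC.
have split2 (Z : zmodType) (G : nat -> nat -> Z) :
    \sum_(0 <= i < n) \sum_(0 <= j < n) G i j -
    \sum_(0 <= i < n) \sum_(0 <= j < n - i) G i j =
    \sum_(0 <= i < n) \sum_(n - i <= j < n) G i j.
  rewrite -sumrB; apply: eq_bigr => i _.
  by rewrite (big_cat_nat (leq0n (n - i)) (leq_subr i n)) /= addrAC subrr add0r.
rewrite split2.
apply: (@le_trans _ _
    ((\sum_(0 <= i < n) \sum_(n - i <= j < n) b w i * b w' j) * N x)).
  apply: le_trans (rnorm_sum _ _ _) _; rewrite mulr_suml; apply: ler_sum => i _.
  apply: le_trans (rnorm_sum _ _ _) _; rewrite mulr_suml; apply: ler_sum => j _.
  rewrite /F rnormZ /a /b /r !abscM !abscV !abscX !absc_nat !exprMn.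
  have := bop_bound (bop_iter TM (i + j)) x; rewrite exprD => h.
  set A := absc w ^+ i; set B := absc w' ^+ j.
  have -> : A * M ^+ i / i`!%:R * (B * M ^+ j / j`!%:R) * N x =
     A / i`!%:R * (B / j`!%:R) * (M ^+ i * M ^+ j * N x) by ring.
  by rewrite ler_wpM2l// !mulr_ge0 ?invr_ge0// exprn_ge0 ?absc_ge0.
rewrite ler_wpM2r ?rnorm_ge0// -split2 -(big_antidiagonal (fun i j => b w i * b w' j)).
have -> : \sum_(0 <= i < n) \sum_(0 <= j < n) b w i * b w' j =
    exp_sum (r w) n * exp_sum (r w') n.
  by rewrite /exp_sum mulr_suml; apply: eq_bigr => i _; rewrite mulr_sumr.
under eq_bigr do rewrite exp_binomial.
rewrite /exp_tail expRD lerD2r ler_pM ?exp_sum_ge0 ?exp_sum_le//.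
Qed.

Lemma opexpD w w' x : opexp T (w + w') x = opexp T w (opexp T w' x).
Proof.
symmetry; apply: opexp_uniq => e e0.
pose K := expR (r w) * N x + N (opexp T w' x) + N x + 1.
have K1 : 0 < K.
  by rewrite ltr_wpDl// !addr_ge0 ?mulr_ge0 ?rnorm_ge0 ?expR_ge0.
have eK : 0 < e / K by rewrite divr_gt0.
have [m1 h1] := exp_tail_cvg (r w) eK.
have [m2 h2] := exp_tail_cvg (r w') eK.
have [m3 h3] := exp_tail_cvg (r w + r w') eK.
exists (m1 + m2 + m3)%N => n nm.
have /h1/(le_trans (ler_norm _)) {}h1 : (m1 <= n)%N.
  by apply: leq_trans nm; rewrite -addnA leq_addr.
have /h2/(le_trans (ler_norm _)) {}h2 : (m2 <= n)%N.
  by apply: leq_trans nm; rewrite addnAC leq_addl.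
have /h3/(le_trans (ler_norm _)) {}h3 : (m3 <= n)%N.
  by apply: leq_trans nm; rewrite leq_addl.
have e1 := opexpP w n (opexp T w' x).
have e2 := pexp_bound w n (opexp T w' x - pexp T w' n x).
have e3 := opexpP w' n x.
have e4 := pexpM w w' n x.
have pB : pexp T w n (opexp T w' x - pexp T w' n x) =
    pexp T w n (opexp T w' x) - pexp T w n (pexp T w' n x).
  have := pexp_linear w n (-1) (pexp T w' n x) (opexp T w' x).
  by rewrite !scaleN1r addrC => ->; rewrite addrC.
rewrite pB in e2.
have s1 := exp_sum_le n (r_ge0 w).
have s0 := exp_sum_ge0 n (r_ge0 w).
set X := opexp T w (opexp T w' x) in e1 *.
set Y := pexp T w n (opexp T w' x) in e1 e2.
set Z := pexp T w n (pexp T w' n x) in e2 e4.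
have := rdist_triangle Y X (pexp T (w + w') n x).
have := rdist_triangle Z Y (pexp T (w + w') n x).
have h4 : N (Y - Z) <= e / K * (expR (r w) * N x).
  apply: le_trans e2 _; rewrite mulrCA ler_pM ?rnorm_ge0//.
  by apply: le_trans e3 _; rewrite ler_wpM2r ?rnorm_ge0.
have h5 : N (X - Y) <= e / K * N (opexp T w' x).
  by apply: le_trans e1 _; rewrite ler_wpM2r ?rnorm_ge0.
have h6 : N (Z - pexp T (w + w') n x) <= e / K * N x.
  by apply: le_trans e4 _; rewrite ler_wpM2r ?rnorm_ge0.
have -> : e = e / K * K by rewrite divfK// gt_eqF.
have : e / K * K = e / K * (expR (r w) * N x) + e / K * N (opexp T w' x) + e / K * N x + e / K.
  by rewrite {2}/K !mulrDr mulr1.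
move: h4 h5 h6 eK; lra.
Qed.

Lemma opexpNK w x : opexp T w (opexp T (- w) x) = x.
Proof. by rewrite -opexpD subrr opexp_0. Qed.

Lemma opexpKN w x : opexp T (- w) (opexp T w x) = x.
Proof. by rewrite -opexpD addNr opexp_0. Qed.

End Exp.
End OperatorExponential.

(** * Elementary inequalities that replace differential calculus *)

Section RealTools.
Variable R : realType.

Lemma archi_nat (a : R) : exists n : nat, (0 < n)%N /\ a <= n%:R.
Proof.
exists (Num.bound `|a|).+1; split => //.
rewrite (le_trans (ler_norm a))// -natr1 ler_wpDr//.
by rewrite ltW// archi_boundP.
Qed.

Lemma archi_small (a e : R) : 0 < e -> exists n : nat, (0 < n)%N /\ a <= e * n%:R.
Proof.
move=> e0; have [n [n0 h]] := archi_nat (a / e); exists n; split => //.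
by move: h; rewrite ler_pdivrMr// mulrC.
Qed.

(** Passage to the limit e -> 0 under an error linear in e; m restricts e to the range in which an
    expansion is available. *)
Lemma le_of_le_small (a b c m : R) : 0 < m ->
  (forall e : R, 0 < e -> e <= m -> a <= b + c * e) -> a <= b.
Proof.
move=> m0 h; apply/ler_addgt0Pr => /= e e0.
have c0 : 0 < `|c| + 1 by rewrite ltr_wpDl.
pose d := Num.min m (e / (`|c| + 1)).
have d0 : 0 < d by rewrite lt_min m0 divr_gt0.
have d1 : d <= m by rewrite ge_min lexx.
have de : d <= e / (`|c| + 1) by rewrite ge_min lexx orbT.
apply: le_trans (h d d0 d1) _; rewrite lerD2l.
apply: (@le_trans _ _ ((`|c| + 1) * d)).
  by rewrite ler_pM2r// ler_wpDr// ler_norm.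
by rewrite mulrC -ler_pdivlMr.
Qed.

Lemma expr_1D_le (u : R) n : 0 <= u -> (1 + u) ^+ n <= expR (n%:R * u).
Proof.
by move=> u0; rewrite expRM_natl lerXn2r ?nnegrE ?expR_ge0 ?expR_ge1Dx ?addr_ge0.
Qed.

Lemma expR_le_1D2 (u : R) : 0 <= u -> u <= 1/2 -> expR u <= 1 + 2 * u.
Proof.
move=> u0 u1; have := expR_ge1Dx (- u); rewrite expRN => h.
have e0 := expR_gt0 u.
have : (1 - u) * expR u <= 1 by rewrite -ler_pdivlMr// mul1r.
nra.
Qed.

Lemma bernoulli (u : R) n : 0 <= u -> 1 + n%:R * u <= (1 + u) ^+ n.
Proof.
move=> u0; elim: n => [|n IHn]; first by rewrite mul0r addr0.
rewrite exprS -natr1; have : 0 <= n%:R :> R by [].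
nra.
Qed.

(** Second differences are nonnegative up to O(r^3). Adding d (s - a)^2 contributes 2 d r^2, which
    beats the cubic error for small r, so the perturbed function has no interior maximum; d is
    chosen to make the perturbation at most e on [a, c]. *)
Lemma quasi_convex (f : R -> R) (a b c : R) : a <= b -> b <= c -> continuous f ->
  (forall s, exists C : R, forall r : R, 0 <= r -> r <= 1 ->
     2 * f s <= f (s + r) + f (s - r) + C * r ^+ 3) ->
  f b <= Num.max (f a) (f c).
Proof.
move=> ab bc fc fC; apply/ler_addgt0Pr => /= e e0.
have ma : f a <= Num.max (f a) (f c) by rewrite le_max lexx.
have mc : f c <= Num.max (f a) (f c) by rewrite le_max lexx orbT.
have [ca|ca] := leP c a.
  have -> : b = a by lra.
  by lra.
pose d := e / ((c - a) ^+ 2 + 1).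
have q0 : 0 < (c - a) ^+ 2 + 1 by rewrite ltr_wpDl// sqr_ge0.
have d0 : 0 < d by rewrite divr_gt0.
pose g s := f s + d * (s - a) ^+ 2.
have gc : continuous g.
  move=> s; apply: cvgD; first exact: fc.
  apply: cvgM; first exact: cvg_cst.
  have h : (fun s : R => (s - a)) @ s --> s - a by apply: cvgB; [exact: cvg_id|exact: cvg_cst].
  exact: (cvgM h h).
have [|s sac smax] := @EVT_max R g a c (ltW ca).
  exact: continuous_subspaceT.
have gb : g b <= g s by apply: smax; rewrite in_itv /= ab.
have fbg : f b <= g b by rewrite lerDl mulr_ge0 ?sqr_ge0// ltW.
have ga : g a = f a by rewrite /g subrr expr0n mulr0 addr0.
have gce : g c <= f c + e.
  have <- : d * ((c - a) ^+ 2 + 1) = e by rewrite divfK ?gt_eqF.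
  by rewrite /g mulrDr mulr1 lerD2l lerDl ltW.
have [sa|sa] := eqVneq s a.
  by move: gb; rewrite sa ga; lra.
have [sc|sc] := eqVneq s c.
  by move: gb; rewrite sc; lra.
exfalso; move: sac; rewrite in_itv /= => /andP[sa' sc'].
have as0 : 0 < s - a by rewrite subr_gt0 lt_def sa.
have sc0 : 0 < c - s by rewrite subr_gt0 lt_def eq_sym sc.
have [C hC] := fC s.
have C0 : 0 < `|C| + 1 by rewrite ltr_wpDl.
pose r := Num.min (Num.min 1 (d / (`|C| + 1))) (Num.min (s - a) (c - s)).
have r0 : 0 < r by rewrite !lt_min ltr01 divr_gt0//= as0.
have [r1 rd ra rc] : [/\ r <= 1, r <= d / (`|C| + 1), r <= s - a & r <= c - s].
  by rewrite /r; split; rewrite !ge_min lexx ?orbT.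
have := hC r (ltW r0) r1.
have g1 : g (s + r) <= g s by apply: smax; rewrite in_itv /=; lra.
have g2 : g (s - r) <= g s by apply: smax; rewrite in_itv /=; lra.
move: g1 g2; rewrite /g => g1 g2 h.
have Cr : C * r ^+ 3 <= d * r ^+ 2.
  rewrite exprS mulrA ler_wpM2r ?sqr_ge0//.
  apply: (@le_trans _ _ ((`|C| + 1) * r)).
    by rewrite ler_wpM2r ?(ltW r0)// ler_wpDr// ler_norm.
  by rewrite mulrC -ler_pdivlMr.
have : 0 < d * r ^+ 2 by rewrite mulr_gt0// exprn_gt0.
nra.
Qed.

End RealTools.

Section QuadraticConst.
Variable R : realType.
Variable V : completeNormedModType R[i].
Local Notation N := (@rnorm R V).

(** A curve with zero derivative is constant: k steps of length t/k accumulate an error of order k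
    (t/k)^2. Identities between exponentials are proved below by this device. *)
Lemma quadratic_const (g : R -> V) (C t d : R) : 0 < d ->
  (forall s h, `|s| <= `|t| -> `|h| <= d -> N (g (s + h) - g s) <= C * h ^+ 2) ->
  g t = g 0.
Proof.
move=> d0 gC; apply/eqP; rewrite -subr_eq0; apply/eqP; apply: rnorm_le0 => e e0.
have [n [n0 hn]] := archi_small (`|C| * t ^+ 2) e0.
have [m [m0 hm]] := archi_small `|t| d0.
pose k := (n * m)%N.
have k0 : 0 < k%:R :> R by rewrite ltr0n muln_gt0 n0.
pose h := t / k%:R.
have hk : k%:R * h = t by rewrite mulrC divfK ?gt_eqF.
have h1 : `|h| <= d.
  rewrite normrM normfV (gtr0_norm k0) ler_pdivrMr//.
  by rewrite (le_trans hm)// ler_wpM2l ?(ltW d0)// ler_nat leq_pmull.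
have step j : (j <= k)%N -> N (g (j%:R * h) - g 0) <= j%:R * (`|C| * h ^+ 2).
  elim: j => [|j IHj] jk; first by rewrite !mul0r subrr rnorm0.
  have js : `|j%:R * h| <= `|t|.
    rewrite -hk !normrM ler_wpM2r// !normr_nat ler_nat ltnW//.
  have := gC _ _ js h1; have := IHj (ltnW jk).
  have := rdist_triangle (g (j%:R * h)) (g (j.+1%:R * h)) (g 0).
  have -> : j.+1%:R * h = j%:R * h + h by rewrite -natr1 mulrDl mul1r.
  have : C * h ^+ 2 <= `|C| * h ^+ 2 by rewrite ler_wpM2r ?sqr_ge0// ler_norm.
  rewrite -natr1; lra.
have := step k (leqnn k); rewrite hk => /le_trans; apply.
have -> : k%:R * (`|C| * h ^+ 2) = `|C| * t ^+ 2 / k%:R.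
  by rewrite /h; field; rewrite gt_eqF.
by rewrite ler_pdivrMr// (le_trans hn)// ler_wpM2l ?(ltW e0)// ler_nat leq_pmulr.
Qed.
End QuadraticConst.

(** * Roots of unity and Cauchy's estimate *)

Section RootsOfUnity.
Variable R : realType.

Lemma prim_root_complex n : (0 < n)%N -> exists z : R[i], n.-primitive_root z.
Proof.
move=> n0; pose p : {poly R[i]} := 'X^n - 1.
have [s Dp] := closed_field_poly_normal p.
rewrite (monicP _) ?monicXnsubC // scale1r in Dp.
have rn1: all n.-unity_root s by apply/allP=> z; rewrite -root_prod_XsubC -Dp.
have sz_s: (n < (size s).+1)%N.
  by rewrite -(size_prod_XsubC s id) -Dp size_XnsubC.
have [|z] := hasP (cyclic.has_prim_root n0 rn1 _ sz_s); last by exists z.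
by rewrite -separable.separable_prod_XsubC -Dp cyclotomic.separable_Xn_sub_1 // pnatr_eq0 -lt0n.
Qed.

Lemma prim_root_sum n (z : R[i]) k : n.-primitive_root z -> ~~ (n %| k)%N ->
  \sum_(j < n) z ^+ (j * k) = 0.
Proof.
move=> zn nk; have zk1 : z ^+ k != 1 by rewrite -(prim_order_dvd zn).
have := subrX1 (z ^+ k) n; rewrite exprAC (prim_expr_order zn) expr1n subrr.
move/esym/eqP; rewrite mulf_eq0 subr_eq0 (negPf zk1) /= => /eqP h; rewrite -[RHS]h.
by apply: eq_bigr => j _; rewrite mulnC exprM.
Qed.

Lemma prim_root_absc n (z : R[i]) : n.-primitive_root z -> absc z = 1.
Proof.
move=> zn; have n0 := prim_order_gt0 zn.
have := congr1 (@absc R) (prim_expr_order zn); rewrite abscX absc1 => /eqP.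
by rewrite pexprn_eq1 ?absc_ge0// => /orP[/eqP n00|/eqP//]; rewrite n00 in n0.
Qed.
End RootsOfUnity.

Section Cauchy.
Variable R : realType.
Variable V : completeNormedModType R[i].
Local Notation N := (@rnorm R V).
Variables (T : V -> V) (M : R).
Hypothesis TM : bounded_op T M.

(** The contour integral becomes an average over the n-th roots of unity. It is applied to the
    partial sum of order n > m, a polynomial of degree below n, from which it extracts the
    coefficient of index m exactly; the truncation error e is arbitrary. *)
Lemma cauchy_estimate (x : V) (r K : R) m : 0 < r ->
  (forall w, absc w = r -> N (opexp T w x) <= K) ->
  N (iter m T x) <= m`!%:R / r ^+ m * K.
Proof.
move=> r0 hK.
suff h : r ^+ m / m`!%:R * N (iter m T x) <= K.
  have f0 : m`!%:R != 0 :> R by rewrite pnatr_eq0 -lt0n fact_gt0.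
  have rm0 : r ^+ m != 0 by rewrite expf_neq0// gt_eqF.
  rewrite -[N _](mulKf (x := r ^+ m / m`!%:R)) ?mulf_neq0 ?invr_eq0// invf_div.
  by rewrite ler_wpM2l// divr_ge0// exprn_ge0// ltW.
apply/ler_addgt0Pr => /= e e0.
have N1 : 0 < N x + 1 by rewrite ltr_wpDl ?rnorm_ge0.
have [n0 hn0] := exp_tail_cvg (r * M) (divr_gt0 e0 N1).
pose n := (n0 + m).+1.
have mn : (m < n)%N by rewrite /n ltnS leq_addl.
have /hn0/(le_trans (ler_norm _)) {}hn0 : (n0 <= n)%N by rewrite /n -addnS leq_addr.
have [z zn] := prim_root_complex R (ltn0Sn (n0 + m)).
rewrite -/n in zn.
have z0 : z != 0 by rewrite (prim_root_eq0 zn).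
have zj j : absc (r%:C * z ^+ j) = r.
  by rewrite abscM abscX (prim_root_absc zn) expr1n mulr1 absc_real gtr0_norm.
have P j : N (pexp T (r%:C * z ^+ j) n x) <= K + e.
  have := opexpP TM (r%:C * z ^+ j) n x; rewrite zj => h1.
  have := hK _ (zj j); move: h1.
  have := rdist_triangle (opexp T (r%:C * z ^+ j) x) (pexp T (r%:C * z ^+ j) n x) 0.
  rewrite !subr0 rdistC.
  have : exp_tail (r * M) n * N x <= e.
    apply: (@le_trans _ _ (e / (N x + 1) * N x)); first by rewrite ler_wpM2r ?rnorm_ge0.
    by rewrite mulrAC ler_pdivrMr// ler_wpM2l ?(ltW e0)// lerDl.
  lra.
have key : \sum_(j < n) z ^- (j * m) *: pexp T (r%:C * z ^+ j) n x =
    (n%:R * (r%:C ^+ m / m`!%:R)) *: iter m T x.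
  transitivity (\sum_(j < n) \sum_(k < n)
      ((r%:C ^+ k / k`!%:R) * (z ^- (j * m) * z ^+ (j * k))) *: iter k T x).
    apply: eq_bigr => j _; rewrite /pexp big_mkord scaler_sumr; apply: eq_bigr => k _.
    by rewrite scalerA exprMn -exprM; congr (_ *: _); ring.
  rewrite exchange_big /= (bigD1 (Ordinal mn)) //= [X in _ + X]big1 => [|k kn].
    rewrite addr0 -scaler_suml; congr (_ *: _).
    under eq_bigr do rewrite mulVf ?expf_neq0// mulr1.
    by rewrite sumr_const card_ord mulr_natl.
  rewrite -scaler_suml -mulr_sumr; set S := \sum_(i < n) _.
  suff -> : S = 0 by rewrite mulr0 scale0r.
  (* The exponent k - m shifted by n to stay a natural number: 0 < l < 2 n and l differs from n, so
     n does not divide l. *)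
  pose l := (k + (n - m))%N.
  transitivity (\sum_(j < n) z ^+ (j * l)).
    apply: eq_bigr => j _; apply: (@mulfI _ (z ^+ (j * m))); first by rewrite expf_neq0.
    rewrite mulrA divff ?expf_neq0// mul1r -exprD -mulnDr /l addnCA subnKC ?(ltnW mn)//.
    have zjn : z ^+ (j * n) = 1 by rewrite mulnC exprM (prim_expr_order zn) expr1n.
    by rewrite mulnDr exprD zjn mulr1.
  apply: (prim_root_sum zn); apply/negP => /dvdnP[q lq].
  have kl : (k < n)%N by [].
  have kl' : k != m :> nat by apply: contra kn => /eqP km; apply/eqP/val_inj.
  move/eqP: kl' lq (mn) kl; rewrite /l; case: q => [|[|q]].
  - by rewrite mul0n; lia.
  - by rewrite mul1n; lia.
  - by rewrite !mulSn; lia.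
have : N (\sum_(j < n) z ^- (j * m) *: pexp T (r%:C * z ^+ j) n x) <= n%:R * (K + e).
  apply: le_trans (rnorm_sum _ _ _) _.
  have -> : n%:R * (K + e) = \sum_(j < n) (K + e) by rewrite sumr_const card_ord mulr_natl.
  apply: ler_sum => j _; rewrite rnormZ abscV abscX (prim_root_absc zn) expr1n invr1 mul1r.
  exact: P.
rewrite key rnormZ !abscM abscV !absc_nat abscX absc_real (gtr0_norm r0) -!mulrA.
by rewrite ler_pM2l ?ltr0n// mulrA.
Qed.
End Cauchy.

(** * Hermitian operators *)

Section Hermitian.
Variable R : realType.
Variable V : completeNormedModType R[i].
Local Notation N := (@rnorm R V).

Lemma rnorm_sublinear : sublinear N.
Proof.
by split=> [x y|r x r0]; [exact: rnormD|rewrite rnormZr ger0_norm].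
Qed.

Lemma cfunctional_continuous (f : V -> R[i]) :
  (forall l y z, f (l *: y + z) = l * f y + f z) ->
  (forall y, `|f y| <= `|y|) -> continuous (f : V -> R[i]^o).
Proof.
move=> fl fb x; apply/cvgrPdist_le => e e0; near=> y.
have -> : f x - f y = f (x - y).
  by rewrite [in RHS]addrC -[- y]scaleN1r fl mulN1r addrC.
apply: le_trans (fb _) _; near: y.
by have /cvgrPdist_le := @cvg_id _ (nbhs x); exact.
Unshelve. all: by end_near. Qed.

(** The complex functional with real part g is f y = g y - i g (i y). Rotating y until f y is real
    and nonnegative bounds |f y| by g; finally f x has real part 1 and modulus at most 1. *)
Lemma complex_support (x : V) : N x = 1 ->
  exists f : V -> R[i], [/\ is_cfunctional f, forall y, `|f y| <= `|y| & f x = 1].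
Proof.
move=> x1; have [g [[gD gZ] gN gx]] := support_functional x rnorm_sublinear.
pose f y : R[i] := (g y)%:C - 'i * (g ('i *: y))%:C.
have fRe y : complex.Re (f y) = g y by rewrite /f /=; ring.
have gD' y z : g (y + z) = g y + g z by rewrite gD.
have gN' y : g (- y) = - g y.
  by rewrite -scaleN1r -(rmorphN1 (real_complex R)) gZ// mulN1r.
have fl l y z : f (l *: y + z) = l * f y + f z.
  have lE : l = (complex.Re l)%:C + 'i * (complex.Im l)%:C by exact: complexE.
  set a := complex.Re l in lE; set b := complex.Im l in lE.
  have E1 : l *: y + z = a%:C *: y + (b%:C *: ('i *: y)) + z.
    by rewrite {1}lE; vring.
  have ii : 'i * 'i = -1 :> R[i] by rewrite -expr2 sqr_i.
  have E2 : 'i *: (l *: y + z) = a%:C *: ('i *: y) - b%:C *: y + 'i *: z.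
    rewrite {1}lE scalerDr scalerA mulrDr mulrA ii; vring.
  rewrite /f E2 E1 !gD' gN' !gZ// lE.
  rewrite !rmorphD !rmorphN !rmorphM.
  have -> : ((a%:C + 'i * b%:C) * ((g y)%:C - 'i * (g ('i *: y))%:C) =
    a%:C * (g y)%:C - ('i * 'i) * b%:C * (g ('i *: y))%:C
    + 'i * (b%:C * (g y)%:C - a%:C * (g ('i *: y))%:C))%R by ring.
  rewrite ii; ring.
have fb y : `|f y| <= `|y|.
  have [->|fy0] := eqVneq (f y) 0; first by rewrite normr0.
  pose c := `|f y| / f y.
  have c1 : absc c = 1.
    have /(congr1 (@complex.Re R)) : `|c| = 1.
      by rewrite /c normrM normr_id normfV divff// normr_eq0.
    by [].
  have cf : f (c *: y) = `|f y|.
    have := fl c y 0; rewrite addr0 => ->.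
    have -> : f 0 = 0.
      by have := fl 0 y 0; rewrite scale0r addr0 mul0r add0r => h; have := fl (-1) 0 0; rewrite scaler0 addr0 mulN1r addNr.
    by rewrite addr0 /c divfK.
  rewrite abscE rnormE lecR /absc -cf fRe; apply: le_trans (gN _) _.
  by rewrite rnormZ c1 mul1r.
exists f; split => //; first by split => //; exact: cfunctional_continuous.
have fx : complex.Re (f x) = 1 by rewrite fRe gx.
have := fb x; rewrite rnormE x1 normc_def lecR fx expr1n => h.
have h2 : 1 + complex.Im (f x) ^+ 2 <= 1.
  rewrite -(@ler_sqrt _ _ 1)// ?sqrtr1//.
have : complex.Im (f x) ^+ 2 = 0.
  by apply/eqP; rewrite eq_le sqr_ge0 andbT; lra.
move/eqP; rewrite sqrf_eq0 => /eqP Im0.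
by rewrite [f x]complexE fx Im0 mulr0 addr0.
Qed.

Section HermOp.
Variables (T : V -> V) (M : R).
Hypotheses (TM : bounded_op T M) (Th : Defs.hermitian T).

(** For f supporting the unit vector u = x / |x|, the value f (u + i s T u) = 1 + i s f (T u) has
    real part 1, because f (T u) is real. *)
Lemma hermitian_lower (s : R) x : N x <= N (x + (s%:C * 'i) *: T x).
Proof.
have [->|x0] := eqVneq x 0; first by rewrite rnorm0 rnorm_ge0.
have n0 := rnorm_gt0 x0.
pose u := ((N x)^-1)%:C *: x.
have u1 : N u = 1 by rewrite rnormZr ger0_norm ?invr_ge0 ?rnorm_ge0// mulVf ?gt_eqF.
have [f [fc fb fu]] := complex_support u1.
have fl := fc.1.
have u1' : `|u| = 1 by rewrite rnormE u1.
have /complex_realP[k fTu] : f (T u) \is Num.real by exact: (Th u1').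
have xu : x = (N x)%:C *: u.
  by rewrite /u scalerA -rmorphM divff ?gt_eqF// scale1r.
have -> : x + (s%:C * 'i) *: T x = (N x)%:C *: ((s%:C * 'i) *: T u + u).
  by rewrite {1 2}xu (bopZ TM); vring.
rewrite rnormZr ger0_norm ?rnorm_ge0//.
rewrite ler_peMr ?rnorm_ge0// -lecR -rnormE; apply: le_trans (fb _).
rewrite fl fu fTu abscE lecR; apply: le_trans (Re_le_absc _).
by rewrite /= !(mul0r, mulr0, mulr1, add0r, addr0, subr0, oppr0) lexx.
Qed.

(** The lower bound with - s at y = (1 + i s T) x, since (1 - i s T) (1 + i s T) = 1 + s^2 T^2. *)
Lemma hermitian_upper (s : R) x :
  N (x + (s%:C * 'i) *: T x) <= (1 + s ^+ 2 * M ^+ 2) * N x.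
Proof.
set y := _ + _; have := hermitian_lower (- s) y.
have ii : 'i * 'i = -1 :> R[i] by rewrite -expr2 sqr_i.
have -> : y + ((- s)%:C * 'i) *: T y = x + (s ^+ 2)%:C *: T (T x).
  rewrite /y (bopD TM) (bopZ TM) scalerDr scalerA.
  have -> : (- s)%:C * 'i * (s%:C * 'i) = (s ^+ 2)%:C.
    rewrite rmorphN rmorphXn.
    by transitivity (- (s%:C ^+ 2) * ('i * 'i)); [ring|rewrite ii; ring].
  by rewrite rmorphN; vring.
move/le_trans; apply; apply: le_trans (rnormD _ _) _.
rewrite rnormZr ger0_norm ?sqr_ge0// mulrDl mul1r lerD2l -mulrA ler_wpM2l ?sqr_ge0//.
exact: (bop_bound (bop_iter TM 2)).
Qed.

Lemma hermitian_shift (c : R) : Defs.hermitian (fun x => T x + c%:C *: x).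
Proof.
move=> x f x1 fc fb fx; have fl := fc.1.
by rewrite addrC fl fx mulr1 realD// ?(Th x1)// complex_real.
Qed.

(** Two lower bounds, for h and for - h, lead from 1 - h^2 T^2 to (1 + h^2 T^2) (1 - h^2 T^2) = 1 -
    h^4 T^4, which leaves only a fourth-order error. *)
Lemma hermitian_second (h : R) x : N (x - (h ^+ 2)%:C *: T (T x)) <=
  (1 + h ^+ 4 * M ^+ 4) * N x.
Proof.
set y := _ - _.
have := hermitian_lower h y; set z := y + _ => yz.
have := hermitian_lower (- h) z.
have ii : 'i * 'i = -1 :> R[i] by rewrite -expr2 sqr_i.
have -> : z + ((- h)%:C * 'i) *: T z = x - (h ^+ 4)%:C *: T (T (T (T x))).
  have -> : z + ((- h)%:C * 'i) *: T z = y + (h ^+ 2)%:C *: T (T y).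
    have -> : T z = T y + (h%:C * 'i) *: T (T y) by rewrite -(bopZ TM) -(bopD TM).
    rewrite /z scalerDr scalerA.
    have -> : (- h)%:C * 'i * (h%:C * 'i) = (h ^+ 2)%:C.
      rewrite rmorphN rmorphXn.
      by transitivity (- (h%:C ^+ 2) * ('i * 'i)); [ring|rewrite ii; ring].
    by rewrite rmorphN; vring.
  by rewrite /y !(bopB TM, bopZ TM) !rmorphXn; vring.
move=> zx; apply: le_trans yz _; apply: le_trans zx _; apply: le_trans (rnormB _ _) _.
have h4 : 0 <= h ^+ 4 by rewrite (_ : 4 = 2 * 2)%N// exprM sqr_ge0.
rewrite rnormZr ger0_norm// mulrDl mul1r lerD2l -mulrA ler_wpM2l//.
exact: (bop_bound (bop_iter TM 4)).
Qed.

End HermOp.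

Section Taylor.
Variables (T : V -> V) (M : R).
Hypotheses (TM : bounded_op T M).

Lemma opexp_taylor w x : absc w <= 1 ->
  N (opexp T w x - x - w *: T x) <= M ^+ 2 * expR M * absc w ^+ 2 * N x.
Proof.
move=> w1; apply: le_trans (opexp_first_order TM w x) _.
have M0 := bop_ge0 TM; have a0 := absc_ge0 w.
rewrite ler_wpM2r ?rnorm_ge0//.
have -> : (absc w * M) ^+ 2 * expR (absc w * M) =
  M ^+ 2 * absc w ^+ 2 * expR (absc w * M) by ring.
have -> : M ^+ 2 * expR M * absc w ^+ 2 = M ^+ 2 * absc w ^+ 2 * expR M by ring.
by rewrite ler_wpM2l ?mulr_ge0 ?exprn_ge0// ler_expR ler_piMl.
Qed.

Lemma opexp_le w x : absc w <= 1 -> N (opexp T w x) <= expR M * N x.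
Proof.
move=> w1; apply: le_trans (bop_bound (opexp_bop TM w) x) _.
rewrite ler_wpM2r ?rnorm_ge0// ler_expR.
by rewrite ler_piMl// (bop_ge0 TM).
Qed.

Lemma opexp_curve_continuous x : continuous (fun s : R => N (opexp T s%:C x)).
Proof.
move=> s; apply/cvgrPdist_le => e e0.
pose y := opexp T s%:C x.
pose K := (M + M ^+ 2 * expR M) * N y + 1.
have M0 := bop_ge0 TM.
have K1 : 0 < K.
  by rewrite ltr_wpDl// mulr_ge0 ?rnorm_ge0// addr_ge0// mulr_ge0 ?expR_ge0// exprn_ge0.
near=> t.
have h1 : `|s - t| <= 1.
  near: t; have /cvgrPdist_le := @cvg_id _ (nbhs s); exact.
have h2 : `|s - t| <= e / K.
  near: t; have /cvgrPdist_le := @cvg_id _ (nbhs s); apply; exact: divr_gt0.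
have -> : opexp T t%:C x = opexp T (t - s)%:C y.
  by rewrite /y -(opexpD TM) -rmorphD subrK.
rewrite -/y; set z := opexp T _ y.
have zy : N (y - z) <= K * `|s - t|.
  have w1 : absc (t - s)%:C <= 1 by rewrite absc_real distrC.
  have := opexp_taylor y w1; rewrite absc_real distrC => h.
  have -> : y - z = - ((z - y - (t - s)%:C *: T y) + (t - s)%:C *: T y) by vring.
  rewrite rnormN; apply: le_trans (rnormD _ _) _.
  rewrite rnormZr (distrC t s).
  have h3 : `|s - t| * N (T y) <= `|s - t| * (M * N y) by rewrite ler_wpM2l// (bop_bound TM).
  have h4 : M ^+ 2 * expR M * `|s - t| ^+ 2 * N y <= `|s - t| * (M ^+ 2 * expR M * N y).
    rewrite mulrAC [X in _ <= X]mulrC ler_wpM2l ?mulr_ge0 ?rnorm_ge0 ?expR_ge0 ?exprn_ge0//.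
    by rewrite expr2 ler_piMl.
  have h5 : K * `|s - t| = `|s - t| * (M * N y) + `|s - t| * (M ^+ 2 * expR M * N y) + `|s - t|.
    by rewrite /K; ring.
  have := normr_ge0 (s - t); lra.
have zyB : `|N y - N z| <= N (y - z).
  rewrite ler_norml; apply/andP; split.
    by have := rdist_triangle y z 0; rewrite !subr0 (rdistC z); lra.
  by have := rdist_triangle z y 0; rewrite !subr0; lra.
apply: le_trans zyB _; apply: le_trans zy _.
by rewrite mulrC -ler_pdivlMr.
Unshelve. all: by end_near. Qed.
End Taylor.

(** A factor 1 + C h^2 over a step h = s/k is raised to the power k, and (1 + C (s/k)^2)^k tends to
    1. *)
Lemma opexp_growth (T : V -> V) (M C d : R) (w : R[i]) :
  bounded_op T M -> 0 < d -> 0 <= C ->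
  (forall (h : R) x, 0 <= h -> h <= d ->
     N (opexp T (h%:C * w) x) <= (1 + C * h ^+ 2) * N x) ->
  forall (s : R) x, 0 <= s -> N (opexp T (s%:C * w) x) <= N x.
Proof.
move=> TM d0 C0 hT s x s0; apply: (le_of_le_small (c := 2 * N x) ltr01) => e e0 e1.
have [n [n0 hn]] := archi_small s d0.
have [m [m0 hm]] := archi_small (2 * C * s ^+ 2) e0.
pose k := (n * m)%N.
have k0 : 0 < k%:R :> R by rewrite ltr0n muln_gt0 n0.
pose h := s / k%:R.
have h0 : 0 <= h by rewrite divr_ge0// ltW.
have hd : h <= d.
  by rewrite ler_pdivrMr// (le_trans hn)// ler_wpM2l ?(ltW d0)// ler_nat leq_pmulr.
have step j : N (opexp T ((j%:R * h)%:C * w) x) <= (1 + C * h ^+ 2) ^+ j * N x.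
  elim: j => [|j IHj]; first by rewrite mul0r mul0r (opexp_0 TM) mul1r.
  have -> : (j.+1%:R * h)%:C * w = h%:C * w + (j%:R * h)%:C * w.
    by rewrite -mulrDl -rmorphD -natr1 mulrDl mul1r addrC.
  rewrite (opexpD TM) exprS -mulrA; apply: le_trans (hT _ _ h0 hd) _.
  by rewrite ler_wpM2l// addr_ge0// mulr_ge0// sqr_ge0.
have := step k; have -> : k%:R * h = s by rewrite /h mulrC divfK ?gt_eqF.
move/le_trans; apply.
have q0 : 0 <= C * h ^+ 2 by rewrite mulr_ge0// sqr_ge0.
have kq : k%:R * (C * h ^+ 2) <= e / 2.
  have -> : k%:R * (C * h ^+ 2) = C * s ^+ 2 / k%:R by rewrite /h; field; rewrite gt_eqF.
  rewrite ler_pdivrMr//.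
  have : e * m%:R <= e * k%:R by rewrite ler_wpM2l ?(ltW e0)// ler_nat leq_pmull.
  lra.
have kq0 : 0 <= k%:R * (C * h ^+ 2) by rewrite mulr_ge0// ltW.
have u1 : k%:R * (C * h ^+ 2) <= 1 / 2 by lra.
have := expR_le_1D2 kq0 u1.
have := expr_1D_le k q0 => a1 a2.
have n0' := rnorm_ge0 x.
have : (1 + C * h ^+ 2) ^+ k * N x <= (1 + e) * N x by rewrite ler_wpM2r//; lra.
have : 0 <= e * N x by rewrite mulr_ge0// ltW.
lra.
Qed.

Section HermExp.
Variables (T : V -> V) (M : R).
Hypotheses (TM : bounded_op T M) (Th : Defs.hermitian T).
Let C := M ^+ 2 + M ^+ 2 * expR M.
Let M0 := bop_ge0 TM.
Let C0 : 0 <= C.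
Proof. by rewrite addr_ge0 ?mulr_ge0 ?expR_ge0 ?exprn_ge0. Qed.

(** [hermitian_upper] and the Taylor bound give norm at most 1 + O(h^2) for e^(ihT), and
    [opexp_growth] removes the error. The sign e treats both directions of time; the inverse turns
    contraction into isometry. *)
Lemma opexp_isometry (s : R) x : N (opexp T (s%:C * 'i) x) = N x.
Proof.
have le (e s' : R) y : `|e| = 1 -> 0 <= s' -> N (opexp T (s'%:C * (e%:C * 'i)) y) <= N y.
  move=> e1 s0; apply: (@opexp_growth T M C 1) => // h z h0 h1.
  have ah : absc (h%:C * (e%:C * 'i)) = h.
    by rewrite !abscM absci !absc_real e1 !mulr1 ger0_norm.
  have w1 : absc (h%:C * (e%:C * 'i)) <= 1 by rewrite ah.
  have := opexp_taylor TM z w1; rewrite ah => t1.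
  have := hermitian_upper TM Th (h * e) z.
  have -> : (h * e)%:C * 'i = h%:C * (e%:C * 'i) by rewrite rmorphM mulrA.
  have e2 : (h * e) ^+ 2 = h ^+ 2 by rewrite exprMn -[e ^+ 2]real_normK ?num_real// e1 expr1n mulr1.
  rewrite e2 => t2.
  have := rdist_triangle (z + (h%:C * (e%:C * 'i)) *: T z) (opexp T (h%:C * (e%:C * 'i)) z) 0.
  rewrite !subr0 opprD addrA.
  have -> : (1 + C * h ^+ 2) * N z = (1 + h ^+ 2 * M ^+ 2) * N z + M ^+ 2 * expR M * h ^+ 2 * N z.
    by rewrite /C; ring.
  lra.
have le2 (s' : R) y : N (opexp T (s'%:C * 'i) y) <= N y.
  have [s0|s0] := leP 0 s'.
    by have := le 1 s' y (normr1 _) s0; rewrite rmorph1 mul1r.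
  have Ns0 : 0 <= - s' by lra.
  have := le (-1) (- s') y; rewrite normrN1 => /(_ erefl Ns0).
  by rewrite mulrA -rmorphM mulrN1 opprK.
apply/le_anti; rewrite le2 /=.
have := le2 (- s) (opexp T (s%:C * 'i) x).
by rewrite rmorphN mulNr (opexpKN TM).
Qed.

Lemma opexp_norm_Re w x : N (opexp T w x) = N (opexp T (complex.Re w)%:C x).
Proof.
rewrite {1}[w]complexE addrC (opexpD TM).
by rewrite mulrC opexp_isometry.
Qed.

Lemma pexp3 w x :
  pexp T w 3 x = x + w *: T x + (w ^+ 2 / 2) *: T (T x).
Proof.
rewrite /pexp big_nat_recr//= big_nat_recr//= big_nat1 expr0 divr1 scale1r.
by rewrite expr1 divr1.
Qed.

(** With y = e^(sT) x and F = y - (r^2/2) T^2 y one has 4 y = e^(rT) y + e^(-rT) y + 2 F + O(r^3),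
    and |F| <= |y| + O(r^4) by [hermitian_second]. This is the second-difference condition of
    [quasi_convex]. *)
Lemma opexp_quasi_convex x (a b c : R) : a <= b -> b <= c ->
  N (opexp T b%:C x) <= Num.max (N (opexp T a%:C x)) (N (opexp T c%:C x)).
Proof.
move=> ab bc; apply: (quasi_convex (f := fun s => N (opexp T s%:C x)) ab bc).
  exact: opexp_curve_continuous TM x.
move=> s; pose y := opexp T s%:C x.
exists ((2 * (M ^+ 3 * expR M) + M ^+ 4) * N y) => r r0 r1.
have shift u : opexp T (s + u)%:C x = opexp T u%:C y.
  by rewrite addrC rmorphD (opexpD TM).
rewrite (shift r) (shift (- r)) -/y.
have ar : absc r%:C = r by rewrite absc_real ger0_norm.
have anr : absc (- r)%:C = r by rewrite absc_real normrN ger0_norm.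
have P3 w : absc w = r -> N (opexp T w y - pexp T w 3 y) <= M ^+ 3 * expR M * N y * r ^+ 3.
  move=> wr; apply: le_trans (opexpP TM w 3 y) _; rewrite wr.
  have rM0 : 0 <= r * M by rewrite mulr_ge0.
  rewrite mulrAC ler_wpM2r ?rnorm_ge0//; apply: le_trans (exp_tail_le 3 rM0) _.
  rewrite exprMn -mulrA [X in _ <= X]mulrC ler_wpM2l ?exprn_ge0//.
  by rewrite ler_wpM2l ?exprn_ge0// ler_expR ler_piMl.
have p1 := P3 _ ar; have p2 := P3 _ anr.
(* Chosen with h^2 = r^2/2, so that 2 F cancels the second-order terms of e^(rT) y + e^(-rT) y. *)
pose h : R := r * Num.sqrt (1 / 2).
have h2 : h ^+ 2 = r ^+ 2 / 2 by rewrite exprMn sqr_sqrtr// mul1r.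
have h4 : h ^+ 4 = r ^+ 4 / 4.
  by rewrite (_ : 4 = 2 * 2)%N// exprM h2 (exprM r 2 2); field.
have p3 := hermitian_second TM Th h y; rewrite h2 h4 in p3.
have nr : (- r)%:C = - r%:C by rewrite rmorphN.
rewrite pexp3 in p1; rewrite pexp3 nr sqrrN in p2.
have rr : (r ^+ 2 / 2)%:C = r%:C ^+ 2 / 2.
  by rewrite rmorphM fmorphV rmorphXn rmorph_nat.
rewrite rr in p3.
set A := opexp T r%:C y in p1 *; set B := opexp T (- r%:C) y in p2.
rewrite nr -/B.
set D1 := A - _ in p1; set D2 := B - _ in p2; set F := y - _ in p3.
have E : y + y + y + y = A + B - D1 - D2 + F + F.
  rewrite /D1 /D2 /F; set q := r%:C ^+ 2 / 2; set q' := r%:C.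
  move: (T y) (T (T y)) q q' A B {D1 D2 F p1 p2 p3 rr} => y1 y2 q q' A B.
  by vring.
have : N (y + y + y + y) = 4 * N y.
  have -> : y + y + y + y = (4 : R)%:C *: y by rewrite rmorph_nat; vring.
  by rewrite rnormZr ger0_norm.
rewrite E => e4.
clear h h2 h4 rr E; clearbody A B D1 D2 F.
have := rnormD (A + B - D1 - D2 + F) F.
have := rnormD (A + B - D1 - D2) F.
have := rnormB (A + B - D1) D2.
have := rnormB (A + B) D1.
have := rnormD A B.
have : r ^+ 4 <= r ^+ 3 by rewrite exprSr ler_piMr// exprn_ge0.
have M4 : 0 <= M ^+ 4 * N y by rewrite mulr_ge0 ?rnorm_ge0 ?exprn_ge0.
have : 0 <= r ^+ 3 by rewrite exprn_ge0.
move: p3 => p3; rewrite mulrDl mul1r in p3.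
have e5 : (r ^+ 4 / 4 * M ^+ 4 * N y) = r ^+ 4 * (M ^+ 4 * N y) / 4 by field.
rewrite e5 in p3.
have -> : (2 * (M ^+ 3 * expR M) + M ^+ 4) * N y * r ^+ 3 =
   2 * (M ^+ 3 * expR M * N y * r ^+ 3) + (M ^+ 4 * N y) * r ^+ 3 by ring.
move=> r30 r43; set m4 := M ^+ 4 * N y in p3 M4 *.
have : r ^+ 4 * m4 <= m4 * r ^+ 3 by rewrite mulrC ler_wpM2l.
have : 0 <= m4 * r ^+ 3 by rewrite mulr_ge0.
move: p1 p2 p3 e4; clear; lra.
Qed.

End HermExp.
End Hermitian.

(** * Uniform boundedness by nested balls *)

Section UniformBoundedness.
Variable R : realType.
Variable V : completeNormedModType R[i].
Local Notation N := (@rnorm R V).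

(** If no common bound exists, every ball contains a smaller ball on which some B n exceeds k.
    Shrinking balls for k = 0, 1, 2, ... close in on a point l at which the family is unbounded. *)
Lemma uniform_boundedness (B : nat -> V -> V) (K : nat -> R) :
  (forall n, bounded_op (B n) (K n)) ->
  (forall x, exists c : R, forall n, N (B n x) <= c) ->
  exists c : R, forall n x, N (B n x) <= c * N x.
Proof.
move=> BK Bpt; apply: contrapT => noc.
have hump (c : R) : exists n x, c * N x < N (B n x).
  apply: contrapT => h; apply: noc; exists c => n x; rewrite leNgt.
  by apply/negP => h2; apply: h; exists n, x.
have step (q : nat * {s : V * R | 0 < s.2}) :
    exists q' : {s : V * R | 0 < s.2},
    let s := sval q.2 in let s' := sval q' in
    [/\ N (s'.1 - s.1) <= s.2, s'.2 <= s.2 / 2 & exists n, forall z,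
      N (z - s'.1) <= 2 * s'.2 -> q.1%:R <= N (B n z)].
  case: q => k [[x r] /= r0].
  have [n [u hu]] := hump ((k%:R + 1) / r).
  have u0 : 0 < N u.
    have := rnorm_ge0 u; rewrite le_eqVlt => /orP[/eqP n0|//].
    move: hu; rewrite -n0 mulr0 => h; move: h.
    by rewrite (rnorm0_eq0 (esym n0)) (bop0 (BK n)) rnorm0 ltxx.
  pose v := (r / N u)%:C *: u.
  have vr : N v = r by rewrite rnormZr ger0_norm ?divr_ge0 ?rnorm_ge0 ?(ltW r0)// divfK ?gt_eqF.
  have Bv : k%:R + 1 <= N (B n v).
    rewrite (bopZ (BK n)) rnormZr ger0_norm ?divr_ge0 ?rnorm_ge0 ?(ltW r0)//.
    have := ler_wpM2l (ltW (divr_gt0 r0 u0)) (ltW hu).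
    rewrite (_ : r / N u * ((k%:R + 1) / r * N u) = k%:R + 1)//.
    by field; rewrite !gt_eqF.
  (* One of x + v and x - v works, since B n (2 v) has norm at least 2 (k + 1). *)
  have [x' x'r x'B] : exists2 x', N (x' - x) <= r & k%:R + 1 <= N (B n x').
    have [h|h] := leP (k%:R + 1) (N (B n (x + v))).
      by exists (x + v) => //; rewrite addrAC subrr add0r vr.
    exists (x - v); first by rewrite addrAC subrr add0r rnormN vr.
    have := rnormB (B n (x + v)) (B n (x - v)).
    rewrite -(bopB (BK n)).
    have -> : x + v - (x - v) = (2 : R)%:C *: v by rewrite rmorph_nat; vring.
    rewrite (bopZ (BK n)) rnormZr ger0_norm// => h2.
    by move: h h2 Bv; lra.
  have K0 := bop_ge0 (BK n).
  pose r' := Num.min (r / 2) ((2 * (K n + 1))^-1).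
  have Kn0 : 0 < 2 * (K n + 1) by rewrite mulr_gt0// ltr_wpDl.
  have r'0 : 0 < r' by rewrite lt_min divr_gt0// invr_gt0.
  exists (exist _ (x', r') r'0) => /=; split => //; first by rewrite ge_min lexx.
  exists n => z zx.
  have h1 : 2 * (K n + 1) * r' <= 1.
    by rewrite mulrC -ler_pdivlMr// mul1r ge_min lexx orbT.
  have := bop_bound (BK n) (z - x'); rewrite (bopB (BK n)).
  have := rdist_triangle (B n z) (B n x') 0; rewrite !subr0 rdistC.
  have : K n * N (z - x') <= K n * (2 * r') by rewrite ler_wpM2l.
  lra.
have [f fP] := choice step.
have r01 : 0 < (1 : R) by [].
pose s0 : {s : V * R | 0 < s.2} := exist (fun s : V * R => is_true (0 < s.2)) ((0 : V), (1 : R)) r01.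
pose fix s k := if k is k'.+1 then f (k', s k') else s0.
pose x k := (sval (s k)).1; pose r k := (sval (s k)).2.
have r0 k : 0 < r k by rewrite /r; case: (s k).
have sP k : [/\ N (x k.+1 - x k) <= r k, r k.+1 <= r k / 2 & exists n, forall z,
      N (z - x k.+1) <= 2 * r k.+1 -> k%:R <= N (B n z)] by exact: (fP (k, s k)).
have xr n k : N (x (n + k)%N - x n) <= 2 * (r n - r (n + k)%N).
  elim: k => [|k IHk]; first by rewrite addn0 !subrr rnorm0 mulr0.
  rewrite addnS; have [h1 h2 _] := sP (n + k)%N.
  by have := rdist_triangle (x (n + k)%N) (x (n + k).+1) (x n); lra.
have [|e e0|l hl] := @rnorm_complete R V x (fun n => 2 * r n).
- by move=> n k; apply: le_trans (xr n k) _; rewrite ler_pM2l// gerBl ltW.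
- have rn n : r n * (1 + n%:R) <= 1.
    elim: n => [|n IHn]; first by rewrite /r /= addr0 mulr1.
    have [_ h _] := sP n; have := r0 n; have := r0 n.+1.
    have n0 : 0 <= n%:R :> R by [].
    rewrite -natr1; nra.
  have [n [n0 hn]] := archi_small 2 e0; exists n.
  have := rn n; have := r0 n.
  have : 0 < n%:R :> R by rewrite ltr0n.
  move=> a b c; have : r n <= n%:R^-1.
    by rewrite -[_^-1]mul1r ler_pdivlMr//; nra.
  move=> d; apply: (@le_trans _ _ (2 / n%:R)); first by rewrite ler_pM2l.
  by rewrite ler_pdivrMr.
have [c hc] := Bpt l.
have [k [k0 ck]] := archi_nat (c + 1).
have [_ _ [n /(_ l (hl k.+1)) h]] := sP k.
by have := hc n; lra.
Qed.

End UniformBoundedness.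

(** * Contraction semigroups from nonnegative spectrum *)

Section Positivity.
Variable R : realType.
Variable V : completeNormedModType R[i].
Local Notation N := (@rnorm R V).

Lemma expR_small_bound (u : R) : `|u| <= 1 / 2 -> `|expR u - 1 - u| <= 2 * u ^+ 2.
Proof.
move=> u1; have := expR_ge1Dx u => h0; rewrite ger0_norm; last by lra.
have := expR_ge1Dx (- u); rewrite expRN => h.
have e0 := expR_gt0 u.
have : (1 - u) * expR u <= 1 by rewrite -ler_pdivlMr// mul1r.
move: u1; rewrite ler_norml => /andP[a b]; nra.
Qed.

Section Shift.
Variables (T : V -> V) (M c : R).
Hypothesis TM : bounded_op T M.
Let S x := T x + c%:C *: x.
Let SM : bounded_op S (M + `|c|). Proof. exact: bop_shift. Qed.

(** The curve e^(sS) e^(-cs) e^(-sT) x has increments O(h^2), because S - c - T = 0 annihilates the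
    first-order terms, and is therefore constant. *)
Lemma opexp_shift (t : R) x :
  opexp S t%:C x = (expR (c * t))%:C *: opexp T t%:C x.
Proof.
have M0 := bop_ge0 TM.
pose g (s : R) := opexp S s%:C ((expR (- (c * s)))%:C *: opexp T (- s)%:C x).
pose m := M + `|c|.
have m0 : 0 <= m by rewrite addr_ge0.
pose A := M ^+ 2 * expR M. pose A' := m ^+ 2 * expR m.
have A0 : 0 <= A by rewrite mulr_ge0 ?expR_ge0 ?exprn_ge0.
have A'0 : 0 <= A' by rewrite mulr_ge0 ?expR_ge0 ?exprn_ge0.
pose d : R := Num.min 1 (1 / 2 / (`|c| + 1)).
have c1 : 0 < `|c| + 1 by rewrite ltr_wpDl.
have d0 : 0 < d by rewrite lt_min ltr01 !divr_gt0.
(* The factor 3 bounds expR (- (c h)) and the last summand bounds (1 + c h) expR (- (c h)) - 1, both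
   for |c h| <= 1/2. *)
pose D := 3 * (A' * expR M + A * m + A + m * M) + (c ^+ 2 + 4 * c ^+ 2).
have incr h y : `|h| <= d -> N ((expR (- (c * h)))%:C *: opexp S h%:C (opexp T (- h)%:C y) - y)
    <= D * h ^+ 2 * N y.
  move=> hd; have h1 : `|h| <= 1 by rewrite (le_trans hd)// ge_min lexx.
  have ch : `|- (c * h)| <= 1 / 2.
    rewrite normrN normrM.
    have : `|h| * (`|c| + 1) <= 1 / 2.
      by rewrite -ler_pdivlMr// (le_trans hd)// ge_min lexx orbT.
    have := normr_ge0 h; have := normr_ge0 c; nra.
  pose e := expR (- (c * h)).
  have eb := expR_small_bound ch; rewrite -/e in eb.
  pose z := opexp T (- h)%:C y.
  have w1 : absc h%:C <= 1 by rewrite absc_real.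
  have w2 : absc (- h)%:C <= 1 by rewrite absc_real normrN.
  have t1 := opexp_taylor SM z w1; have t2 := opexp_taylor TM y w2.
  have t3 := opexp_le TM y w2.
  rewrite absc_real real_normK ?num_real// -/m -/A' in t1.
  rewrite absc_real normrN real_normK ?num_real// -/A -/z in t2.
  rewrite -/z in t3.
  set r1 := opexp S h%:C z - z - h%:C *: S z in t1.
  set r2 := z - y - (- h)%:C *: T y in t2.
  have zE : z = y - h%:C *: T y + r2 by rewrite /r2 rmorphN; vring.
  have SzE : S z = S y - h%:C *: S (T y) + S r2.
    by rewrite zE (bopD SM) (bopB SM) (bopZ SM).
  have E : e%:C *: opexp S h%:C z - y = e%:C *: (r1 + h%:C *: S r2 + r2 - (h ^+ 2)%:C *: S (T y))
      + ((e * (1 + c * h) - 1)%:C) *: y.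
    have -> : opexp S h%:C z = r1 + z + h%:C *: S z by rewrite /r1; vring.
    rewrite SzE {1}zE /S rmorphXn; clearbody r1 r2 e; rewrite !rmorphB !rmorphM !rmorphD !rmorphM rmorph1; vring.
  rewrite -/e -/z E; apply: le_trans (rnormD _ _) _; rewrite !rnormZr.
  have e2 : `|e * (1 + c * h) - 1| <= (c ^+ 2 + 4 * c ^+ 2) * h ^+ 2.
    have -> : e * (1 + c * h) - 1 = (e - 1 - (- (c * h))) * (1 + c * h) - c ^+ 2 * h ^+ 2 by ring.
    apply: le_trans (ler_normB _ _) _; rewrite normrM.
    have k1 : `|1 + c * h| <= 2.
      by apply: le_trans (ler_normD _ _) _; rewrite normr1 -[`|c * h|]normrN; lra.
    have : `|e - 1 - - (c * h)| * `|1 + c * h| <= 2 * (- (c * h)) ^+ 2 * 2.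
      by rewrite ler_pM.
    have -> : `|c ^+ 2 * h ^+ 2| = c ^+ 2 * h ^+ 2 by rewrite (ger0_norm (mulr_ge0 (sqr_ge0 _) (sqr_ge0 _))).
    rewrite sqrrN exprMn; lra.
  have e3 : `|e| <= 3.
    rewrite ger0_norm ?expR_ge0//; move: eb; rewrite ler_norml => /andP[_].
    have : (- (c * h)) ^+ 2 <= 1 / 4 by rewrite -real_normK ?num_real//; have := normr_ge0 (- (c * h)); nra.
    by have := ler_norm (- (c * h)); lra.
  have e4 : `|h| * N (S r2) <= A * m * h ^+ 2 * N y.
    apply: (@le_trans _ _ (1 * (m * (A * h ^+ 2 * N y)))); last by rewrite mul1r; lra.
    rewrite ler_pM ?rnorm_ge0//; apply: le_trans (bop_bound SM _) _.
    by rewrite ler_wpM2l.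
  have e5 : `|h ^+ 2| * N (S (T y)) <= m * M * h ^+ 2 * N y.
    rewrite ger0_norm ?sqr_ge0//.
    rewrite [X in _ <= X](_ : _ = h ^+ 2 * (m * (M * N y))); last by ring.
    rewrite ler_wpM2l ?sqr_ge0//; apply: le_trans (bop_bound SM _) _.
    by rewrite ler_wpM2l// (bop_bound TM).
  have e6 : N r1 <= A' * expR M * h ^+ 2 * N y.
    apply: le_trans t1 _; rewrite [X in _ <= X](_ : _ = A' * h ^+ 2 * (expR M * N y)); last by ring.
    by rewrite ler_wpM2l// mulr_ge0// sqr_ge0.
  have := rnormB (r1 + h%:C *: S r2 + r2) ((h ^+ 2)%:C *: S (T y)).
  have := rnormD (r1 + h%:C *: S r2) r2.
  have := rnormD r1 (h%:C *: S r2).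
  rewrite !rnormZr => b1 b2 b3.
  set q := r1 + _ + _ - _ in b3 *.
  have b4 : N q <= (A' * expR M + A * m + A + m * M) * h ^+ 2 * N y by lra.
  have b5 : `|e| * N q <= 3 * ((A' * expR M + A * m + A + m * M) * h ^+ 2 * N y).
    by rewrite ler_pM ?rnorm_ge0.
  have b6 : `|e * (1 + c * h) - 1| * N y <= (c ^+ 2 + 4 * c ^+ 2) * h ^+ 2 * N y.
    by rewrite ler_wpM2r ?rnorm_ge0.
  rewrite /D; move: b5 b6; lra.
have g0 : g 0 = x by rewrite /g mulr0 oppr0 expR0 scale1r (opexp_0 TM) (opexp_0 SM).
have gt : g t = x.
  rewrite -g0.
  pose G := expR (`|t| * m) * (expR (`|c| * `|t|) * (expR (`|t| * M) * N x)).
  apply: (@quadratic_const R V g (G * D) t d d0) => s h st hd.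
  pose y := opexp T (- s)%:C x.
  have -> : g (s + h) - g s = opexp S s%:C ((expR (- (c * s)))%:C *:
      ((expR (- (c * h)))%:C *: opexp S h%:C (opexp T (- h)%:C y) - y)).
    rewrite /g -/y scalerBr (bopB (opexp_bop SM _)); congr (_ - _).
    have -> : opexp T (- (s + h))%:C x = opexp T (- h)%:C y.
      by rewrite /y -(opexpD TM) -rmorphD opprD addrC.
    rewrite rmorphD (opexpD SM) mulrDr opprD expRD rmorphM.
    by rewrite -scalerA !(bopZ (opexp_bop SM _)).
  apply: le_trans (bop_bound (opexp_bop SM _) _) _.
  rewrite absc_real rnormZr (ger0_norm (expR_ge0 _)).
  have D0 : 0 <= D.
    rewrite /D; apply: addr_ge0; last by have := sqr_ge0 c; lra.
    by rewrite mulr_ge0// !addr_ge0// mulr_ge0// expR_ge0.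
  have yx : N y <= expR (`|t| * M) * N x.
    apply: le_trans (bop_bound (opexp_bop TM _) _) _; rewrite ler_wpM2r ?rnorm_ge0// ler_expR.
    by rewrite absc_real normrN ler_wpM2r.
  have -> : G * D * h ^+ 2 = expR (`|t| * m) * (expR (`|c| * `|t|) *
     (D * h ^+ 2 * (expR (`|t| * M) * N x))) by rewrite /G; ring.
  rewrite -/m ler_pM ?mulr_ge0 ?expR_ge0 ?rnorm_ge0 ?ler_expR ?ler_wpM2r//.
  rewrite ler_pM ?expR_ge0 ?rnorm_ge0// ?ler_expR.
    by rewrite (le_trans (ler_norm _))// normrN normrM ler_wpM2l.
  apply: le_trans (incr _ _ hd) _.
  by rewrite ler_wpM2l// mulr_ge0// sqr_ge0.
move: gt; rewrite /g rmorphN.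
set u := expR _ => gt.
have {2}<- : opexp S t%:C (u%:C *: opexp T (- t%:C) x) = x by [].
rewrite (bopZ (opexp_bop SM _)) (bopZ (opexp_bop TM _)) scalerA -rmorphM /u -expRD subrr expR0 scale1r.
rewrite (@opexp_comm R V S _ SM (opexp T t%:C) (expR (absc t%:C * M)) t%:C t%:C).
- by rewrite (opexpNK TM).
- exact: expR_ge0.
- exact: bopD (opexp_bop TM _).
- exact: bop_bound (opexp_bop TM _).
- move=> k y; rewrite (bopZ (opexp_bop TM _)); congr (_ *: _).
  elim: k => //= k <-.
  by rewrite /S (bopD (opexp_bop TM _)) (bopZ (opexp_bop TM _)) (opexpT TM).
Qed.
End Shift.

(** As e^(-hT) is a contraction and maps x + h T x to x + O(h^2), the norm of x + h T x is at least
    |x| - O(h^2). Writing x + h T x = h (T x + d x) + (1 - h d) x and dividing by h gives the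
    bound. *)
Lemma resolvent_bound (T : V -> V) (M d : R) x : bounded_op T M -> 0 < d ->
  (forall (t : R) x, 0 <= t -> N (opexp T (- t)%:C x) <= N x) ->
  d * N x <= N (T x + d%:C *: x).
Proof.
move=> TM d0 cT; have M0 := bop_ge0 TM.
pose A := M ^+ 2 * expR M.
have A0 : 0 <= A by rewrite mulr_ge0 ?expR_ge0 ?exprn_ge0.
pose C := A * N x + A * (M * N x) + M * (M * N x).
pose m := Num.min 1 d^-1.
have m0 : 0 < m by rewrite lt_min ltr01 invr_gt0.
apply: (le_of_le_small (c := C) m0) => h h0 hm.
have h1 : h <= 1 by rewrite (le_trans hm)// ge_min lexx.
have hd : h * d <= 1.
  by rewrite -ler_pdivlMr// mul1r (le_trans hm)// ge_min lexx orbT.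
pose E := opexp T (- h)%:C.
have w1 : absc (- h)%:C <= 1 by rewrite absc_real normrN gtr0_norm.
have ah : absc (- h)%:C = h by rewrite absc_real normrN gtr0_norm.
have t1 := opexp_taylor TM x w1; have t2 := opexp_taylor TM (T x) w1.
rewrite ah -/A in t1 t2.
set r1 := _ - _ in t1; set r2 := _ - _ in t2.
have EE : E (x + h%:C *: T x) = x + r1 + h%:C *: r2 - (h ^+ 2)%:C *: T (T x).
  rewrite /E (bopD (opexp_bop TM _)) (bopZ (opexp_bop TM _)).
  by rewrite /r1 /r2 rmorphN rmorphXn; vring.
have := cT h (x + h%:C *: T x) (ltW h0); rewrite -/E EE => t3.
have := rnormB (x + r1 + h%:C *: r2 - (h ^+ 2)%:C *: T (T x)) (r1 + h%:C *: r2 - (h ^+ 2)%:C *: T (T x)).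
have -> : x + r1 + h%:C *: r2 - (h ^+ 2)%:C *: T (T x) -
   (r1 + h%:C *: r2 - (h ^+ 2)%:C *: T (T x)) = x by vring.
have := rnormB (r1 + h%:C *: r2) ((h ^+ 2)%:C *: T (T x)).
have := rnormD r1 (h%:C *: r2).
rewrite !rnormZr !ger0_norm ?sqr_ge0 ?(ltW h0)//.
have t4 : h * N r2 <= A * (M * N x) * h ^+ 2.
  apply: (@le_trans _ _ (1 * (A * h ^+ 2 * (M * N x)))); last by rewrite mul1r; lra.
  rewrite ler_pM ?rnorm_ge0 ?(ltW h0)//; apply: le_trans t2 _.
  by rewrite ler_wpM2l ?(bop_bound TM)// mulr_ge0// sqr_ge0.
have t5 : h ^+ 2 * N (T (T x)) <= M * (M * N x) * h ^+ 2.
  rewrite mulrC ler_wpM2r ?sqr_ge0//; apply: le_trans (bop_bound TM _) _.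
  by rewrite ler_wpM2l ?(bop_bound TM).
have t6 : N (x + h%:C *: T x) <= h * N (T x + d%:C *: x) + `|1 - h * d| * N x.
  have -> : x + h%:C *: T x = h%:C *: (T x + d%:C *: x) + (1 - h * d)%:C *: x.
    by rewrite rmorphB rmorphM rmorph1; vring.
  by apply: le_trans (rnormD _ _) _; rewrite !rnormZr (gtr0_norm h0).
rewrite ger0_norm in t6; last by lra.
move=> a1 a2 a3.
have nx := rnorm_ge0 x.
have : h * (d * N x) <= h * (N (T x + d%:C *: x) + C * h).
  rewrite /C; move: a1 a2 a3 t1 t3 t4 t5 t6; clear; lra.
by rewrite ler_pM2l.
Qed.

Section HermitianContraction.
Variables (T : V -> V) (M : R).
Hypotheses (TM : bounded_op T M) (Th : Defs.hermitian T).
Hypothesis Tb : forall c : R, 0 < c -> bijective (fun x => T x + c%:C *: x).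
Let M0 := bop_ge0 TM.

Let growth (c : R) := forall (t : R) x, 0 <= t ->
  N (opexp T (- t)%:C x) <= expR (c * t) * N x.

Let growthM : growth M.
Proof.
move=> t x t0; apply: le_trans (bop_bound (opexp_bop TM _) _) _.
by rewrite absc_real normrN ger0_norm// [t * M]mulrC.
Qed.

Let growth_inf (c0 : R) : (forall e : R, 0 < e -> exists2 c, growth c & c <= c0 + e) ->
  growth c0.
Proof.
move=> h t x t0; have nx := rnorm_ge0 x.
have d0 : 0 < (1 / 2) / (t + 1) :> R by rewrite !divr_gt0// ltr_wpDl.
apply: (le_of_le_small (c := expR (c0 * t) * (2 * t) * N x) d0) => e e0 ed.
have [c gc cc] := h e e0; apply: le_trans (gc t x t0) _.
have et0 : 0 <= e * t by rewrite mulr_ge0// ltW.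
have et : e * t <= 1 / 2.
  move: ed; rewrite ler_pdivlMr ?ltr_wpDl//; lra.
have := expR_le_1D2 et0 et => h2.
have : expR (c * t) <= expR (c0 * t) * expR (e * t).
  by rewrite -expRD ler_expR -mulrDl ler_wpM2r.
have e1 := expR_gt0 (c0 * t).
have : expR (c0 * t) * expR (e * t) <= expR (c0 * t) * (1 + 2 * (e * t)).
  by rewrite ler_pM2l.
move=> a b; have : expR (c * t) * N x <= expR (c0 * t) * (1 + 2 * (e * t)) * N x.
  by rewrite ler_wpM2r//; lra.
lra.
Qed.

(* A growth rate c0 > 0 that cannot be lowered makes - c0 an approximate
   eigenvalue of T: by convexity the orbit eventually grows at a rate close to
   c0 in both directions, and Cauchy's estimate applies on long strips. *)
Let approximate_eigenvector (c0 L : R) : 0 < c0 -> 0 < L -> growth c0 ->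
  (forall c, 0 <= c -> c < c0 -> ~ growth c) ->
  exists2 y, 0 < N y & N (T y + c0%:C *: y) <= expR 1 / L * N y.
Proof.
move=> c00 L0 gc0 gmin.
pose m := Num.min c0 L^-1.
have m0 : 0 < m by rewrite lt_min c00 invr_gt0.
have mc : m <= c0 by rewrite ge_min lexx.
have mL : m * L <= 1 by rewrite -ler_pdivlMr// mul1r ge_min lexx orbT.
have /existsNP[t /existsNP[x /not_implyP[t0 /negP]]] : ~ growth (c0 - m).
  by apply: gmin; lra.
rewrite -ltNge => hx.
pose S z := T z + (c0 - m)%:C *: z.
have SM : bounded_op S (M + `|c0 - m|) by exact: bop_shift.
have Sh : Defs.hermitian S by exact: hermitian_shift.
pose k (s : R) := N (opexp S (- s)%:C x).
have kE s : k s = expR (- ((c0 - m) * s)) * N (opexp T (- s)%:C x).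
  by rewrite /k (opexp_shift _ TM) rnormZr (ger0_norm (expR_ge0 _)) mulrN.
have k0 : k 0 = N x by rewrite /k oppr0 (opexp_0 SM).
have kt : k 0 < k t.
  rewrite k0 kE expRN mulrC ltr_pdivlMr ?expR_gt0//; lra.
have qc (a b c : R) : a <= b -> b <= c -> k b <= Num.max (k a) (k c).
  by move=> ab bc; rewrite /k maxC; apply: (opexp_quasi_convex SM Sh); rewrite lerN2.
clearbody k; clear SM Sh S.
(* Since k t exceeds k 0, quasi-convexity forbids any decrease of k after t. *)
have kmono (s s' : R) : t <= s -> s <= s' -> k s <= k s'.
  move=> ts ss'; rewrite leNgt; apply/negP => ks.
  have := qc 0 s s' (le_trans t0 ts) ss'; rewrite le_max (leNgt _ (k s')) ks orbF => ks0.
  have := qc 0 t s t0 ts; rewrite le_max => /orP[|h]; lra.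
pose T0 z := T z + c0%:C *: z.
have T0M : bounded_op T0 (M + `|c0|) by exact: bop_shift.
have T0h : Defs.hermitian T0 by exact: hermitian_shift.
have T0E (s : R) z : N (opexp T0 (- s)%:C z) = expR (- (c0 * s)) * N (opexp T (- s)%:C z).
  by rewrite (opexp_shift _ TM) rnormZr (ger0_norm (expR_ge0 _)) mulrN.
(* On the disc of radius L the norm of e^(w T0) y depends only on a = Re w. For a < 0 the growth
   rate c0 bounds it by |y|; for 0 <= a <= L it is the orbit of x at time t + L - a >= t, where
   monotonicity of k leaves only the factor e^(m a) <= e. *)
pose y := opexp T0 (- (t + L))%:C x.
have yE (s : R) : N (opexp T0 (- s)%:C x) = expR (- (m * s)) * k s.
  by rewrite T0E kE mulrA -expRD; congr (expR _ * _); ring.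
have y0 : 0 < N y.
  rewrite /y yE mulr_gt0 ?expR_gt0//; apply: lt_le_trans (kmono t _ _ _) => //; last by lra.
  by apply: le_lt_trans kt; rewrite k0 rnorm_ge0.
have yN : N y = expR (- (m * (t + L))) * k (t + L) := yE (t + L).
have ya (a : R) : opexp T0 a%:C y = opexp T0 (- (t + L - a))%:C x.
  by rewrite /y -(opexpD T0M) -rmorphD; congr (opexp T0 _%:C x); ring.
clearbody y; exists y => //.
have := @cauchy_estimate R V T0 _ T0M y L (expR 1 * N y) 1 L0.
rewrite /= expr1 div1r.
have -> : L^-1 * (expR 1 * N y) = expR 1 / L * N y by ring.
apply => w wL.
rewrite (opexp_norm_Re T0M T0h).
set a := complex.Re w.
have aL : a <= L by rewrite -wL Re_le_absc.
have e1 : 1 <= expR 1 :> R by rewrite -expR0 ler_expR.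
have [a0|a0] := leP 0 a; last first.
  have -> : a = - (- a) by rewrite opprK.
  have na0 : 0 <= - a by lra.
  rewrite T0E; have := gc0 (- a) y na0 => h.
  apply: (@le_trans _ _ (N y)); last by rewrite ler_peMl// ltW.
  by rewrite expRN ler_pdivrMl ?expR_gt0.
rewrite ya yE yN.
have -> : expR (- (m * (t + L - a))) = expR (m * a) * expR (- (m * (t + L))).
  by rewrite -expRD; congr expR; ring.
have ks : k (t + L - a) <= k (t + L) by apply: kmono; lra.
have kp : 0 <= k (t + L - a).
  by apply: le_trans (kmono t _ _ _); rewrite ?lexx//; [rewrite (le_trans _ (ltW kt))// k0 rnorm_ge0|lra].
rewrite -mulrA ler_pM ?mulr_ge0 ?expR_ge0//; last by rewrite ler_wpM2l// expR_ge0.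
rewrite ler_expR; apply: le_trans mL; rewrite ler_wpM2l//; exact: ltW.
Qed.

(** Suppose the least growth rate c0 is positive. The spectral hypothesis makes T0 = T + c0
    bijective, and the inverses B n of T0 + [dl n] turn out to be uniformly bounded. An approximate
    null vector of T0, with L adapted to that bound, is a contradiction. *)
Theorem hermitian_contraction (t : R) x : 0 <= t -> N (opexp T (- t)%:C x) <= N x.
Proof.
pose A := [set c : R | 0 <= c /\ growth c].
have A_M : A M by split.
have hA : has_inf A by split; [exists M|exists 0 => c []].
pose c0 := inf A.
have c00 : 0 <= c0 by apply: lb_le_inf; [exists M|move=> c []].
have gc0 : growth c0.
  apply: growth_inf => e e0; have [c [_ gc] ce] := inf_adherent e0 hA.
  by exists c => //; exact: ltW.
have [c0E|c0N] := eqVneq c0 0.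
  by move=> t0; have := gc0 t x t0; rewrite c0E mul0r expR0 mul1r.
exfalso; have c0p : 0 < c0 by rewrite lt_def c0N.
have gmin c : 0 <= c -> c < c0 -> ~ growth c.
  move=> cp cc gc; have : c0 <= c by apply: inf_lbound; [exists 0 => ? []|split].
  by rewrite leNgt cc.
pose T0 z := T z + c0%:C *: z.
have T0M : bounded_op T0 (M + `|c0|) by exact: bop_shift.
have T0c (s : R) z : 0 <= s -> N (opexp T0 (- s)%:C z) <= N z.
  move=> s0; rewrite (opexp_shift _ TM) rnormZr (ger0_norm (expR_ge0 _)) mulrN expRN.
  by rewrite ler_pdivrMl ?expR_gt0// gc0.
pose dl n : R := n.+1%:R^-1.
have dl0 n : 0 < dl n by rewrite invr_gt0.
have Bex n : exists B : V -> V,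
    (forall z, B (T0 z + (dl n)%:C *: z) = z) /\ (forall z, T0 (B z) + (dl n)%:C *: B z = z).
  have /Tb[g g1 g2] : 0 < c0 + dl n by rewrite addr_gt0.
  exists g; split=> z; rewrite -addrA -scalerDl -rmorphD; [exact: g1|exact: g2].
have [B BP] := choice Bex.
have BL n c y z : B n (c *: y + z) = c *: B n y + B n z.
  have [B1 B2] := BP n; rewrite -[RHS]B1; congr (B n _).
  rewrite -{1}(B2 y) -{1}(B2 z) (bopD T0M) (bopZ T0M); vring.
have Bb n z : N (B n z) <= (dl n)^-1 * N z.
  have [_ B2] := BP n; rewrite -{2}(B2 z) -ler_pdivrMl ?invr_gt0// invrK.
  exact: resolvent_bound T0M (dl0 n) T0c.
have Bop n : bounded_op (B n) (dl n)^-1.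
  by split; [exact: BL|rewrite invr_ge0 ltW|exact: Bb].
have [|K hK] := uniform_boundedness Bop.
  (* Pointwise bound: z = T0 (g z) gives B n z = g z - [dl n] B n (g z), and the resolvent bound 1 /
     [dl n] cancels the factor [dl n]. *)
  move=> z; have /Tb[g g1 g2] := c0p.
  exists (2 * N (g z)) => n; have [B1 _] := BP n.
  have zE : z = (T0 (g z) + (dl n)%:C *: g z) - (dl n)%:C *: g z.
    by rewrite addrK /T0 g2.
  rewrite zE (bopB (Bop n)) B1 (bopZ (Bop n)); apply: le_trans (rnormB _ _) _.
  rewrite rnormZr (gtr0_norm (dl0 n)).
  have := Bb n (g z); rewrite -ler_pdivrMl ?invr_gt0// invrK -zE; lra.
have K1 : 0 < `|K| + 1 by rewrite ltr_wpDl.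
pose L := 4 * (`|K| + 1) * expR 1.
have L0 : 0 < L by rewrite !mulr_gt0// expR_gt0.
have [y y0 hy] := approximate_eigenvector c0p L0 gc0 gmin.
have [n [n0 hn]] := archi_nat (4 * (`|K| + 1)).
have [B1 _] := BP n.
have := hK n (T0 y + (dl n)%:C *: y); rewrite B1 => h1.
have h2 := rnormD (T0 y) ((dl n)%:C *: y); rewrite rnormZr (gtr0_norm (dl0 n)) in h2.
have h3 : (`|K| + 1) * N (T0 y) <= N y / 4.
  rewrite mulrC -ler_pdivlMr//; apply: le_trans hy _.
  rewrite /L; have -> : expR 1 / (4 * (`|K| + 1) * expR 1) * N y = N y / 4 / (`|K| + 1).
    by field; rewrite ?gt_eqF ?expR_gt0.
  by [].
have h4 : (`|K| + 1) * dl n <= 1 / 4.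
  have n1 : n.+1%:R = n%:R + 1 :> R by rewrite natr1.
  by rewrite ler_pdivrMr// n1; lra.
have h5 : (`|K| + 1) * (dl n * N y) <= N y / 4.
  by rewrite mulrA; have := ler_wpM2r (ltW y0) h4; lra.
have h6 : N y <= (`|K| + 1) * N (T0 y + (dl n)%:C *: y).
  apply: le_trans h1 _; rewrite ler_wpM2r ?rnorm_ge0// ler_wpDr// ler_norm//.
have : (`|K| + 1) * N (T0 y + (dl n)%:C *: y) <= (`|K| + 1) * (N (T0 y) + dl n * N y).
  by rewrite ler_pM2l.
rewrite mulrDr; lra.
Qed.
End HermitianContraction.

End Positivity.

(** * Algebra of the triple product *)

Section TripleAlgebra.
Variable R : realType.
Variable V : completeNormedModType R[i].
Variable tp : V -> V -> V -> V.
Hypothesis tpJ : is_JBstar_triple tp.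
Local Notation N := (@rnorm R V).

Lemma tpC a b c : tp a b c = tp c b a. Proof. by case: tpJ. Qed.

Lemma tpLl (l : R[i]) a a' b c : tp (l *: a + a') b c = l *: tp a b c + tp a' b c.
Proof. by case: tpJ. Qed.

Lemma tpLm (l : R[i]) a b b' c : tp a (l *: b + b') c = l^* *: tp a b c + tp a b' c.
Proof. by case: tpJ. Qed.

Lemma tp_jordan a b x y z : tp a b (tp x y z) =
  tp (tp a b x) y z - tp x (tp b a y) z + tp x y (tp a b z).
Proof. by case: tpJ => _ _ _ _ []. Qed.

Lemma tp_hermitian a : Defs.hermitian (tp a a).
Proof. by case: tpJ => _ _ _ _ [_ /(_ a)[]]. Qed.

Lemma tp_spectrum a (c : R) : 0 < c -> bijective (fun x => tp a a x + c%:C *: x).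
Proof.
case: tpJ => _ _ _ _ [_ /(_ a)[_ sp] _] c0; apply: contrapT => nb.
have := sp (- c)%:C; rewrite ler0c oppr_ge0 => h.
suff : (c <= 0) by rewrite leNgt c0.
apply: h; rewrite /spectrum /= => bj; apply: nb.
apply: (eq_bij bj) => x.
by rewrite /Lop rmorphN scaleNr opprK.
Qed.

Lemma rnorm_cube a : N (tp a a a) = N a ^+ 3.
Proof.
case: tpJ => _ _ _ _ [_ _ /(_ a)]; rewrite !rnormE -rmorphXn => h.
exact: complexI h.
Qed.

Lemma tpLr (l : R[i]) a b c c' : tp a b (l *: c + c') = l *: tp a b c + tp a b c'.
Proof. by rewrite tpC tpLl ![tp _ b a]tpC. Qed.

Lemma tpDl a a' b c : tp (a + a') b c = tp a b c + tp a' b c.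
Proof. by have := tpLl 1 a a' b c; rewrite !scale1r. Qed.

Lemma tpDr a b c c' : tp a b (c + c') = tp a b c + tp a b c'.
Proof. by have := tpLr 1 a b c c'; rewrite !scale1r. Qed.

Lemma tpDm a b b' c : tp a (b + b') c = tp a b c + tp a b' c.
Proof. by have := tpLm 1 a b b' c; rewrite rmorph1 !scale1r. Qed.

Lemma tp0l b c : tp 0 b c = 0.
Proof. by apply: (addrI (tp 0 b c)); rewrite -tpDl !addr0. Qed.

Lemma tp0r a b : tp a b 0 = 0. Proof. by rewrite tpC tp0l. Qed.

Lemma tp0m a c : tp a 0 c = 0.
Proof. by apply: (addrI (tp a 0 c)); rewrite -tpDm !addr0. Qed.

Lemma tpZl (l : R[i]) a b c : tp (l *: a) b c = l *: tp a b c.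
Proof. by have := tpLl l a 0 b c; rewrite !addr0 tp0l addr0. Qed.

Lemma tpZr (l : R[i]) a b c : tp a b (l *: c) = l *: tp a b c.
Proof. by have := tpLr l a b c 0; rewrite !addr0 tp0r addr0. Qed.

Lemma tpZm (l : R[i]) a b c : tp a (l *: b) c = l^* *: tp a b c.
Proof. by have := tpLm l a b 0 c; rewrite !addr0 tp0m addr0. Qed.

Lemma tpZmr (r : R) a b c : tp a (r%:C *: b) c = r%:C *: tp a b c.
Proof. by rewrite tpZm (_ : Num.conj r%:C = r%:C) //; exact: conjc_real. Qed.

Lemma tpNl a b c : tp (- a) b c = - tp a b c.
Proof. by rewrite -scaleN1r tpZl scaleN1r. Qed.

Lemma tpNr a b c : tp a b (- c) = - tp a b c.
Proof. by rewrite -scaleN1r tpZr scaleN1r. Qed.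

Lemma tpNm a b c : tp a (- b) c = - tp a b c.
Proof.
by rewrite -scaleN1r -(rmorphN1 (real_complex R)) tpZmr rmorphN1 scaleN1r.
Qed.

Definition tpE := (tpDl, tpDm, tpDr, tpNl, tpNm, tpNr, tpZl, tpZmr, tpZr).

(** Continuity at 0 bounds the product by 1 on a small ball of radius d, and homogeneity yields the
    constant d^-3. Enlarging C to at least 1 lets later estimates absorb powers of C. *)
Lemma tp_bound : exists C : R, 1 <= C /\
  forall a b c, N (tp a b c) <= C * N a * N b * N c.
Proof.
case: (tpJ) => _ _ _ tpc _.
have /cvgrPdist_lt/(_ 1 ltr01) := tpc ((0, 0), 0).
rewrite /= tp0l => /nbhs_normP[e e0 he].
have eE : e = (complex.Re e)%:C by rewrite RRe_real // gtr0_real.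
pose d := complex.Re e / 2.
have re0 : 0 < complex.Re e by move: e0; rewrite /= {1}eE ltcR.
have d0 : 0 < d by rewrite divr_gt0.
have small a b c : N a <= d -> N b <= d -> N c <= d -> N (tp a b c) <= 1.
  move=> ad bd cd; have := he ((a, b), c).
  rewrite /= !sub0r !normrN => h; apply: ltW; rewrite -ltcR -rnormE rmorph1; apply: h.
  have mx (u v : R[i]) : u < e -> v < e -> Num.max u v < e.
    by rewrite /Order.max; case: ifP.
  rewrite !prod_normE /=.
  have lt x : N x <= d -> `|x| < e.
    move=> xd; rewrite rnormE eE ltcR; apply: le_lt_trans xd _.
    by rewrite /d; lra.
  by apply: (mx); [apply: (mx)|]; apply: (lt).
clearbody d; pose C := Num.max 1 (d^-1 ^+ 3).
exists C; split; first by rewrite le_max lexx.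
move=> a b c.
have [->|a0] := eqVneq a 0; first by rewrite tp0l !rnorm0 mulr0 !mul0r.
have [->|b0] := eqVneq b 0; first by rewrite tp0m !rnorm0 mulr0 mul0r.
have [->|c0] := eqVneq c 0; first by rewrite tp0r !rnorm0 mulr0.
have [[na nb] nc] := (rnorm_gt0 a0, rnorm_gt0 b0, rnorm_gt0 c0).
pose s (x : V) := (d / N x)%:C *: x.
have Ns x : 0 < N x -> N (s x) <= d.
  by move=> nx; rewrite rnormZr ger0_norm ?divr_ge0 ?(ltW d0) ?(ltW nx)// divfK ?gt_eqF.
have := small _ _ _ (Ns _ na) (Ns _ nb) (Ns _ nc).
rewrite /s tpZl tpZmr tpZr !rnormZr !ger0_norm ?divr_ge0 ?(ltW d0) ?rnorm_ge0//.
have -> : d / N a * (d / N b * (d / N c * N (tp a b c))) =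
   d ^+ 3 / (N a * N b * N c) * N (tp a b c) by field; rewrite !gt_eqF.
rewrite -ler_pdivlMl ?divr_gt0 ?mulr_gt0 ?exprn_gt0// mulr1 invf_div => h.
apply: le_trans h _.
have -> : C * N a * N b * N c = C * (N a * N b * N c) by ring.
rewrite mulrC ler_wpM2r ?mulr_ge0 ?rnorm_ge0//.
by rewrite /C le_max -exprVn lexx orbT.
Qed.

(** The Jordan identity applied to A and to B gives A = 2 B - D and B = 2 A - D; hence 3 (A - B) = 0
    and A = B = D. *)
Lemma tp_JP1 x y b : tp x y (tp x b x) = tp x (tp y x b) x.
Proof.
set A := tp x y _; set D := tp x (tp _ _ _) x; set B := tp x b (tp x y x).
have e1 : A = B - D + B by rewrite /A tp_jordan (tpC (tp x y x)).
have e2 : B = A - D + A by rewrite {1}/B tp_jordan (tpC (tp x b x)) (tpC b).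
have e3 : (3 : R)%:C *: (A - B) = 0.
  have -> : (3 : R)%:C *: (A - B) = (A - (B - D + B)) - (B - (A - D + A)).
    by rewrite rmorph_nat; vring.
  by rewrite -e1 -e2 !subrr.
have AB : A = B.
  apply/eqP; rewrite -subr_eq0; move/eqP: e3; rewrite scaler_eq0 => /orP[|//].
  by rewrite rmorph_nat pnatr_eq0.
by apply/eqP; rewrite -subr_eq0 -(addrK A (A - D)) -e2 AB subrr.
Qed.

Definition cube z := tp z z z.
Definition quad z b := tp z b z.

Lemma quad_tp z b : tp z z (quad z b) = quad z (tp z z b).
Proof. exact: tp_JP1. Qed.

Lemma tp_cubeC z b : tp (cube z) z b = tp z (cube z) b.
Proof.
have := tp_jordan z z z z b; move/eqP; rewrite -subr_eq subrr eq_sym subr_eq0.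
by move/eqP.
Qed.

Lemma tp_cubeE z b : tp (cube z) z b = tp z z (tp z z b) + tp z z (tp z z b) - quad z (quad z b).
Proof.
rewrite /cube tpC tp_jordan (tpC (tp b z z)) (tpC b z z) /quad.
by rewrite addrAC.
Qed.

(** The instance Q(Q(z) z) = Q(z)^3 of the fundamental formula. Expanding L(z,z) {z^3,b,z} by the
    Jordan identity produces Q(z^3) b and {z^5,b,z} = L(z^3,z) Q(z) b; [tp_cubeE] rewrites L(z^3,z)
    as 2 L(z,z)^2 - Q(z)^2, and the terms L(z,z)^2 Q(z) b cancel. *)
Lemma quad_cube z b : quad (cube z) b = quad z (quad z (quad z b)).
Proof.
have e1 c : tp (cube z) c z = tp z z (quad z c).
  have := tp_jordan z z z c z; rewrite -!/(cube z) -!/(quad z _) quad_tp (tpC z c).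
  move=> h; apply/eqP; rewrite -subr_eq0; apply/eqP.
  have -> : tp (cube z) c z - quad z (tp z z c) =
    (2 : R)^-1%:C *: ((tp (cube z) c z - quad z (tp z z c) + tp (cube z) c z)
       - quad z (tp z z c)).
    have -> : (2 : R)^-1%:C = (2 : R[i])^-1 by rewrite fmorphV rmorph_nat.
    have -> : tp (cube z) c z - quad z (tp z z c) + tp (cube z) c z - quad z (tp z z c) =
      (2 : R[i]) *: (tp (cube z) c z - quad z (tp z z c)) by vring.
    by rewrite scalerA mulVf ?pnatr_eq0// scale1r.
  by rewrite -h subrr scaler0.
pose z5 := tp z z (cube z).
have e2 : tp z5 b z = tp (cube z) z (quad z b).
  have h1 := tp_jordan (cube z) z z b z.
  rewrite -!/(quad z _) -(tp_cubeC z b) /quad -(tp_JP1 z (cube z) b) in h1.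
  rewrite -!tp_cubeC (tpC (cube z) z z) -/z5 (tpC z b) in h1.
  rewrite /quad; set X := tp (cube z) z _ in h1 *; set Y := tp z5 b z in h1 *.
  have : (2 : R[i]) *: (Y - X) = 0.
    have -> : (2 : R[i]) *: (Y - X) = (Y - X + Y) - X by vring.
    by rewrite -h1 subrr.
  by move/eqP; rewrite scaler_eq0 pnatr_eq0 /= subr_eq0 => /eqP.
have := tp_jordan z z (cube z) b z.
rewrite -/(cube z) -/z5 !e1 -/(quad (cube z) b) e2 tp_cubeE -quad_tp => h.
set X := tp z z (tp z z (quad z b)) in h.
have -> : quad (cube z) b = (X + X - quad z (quad z (quad z b)) - X + quad (cube z) b) - X
   + quad z (quad z (quad z b)) by vring.
by rewrite -h subrr add0r.
Qed.

(** The m with 3^k = 2 m + 1: it is the number of applications of L(z,z) that lead from z to its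
    k-fold iterated cube. *)
Definition half_pow3 k : nat := ((3 ^ k).-1)./2.

Lemma half_pow3E k : (2 * half_pow3 k + 1 = 3 ^ k)%N.
Proof.
rewrite /half_pow3; have : odd (3 ^ k) by rewrite oddX orbT.
have : (0 < 3 ^ k)%N by rewrite expn_gt0.
case: (3 ^ k)%N => //= n _ on; rewrite addn1 mul2n; congr _.+1.
by have := odd_double_half n; rewrite (negPf on).
Qed.

Lemma half_pow3S k : half_pow3 k.+1 = (3 ^ k + half_pow3 k)%N.
Proof. by have := half_pow3E k; have := half_pow3E k.+1; rewrite expnS; lia. Qed.

Lemma quad_iter_cube z k b : quad (iter k cube z) b = iter (3 ^ k) (quad z) b.
Proof.
elim: k b => [//|k IHk] b; rewrite iterS quad_cube !IHk -!iterD.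
by congr (iter _ _ _); rewrite expnS; lia.
Qed.

Lemma rnorm_iter_cube z k : N (iter k cube z) = N z ^+ (3 ^ k).
Proof.
elim: k => [|k IHk]; first by rewrite expn0 expr1.
by rewrite iterS rnorm_cube IHk -exprM mulnC -expnS.
Qed.

Lemma tp_quad_iter_cube z k b :
  tp z z (quad (iter k cube z) b) = quad (iter k cube z) (tp z z b).
Proof.
by rewrite !quad_iter_cube; elim: (3 ^ k)%N => //= n <-; rewrite quad_tp.
Qed.

End TripleAlgebra.

(** * One-parameter groups generated by L(z,z) *)

Section TripleExponential.
Variable R : realType.
Variable V : completeNormedModType R[i].
Variable tp : V -> V -> V -> V.
Hypothesis tpJ : is_JBstar_triple tp.
Local Notation N := (@rnorm R V).
Variable C : R.
Hypothesis C1 : 1 <= C.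
Hypothesis tpC_bound : forall a b c, N (tp a b c) <= C * N a * N b * N c.

Let C0 : 0 <= C. Proof. by rewrite (le_trans ler01). Qed.

Lemma tp_le a b c (x y z : R) : N a <= x -> N b <= y -> N c <= z ->
  N (tp a b c) <= C * x * y * z.
Proof.
move=> ax yb cz; apply: le_trans (tpC_bound a b c) _.
have ha := rnorm_ge0 a; have hb := rnorm_ge0 b; have hc := rnorm_ge0 c.
by rewrite !ler_pM ?mulr_ge0.
Qed.

Lemma tp_bop a b : bounded_op (tp a b) (C * N a * N b).
Proof.
split=> [c x y||x]; first exact: tpLr.
  by rewrite !mulr_ge0 ?rnorm_ge0.
exact: tpC_bound.
Qed.

Lemma bounded_op_le (T : V -> V) (M M' : R) : M <= M' -> bounded_op T M -> bounded_op T M'.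
Proof.
move=> MM [TL M0 TM]; split => //; first exact: le_trans MM.
by move=> x; apply: le_trans (TM x) _; rewrite ler_wpM2r ?rnorm_ge0.
Qed.

Lemma tp_bop1 a : N a <= 1 -> bounded_op (tp a a) C.
Proof.
move=> a1; apply: bounded_op_le (tp_bop a a).
rewrite -mulrA ler_piMr// -expr2 expr_le1//; exact: rnorm_ge0.
Qed.

Local Notation E w := (opexp (tp w w)).

Section Automorphism.
Variable w : V.
Let TM := tp_bop w w.
Let M := C * N w * N w.
Let M0 : 0 <= M. Proof. by rewrite !mulr_ge0 ?rnorm_ge0. Qed.

(** Infinitesimally this is the Jordan identity. The curve obtained by carrying the right-hand side
    back with e^(-sL) therefore has increments O(h^2) and is constant. *)
Lemma opexp_automorphism (t : R) a b c :
  E w t%:C (tp a b c) = tp (E w t%:C a) (E w (- t)%:C b) (E w t%:C c).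
Proof.
pose g (s : R) := E w (- s)%:C (tp (E w s%:C a) (E w (- s)%:C b) (E w s%:C c)).
pose A := M ^+ 2 * expR M.
have A0 : 0 <= A by rewrite mulr_ge0 ?expR_ge0 ?exprn_ge0.
pose G := expR (`|t| * M).
have G0 : 0 <= G by exact: expR_ge0.
have EG (s : R) x : `|s| <= `|t| -> N (E w s%:C x) <= G * N x.
  move=> st; apply: le_trans (bop_bound (opexp_bop TM _) _) _.
  by rewrite absc_real ler_wpM2r ?rnorm_ge0// ler_expR ler_wpM2r.
pose B := M + A.
have B0 : 0 <= B by rewrite addr_ge0.
(* The first two summands come from e^(-hL) acting on v + h L v; the last comes from [rho], with 3 A
   for Taylor remainders, 3 B^2 for products of two increments and B^3 for the product of three. *)
pose K := A * C + B * M * C + expR M * (C * (3 * A + 3 * B ^+ 2 + B ^+ 3)).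
have incr (h : R) x y z : `|h| <= 1 ->
    N (E w (- h)%:C (tp (E w h%:C x) (E w (- h)%:C y) (E w h%:C z)) - tp x y z) <=
    K * h ^+ 2 * (N x * N y * N z).
  move=> h1.
  have w1 : absc h%:C <= 1 by rewrite absc_real.
  have w2 : absc (- h)%:C <= 1 by rewrite absc_real normrN.
  have tay (h' : R) u : `|h'| = `|h| -> N (E w h'%:C u - u - h'%:C *: tp w w u) <= A * h ^+ 2 * N u.
    move=> hh; have h'1 : absc h'%:C <= 1 by rewrite absc_real hh.
    have := opexp_taylor TM u h'1.
    by rewrite absc_real hh real_normK ?num_real.
  have dif (h' : R) u : `|h'| = `|h| -> N (E w h'%:C u - u) <= B * `|h| * N u.
    move=> hh; have -> : E w h'%:C u - u = (E w h'%:C u - u - h'%:C *: tp w w u) + h'%:C *: tp w w u.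
      by vring.
    apply: le_trans (rnormD _ _) _; rewrite rnormZr hh.
    have q1 := tay _ u hh; have q2 := bop_bound TM u.
    have q3 : h ^+ 2 <= `|h| by rewrite -real_normK ?num_real// expr2 ler_piMl.
    have q4 : A * h ^+ 2 * N u <= A * `|h| * N u.
      by rewrite ler_wpM2r ?rnorm_ge0// ler_wpM2l.
    have q5 : `|h| * N (tp w w u) <= `|h| * (M * N u) by rewrite ler_wpM2l.
    rewrite /B; lra.
  have nh : `|- h| = `|h| by rewrite normrN.
  set x1 := E w h%:C x; set y1 := E w (- h)%:C y; set z1 := E w h%:C z.
  pose al := x1 - x; pose be := y1 - y; pose ga := z1 - z.
  have dx := dif h x erefl; have dy := dif _ y nh; have dz := dif h z erefl.
  have tx := tay h x erefl; have ty := tay _ y nh; have tz := tay h z erefl.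
  rewrite -/x1 -/al in dx tx; rewrite -/y1 -/be in dy ty; rewrite -/z1 -/ga in dz tz.
  pose ra := al - h%:C *: tp w w x; pose rb := be - (- h)%:C *: tp w w y.
  pose rc := ga - h%:C *: tp w w z.
  pose v := tp x y z.
  (* All terms beyond first order; the first-order ones add up to h L(w,w) v by the Jordan
     identity. *)
  pose rho := tp ra y z + tp x rb z + tp x y rc + tp al be z + tp al y ga + tp x be ga + tp al be ga.
  have uE : tp x1 y1 z1 = v + h%:C *: tp w w v + rho.
    rewrite /rho /v (tp_jordan tpJ) /ra /rb /rc.
    have -> : x1 = x + al by rewrite /al addrC subrK.
    have -> : y1 = y + be by rewrite /be addrC subrK.
    have -> : z1 = z + ga by rewrite /ga addrC subrK.
    have nr : (- h)%:C = - h%:C by rewrite rmorphN.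
    rewrite nr scaleNr opprK; move: tpJ; clear; clearbody al be ga => tpJ'.
    by rewrite !(tpE tpJ'); vring.
  pose P := N x * N y * N z.
  have nx := rnorm_ge0 x; have ny := rnorm_ge0 y; have nz := rnorm_ge0 z.
  have nh0 := normr_ge0 h.
  have P0 : 0 <= P by rewrite !mulr_ge0.
  have nrho : N rho <= C * (3 * A + 3 * B ^+ 2 + B ^+ 3) * h ^+ 2 * P.
    have h2 : `|h| ^+ 2 = h ^+ 2 by rewrite real_normK ?num_real.
    have h3 : `|h| ^+ 3 <= h ^+ 2 by rewrite exprS h2 ler_piMl ?sqr_ge0.
    have k1 := tp_le tx (lexx (N y)) (lexx (N z)).
    have k2 := tp_le (lexx (N x)) ty (lexx (N z)).
    have k3 := tp_le (lexx (N x)) (lexx (N y)) tz.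
    have k4 := tp_le dx dy (lexx (N z)).
    have k5 := tp_le dx (lexx (N y)) dz.
    have k6 := tp_le (lexx (N x)) dy dz.
    have k7 := tp_le dx dy dz.
    have k8 : C * (B * `|h| * N x) * (B * `|h| * N y) * (B * `|h| * N z) <= C * B ^+ 3 * h ^+ 2 * P.
      rewrite [X in X <= _](_ : _ = C * B ^+ 3 * P * `|h| ^+ 3); last by rewrite /P; ring.
      rewrite [X in _ <= X](_ : _ = C * B ^+ 3 * P * h ^+ 2); last by ring.
      by rewrite ler_wpM2l// !mulr_ge0// exprn_ge0.
    have e4 : C * (B * `|h| * N x) * (B * `|h| * N y) * N z = C * B ^+ 2 * h ^+ 2 * P.
      by rewrite -h2 /P; ring.
    have e5 : C * (B * `|h| * N x) * N y * (B * `|h| * N z) = C * B ^+ 2 * h ^+ 2 * P.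
      by rewrite -h2 /P; ring.
    have e6 : C * N x * (B * `|h| * N y) * (B * `|h| * N z) = C * B ^+ 2 * h ^+ 2 * P.
      by rewrite -h2 /P; ring.
    have e1 : C * (A * h ^+ 2 * N x) * N y * N z = C * A * h ^+ 2 * P by rewrite /P; ring.
    have e2 : C * N x * (A * h ^+ 2 * N y) * N z = C * A * h ^+ 2 * P by rewrite /P; ring.
    have e3 : C * N x * N y * (A * h ^+ 2 * N z) = C * A * h ^+ 2 * P by rewrite /P; ring.
    rewrite e1 in k1; rewrite e2 in k2; rewrite e3 in k3; rewrite e4 in k4.
    rewrite e5 in k5; rewrite e6 in k6; have {k7 k8} k7 := le_trans k7 k8.
    rewrite /rho -/ra -/rb -/rc.
    have s1 := rnormD (tp ra y z + tp x rb z + tp x y rc + tp al be z + tp al y ga + tp x be ga) (tp al be ga).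
    have s2 := rnormD (tp ra y z + tp x rb z + tp x y rc + tp al be z + tp al y ga) (tp x be ga).
    have s3 := rnormD (tp ra y z + tp x rb z + tp x y rc + tp al be z) (tp al y ga).
    have s4 := rnormD (tp ra y z + tp x rb z + tp x y rc) (tp al be z).
    have s5 := rnormD (tp ra y z + tp x rb z) (tp x y rc).
    have s6 := rnormD (tp ra y z) (tp x rb z).
    move: k1 k2 k3 k4 k5 k6 k7 s1 s2 s3 s4 s5 s6; clear; clearbody P; lra.
  have vb : N v <= C * P by rewrite /P !mulrA; exact: tpC_bound.
  have Tvb : N (tp w w v) <= M * (C * P).
    by apply: le_trans (bop_bound TM v) _; rewrite ler_wpM2l.
  have -> : E w (- h)%:C (tp x1 y1 z1) - tp x y z =
     (E w (- h)%:C v - v - (- h)%:C *: tp w w v) + h%:C *: (E w (- h)%:C (tp w w v) - tp w w v)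
     + E w (- h)%:C rho.
    rewrite uE !(bopD (opexp_bop TM _)) (bopZ (opexp_bop TM _)) -/v rmorphN.
    by clear; vring.
  have f1 := tay _ v nh; have f2 := dif _ (tp w w v) nh; have f3 := opexp_le TM rho w2.
  apply: le_trans (rnormD _ _) _; apply: le_trans (lerD (rnormD _ _) (lexx _)) _.
  rewrite rnormZr.
  have g1 : A * h ^+ 2 * N v <= A * h ^+ 2 * (C * P).
    by rewrite ler_wpM2l// mulr_ge0// sqr_ge0.
  have g2 : `|h| * N (E w (- h)%:C (tp w w v) - tp w w v) <= B * h ^+ 2 * (M * (C * P)).
    apply: (@le_trans _ _ (`|h| * (B * `|h| * (M * (C * P))))).
      rewrite ler_wpM2l//; apply: le_trans f2 _; rewrite ler_wpM2l// mulr_ge0//.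
    by rewrite -[h ^+ 2]real_normK ?num_real//; lra.
  have g3 : expR M * N rho <= expR M * (C * (3 * A + 3 * B ^+ 2 + B ^+ 3) * h ^+ 2 * P).
    by rewrite ler_wpM2l// expR_ge0.
  rewrite -/P /K -/M in f1 f3 *.
  move: f1 f3 g1 g2 g3; clear; clearbody P v rho; lra.
have gt : g t = g 0.
  apply: (@quadratic_const R V g (G * (K * ((G * N a) * (G * N b) * (G * N c)))) t 1 ltr01) => s h st h1.
  have nst : `|- s| <= `|t| by rewrite normrN.
  have -> : g (s + h) - g s = E w (- s)%:C
      (E w (- h)%:C (tp (E w h%:C (E w s%:C a)) (E w (- h)%:C (E w (- s)%:C b)) (E w h%:C (E w s%:C c)))
       - tp (E w s%:C a) (E w (- s)%:C b) (E w s%:C c)).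
    rewrite (bopB (opexp_bop TM _)) -!(opexpD TM) -!rmorphD /g.
    by rewrite opprD (addrC h s) (addrC (- h)).
  apply: le_trans (EG _ _ nst) _.
  rewrite -mulrA ler_wpM2l//; apply: le_trans (incr _ _ _ _ h1) _.
  have K0 : 0 <= K.
    rewrite /K !addr_ge0 ?mulr_ge0 ?expR_ge0 ?exprn_ge0 ?addr_ge0 ?mulr_ge0 ?rnorm_ge0//.
  rewrite [X in X <= _]mulrAC ler_wpM2r ?sqr_ge0// ler_wpM2l//.
  rewrite !ler_pM ?mulr_ge0 ?rnorm_ge0//; exact: EG.
move: gt; rewrite /g oppr0 !(opexp_0 TM) => <-.
by rewrite rmorphN (opexpNK TM).
Qed.
End Automorphism.
End TripleExponential.

Section ExponentialStructure.
Variable R : realType.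
Variable V : completeNormedModType R[i].
Variable tp : V -> V -> V -> V.
Hypothesis tpJ : is_JBstar_triple tp.
Local Notation N := (@rnorm R V).
Variable C : R.
Hypothesis C1 : 1 <= C.
Hypothesis tpC_bound : forall a b c, N (tp a b c) <= C * N a * N b * N c.
Local Notation quad := (quad tp).
Local Notation cube := (cube tp).

Section AtPoint.
Variable z : V.
Let TM := tp_bop tpJ C1 tpC_bound z z.
Local Notation T := (tp z z).
Local Notation E t := (opexp T t%:C).

Lemma quad_opexp (t : R) b : quad z (E t b) = E t (quad z b).
Proof.
apply: (opexp_comm TM (K := C * N z * N z)) => [|x y|y|k y].
- by rewrite !mulr_ge0 ?rnorm_ge0 ?(le_trans ler01 C1).
- by rewrite /quad tpDm.
- by rewrite mulrAC; exact: tpC_bound.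
- have -> : t%:C ^+ k / k`!%:R = (t ^+ k / k`!%:R)%:C by rewrite rmorphM fmorphV rmorphXn rmorph_nat.
  rewrite /quad tpZmr//; congr (_ *: _).
  by elim: k => //= k <-; rewrite -[RHS]/(tp z z (quad z _)) (quad_tp tpJ).
Qed.

Lemma opexpDr (s t : R) x : E s (E t x) = E (s + t) x.
Proof. by rewrite rmorphD (opexpD TM). Qed.

Lemma quad_at_opexp (t : R) b : quad (E t z) b = quad z (E (2 * t) b).
Proof.
have -> : quad (E t z) b = E t (quad z (E t b)).
  rewrite /quad (opexp_automorphism tpJ C1 tpC_bound) opexpDr addNr.
  by rewrite (opexp_0 TM).
by rewrite -quad_opexp opexpDr mulr2n mulrDl mul1r.
Qed.

(** With y = e^(tL) z, the next cube applies Q(y) 3^k times to y^(3^k), because Q(y^3) = Q(y)^3.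
    Each application adds 2 t to the exponent and one factor L, as Q(z) L^j z = L^(j+1) z. *)
Lemma iter_cube_opexp k (t : R) :
  iter k cube (E t z) = E (3 ^+ k * t) (iter (half_pow3 k) T z).
Proof.
elim: k => [|k IHk]; first by rewrite expr0 mul1r.
rewrite iterS -[cube _]/(quad _ _) (quad_iter_cube tpJ) IHk half_pow3S.
have Qiter n m s : iter n (quad (E t z)) (E s (iter m T z)) = E (n%:R * 2 * t + s) (iter (n + m) T z).
  elim: n => [|n IHn]; first by rewrite !mul0r add0r.
  rewrite iterS IHn quad_at_opexp opexpDr quad_opexp.
  have -> : 2 * t + (n%:R * 2 * t + s) = n.+1%:R * 2 * t + s.
    by rewrite -natr1; ring.
  have -> // : quad z (iter (n + m) T z) = iter (n.+1 + m) T z.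
  by rewrite addSn; elim: (n + m)%N => //= j IHj; rewrite -(quad_tp tpJ) IHj.
rewrite Qiter.
have -> // : (3 ^ k)%:R * 2 * t + 3 ^+ k * t = 3 ^+ k.+1 * t :> R.
by rewrite natrX exprS; ring.
Qed.

Lemma iter_cube_tp k : iter k cube z = iter (half_pow3 k) T z.
Proof.
by have := iter_cube_opexp k 0; rewrite mulr0 !(opexp_0 TM).
Qed.

Lemma rnorm_opexp_pow k (t : R) :
  N (E t z) ^+ (3 ^ k) = N (E (3 ^+ k * t) (iter (half_pow3 k) T z)).
Proof. by rewrite -(rnorm_iter_cube tpJ) iter_cube_opexp. Qed.

Lemma opexp_contraction w x : complex.Re w <= 0 -> N (opexp T w x) <= N x.
Proof.
move=> w0; rewrite (opexp_norm_Re TM (tp_hermitian tpJ z)).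
rewrite -[complex.Re w]opprK; apply: (hermitian_contraction TM (tp_hermitian tpJ z)).
  by move=> c; exact: tp_spectrum.
by rewrite oppr_ge0.
Qed.

(** Cauchy's estimate on the circle of radius r about - r, which lies in the closed left half-plane,
    where the exponentials are contractions. *)
Lemma opexp_decay m (r : R) x : 0 < r ->
  N (iter m T (E (- r) x)) <= m`!%:R / r ^+ m * N x.
Proof.
move=> r0; apply: (cauchy_estimate TM) => // w wr.
rewrite -(opexpD TM); apply: opexp_contraction.
rewrite raddfD /= -wr; have := Re_le_absc w; lra.
Qed.
End AtPoint.
End ExponentialStructure.

(** * The cubic estimate on the unit ball *)

Section Growth.
Variable R : realType.

(** A weak form of Stirling's formula. The induction step is (n / (n + 1))^(n + 1) <= 1/e. *)
Lemma fact_expR m : (0 < m)%N ->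
  m`!%:R * expR m%:R <= expR 1 * m%:R * m%:R ^+ m :> R.
Proof.
case: m => // m _; elim: m => [|m IHm]; first by rewrite factS fact0 muln1 expr1n mul1r !mulr1.
have e0 := expR_gt0 (1 : R).
set n := m.+1 in IHm *.
have n0 : 0 < n%:R :> R by rewrite ltr0n.
have n1 : 0 < n%:R + 1 :> R by rewrite addr_gt0.
have eb : expR 1 * n%:R ^+ n.+1 <= (n%:R + 1) ^+ n.+1 :> R.
  have h : n%:R / (n%:R + 1) <= expR (- (n%:R + 1)^-1) :> R.
    apply: le_trans (expR_ge1Dx _).
    have -> // : n%:R / (n%:R + 1) = 1 - (n%:R + 1)^-1 :> R by field; rewrite gt_eqF.
  have : (n%:R / (n%:R + 1)) ^+ n.+1 <= expR (- 1) :> R.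
    apply: le_trans (_ : expR (- (n%:R + 1)^-1) ^+ n.+1 <= _).
      by rewrite lerXn2r ?nnegrE ?expR_ge0 ?divr_ge0 ?(ltW n0) ?(ltW n1).
    rewrite -expRM_natl -natr1 mulrN divff ?gt_eqF//.
  rewrite expRN expr_div_n ler_pdivrMr ?exprn_gt0// => h2.
  by rewrite mulrC -ler_pdivlMr// mulrC.
rewrite factS natrM -natr1 expRD.
have -> : (n%:R + 1) * n`!%:R * (expR n%:R * expR 1) =
  (n`!%:R * expR n%:R) * ((n%:R + 1) * expR 1) :> R by ring.
apply: (@le_trans _ _ ((expR 1 * n%:R * n%:R ^+ n) * ((n%:R + 1) * expR 1))).
  by rewrite ler_wpM2r// mulr_ge0 ?(ltW n1) ?(ltW e0).
have -> : expR 1 * n%:R * n%:R ^+ n * ((n%:R + 1) * expR 1) =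
  (expR 1 * (n%:R + 1)) * (expR 1 * n%:R ^+ n.+1) :> R by rewrite exprS; ring.
by rewrite ler_wpM2l// mulr_ge0 ?(ltW n1) ?(ltW e0).
Qed.

Lemma pow3_ge k : k%:R <= 3 ^+ k :> R.
Proof.
rewrite -natrX ler_nat; elim: k => // k; rewrite expnS.
have p : (0 < 3 ^ k)%N by rewrite expn_gt0.
lia.
Qed.

Lemma pow3_unbounded (a : R) : exists k, a <= 3 ^+ k.
Proof.
by have [k [_ h]] := archi_nat a; exists k; apply: le_trans h (pow3_ge k).
Qed.

(** If u = 1 + d with d > 0, Bernoulli's inequality at exponent 3^k followed by cubing gives growth
    at least (d 3^k)^3, faster than the linear bound c 3^(k+1). *)
Lemma pow3_growth_le1 (u c : R) : (forall k, u ^+ (3 ^ k.+1) <= c * 3 ^+ k.+1) -> u <= 1.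
Proof.
move=> h; rewrite leNgt; apply/negP => u1.
pose d := u - 1; have d0 : 0 < d by rewrite subr_gt0.
have [k hk] := pow3_unbounded ((3 * `|c| + 1) / d ^+ 3).
have := h k; have -> : u = 1 + d by rewrite /d addrC subrK.
have X1 : 1 <= 3 ^+ k :> R by rewrite -natrX ler1n expn_gt0.
have q := bernoulli (3 ^ k) (ltW d0).
rewrite expnS mulnC exprM [3 ^+ _]exprS; rewrite natrX in q.
rewrite ler_pdivrMr ?exprn_gt0// in hk.
have cc := ler_norm c.
set X : R := 3 ^+ k in hk X1 q *; set W := (1 + d) ^+ _ in q *.
have Xd : 0 < X * d by rewrite mulr_gt0// (lt_le_trans ltr01).
have q3 : (X * d) ^+ 3 <= W ^+ 3 by rewrite lerXn2r ?nnegrE; lra.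
clearbody X W d; clear u1 h q; rewrite exprMn in q3.
have c0 := normr_ge0 c.
have X0 : 0 <= X by lra.
have X2 : X <= X ^+ 2 by rewrite expr2 ler_peMl.
have c3 : 0 <= 3 * `|c| + 1 by lra.
have k1 : X * (3 * `|c| + 1) <= X ^+ 2 * (X * d ^+ 3).
  by apply: ler_pM => //; rewrite mulrC.
have k2 : X * c <= X * `|c| by rewrite ler_wpM2l.
move=> h; nra.
Qed.
End Growth.

Section KOne.
Variable R : realType.
Variable V : completeNormedModType R[i].
Variable tp : V -> V -> V -> V.
Hypothesis tpJ : is_JBstar_triple tp.
Local Notation N := (@rnorm R V).
Variable C : R.
Hypothesis C1 : 1 <= C.
Hypothesis tpC_bound : forall a b c, N (tp a b c) <= C * N a * N b * N c.
Local Notation quad := (quad tp).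
Local Notation cube := (cube tp).

Section AtPoint.
Variable z : V.
Hypothesis z1 : N z <= 1.
Let TM := tp_bop1 tpJ C1 tpC_bound z1.
Local Notation T := (tp z z).
Let S x := T x + (- 1)%:C *: x.
Let SM := bop_shift TM (- 1).
Let Sh := hermitian_shift (tp_hermitian tpJ z) (- 1).

(* Write L for L(z,z) and 3^k = 2m + 1. The 3^k-th power of the norm of
   e^(1/2 (1-L)) z is that of e^(m + 1/2) L^m e^(-mL) (e^(-L/2) z), which by
   Cauchy's estimate is at most e^(m + 1/2) m!/m^m = O(m): only linear growth. *)
Lemma opexp_shift_half : N (opexp S (- (1 / 2))%:C z) <= 1.
Proof.
rewrite (opexp_shift (- 1) TM) rnormZr ger0_norm ?expR_ge0//.
apply: (@pow3_growth_le1 _ _ (expR (1 / 2) * expR 1)) => k.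
set K := k.+1; set m := half_pow3 K.
have m0 : (0 < m)%N by rewrite /m /K half_pow3S ltn_addr// expn_gt0.
have mK : 3 ^+ K = 2 * m%:R + 1 :> R.
  by rewrite -natrX -half_pow3E natrD natrM.
rewrite exprMn (rnorm_opexp_pow tpJ C1 tpC_bound) -/m.
have -> : 3 ^+ K * - (1 / 2) = - m%:R + - (1 / 2) :> R by rewrite mK; field.
rewrite -(opexpDr tpJ C1 tpC_bound) -[X in N X](_ : iter m T (opexp T (- m%:R)%:C (opexp T (- (1 / 2))%:C z)) = _); last first.
  by rewrite !(opexp_iter TM).
have m0' : 0 < m%:R :> R by rewrite ltr0n.
have h1 := opexp_decay tpJ C1 tpC_bound z m (opexp T (- (1 / 2))%:C z) m0'.
have h2 : N (opexp T (- (1 / 2))%:C z) <= 1.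
  apply: le_trans (opexp_contraction tpJ C1 tpC_bound _ _ _) z1.
  by rewrite /=; lra.
have mm : 0 < m%:R ^+ m :> R by rewrite exprn_gt0.
have h3 : N (iter m T (opexp T (- m%:R)%:C (opexp T (- (1 / 2))%:C z))) <= m`!%:R / m%:R ^+ m.
  apply: le_trans h1 _; rewrite ler_piMr// divr_ge0// exprn_ge0// (ltW m0').
have -> : -1 * - (1 / 2) = 1 / 2 :> R by rewrite mulN1r opprK.
rewrite -expRM_natl natrX mK.
have -> : (2 * m%:R + 1) * (1 / 2) = 1 / 2 + m%:R :> R by field.
rewrite expRD -!mulrA ler_wpM2l ?expR_ge0//.
apply: le_trans (ler_wpM2l (expR_ge0 _) h3) _.
rewrite mulrA ler_pdivrMr// mulrC.
apply: le_trans (fact_expR R m0) _.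
rewrite ler_wpM2r ?(ltW mm)// ler_wpM2l ?expR_ge0//; lra.
Qed.

Lemma opexp_shift_le1 (t : R) : 0 <= t -> t <= 1 / 2 -> N (opexp S (- t)%:C z) <= 1.
Proof.
move=> t0 t1.
have a1 : - (1 / 2) <= - t by lra.
have a2 : - t <= 0 by lra.
apply: le_trans (opexp_quasi_convex SM Sh z a1 a2) _.
rewrite ge_max; apply/andP; split; first exact: opexp_shift_half.
by rewrite rmorph0 (opexp_0 SM).
Qed.

(** z + t (z - z^3) is the first-order part of e^(-tS) z, which has norm at most 1. *)
Lemma rnorm_sub_cube (t : R) : 0 <= t -> t <= 1 / 2 ->
  N (z + t%:C *: (z - cube z)) <= 1 + (C + 1) ^+ 2 * expR (C + 1) * t ^+ 2.
Proof.
move=> t0 t1; have h := opexp_shift_le1 t0 t1.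
have ta : absc (- t)%:C = t by rewrite absc_real normrN ger0_norm.
have t1' : absc (- t)%:C <= 1 by rewrite ta; lra.
have := opexp_taylor SM z t1'; rewrite ta normrN normr1; set y := opexp _ _ _ in h *; set a := _ ^+ 2 * expR _ => h2.
have h3 : a * t ^+ 2 * N z <= a * t ^+ 2.
  by rewrite ler_piMr// mulr_ge0 ?sqr_ge0// mulr_ge0 ?sqr_ge0 ?expR_ge0.
have -> : z + t%:C *: (z - cube z) = y - (y - z - (- t)%:C *: S z).
  have nr (r : R) : (- r)%:C = - r%:C by rewrite rmorphN.
  by rewrite /S !nr /cube; vring.
by apply: le_trans (rnormB _ _) _; lra.
Qed.

(** The two-sided version needed on a full disc: for r > 0 the first-order part (1 - r) z + r z^3 is
    a convex combination of points of the unit ball. *)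
Lemma opexp_shift_small (r : R) : `|r| <= 1 / 2 ->
  N (opexp S r%:C z) <= 1 + (C + 1) ^+ 2 * expR (C + 1) * r ^+ 2.
Proof.
move=> r1; set a := _ ^+ 2 * expR _.
have a0 : 0 <= a by rewrite mulr_ge0 ?sqr_ge0 ?expR_ge0.
have ar0 : 0 <= a * r ^+ 2 by rewrite mulr_ge0 ?sqr_ge0.
have [r0|r0] := leP r 0.
  rewrite -[r in opexp _ r%:C]opprK; apply: le_trans (opexp_shift_le1 _ _) _; first lra.
    by rewrite -(ler0_norm r0).
  by rewrite lerDl.
rewrite gtr0_norm// in r1.
have w1 : absc r%:C <= 1 by rewrite absc_real gtr0_norm//; lra.
have := opexp_taylor SM z w1; rewrite absc_real (gtr0_norm r0) normrN normr1 -/a.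
set y := opexp _ _ _ => h.
have h2 : N ((1 - r)%:C *: z + r%:C *: cube z) <= 1.
  apply: le_trans (rnormD _ _) _; rewrite !rnormZr (rnorm_cube tpJ) (gtr0_norm r0).
  have zz := rnorm_ge0 z.
  have z3 : N z ^+ 3 <= 1 by rewrite exprn_ile1.
  rewrite ger0_norm; last by lra.
  have : (1 - r) * N z <= 1 - r by rewrite ler_piMr//; lra.
  have : r * N z ^+ 3 <= r by rewrite ler_piMr//; lra.
  lra.
have h3 : a * r ^+ 2 * N z <= a * r ^+ 2 by rewrite ler_piMr.
have -> : y = (y - z - r%:C *: S z) + ((1 - r)%:C *: z + r%:C *: cube z).
  have nr : (- 1)%:C = - 1 :> R[i] by rewrite rmorphN rmorph1.
  rewrite rmorphB rmorph1 /S nr /cube; clearbody y; clear; by vring.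
by apply: le_trans (rnormD _ _) _; lra.
Qed.
End AtPoint.

(* For y = z^(3^k) and S = L(z,z) - 1, the norm of e^(sS) y is the 3^k-th power
   of that of e^(s/3^k S) z, which is 1 + O(9^-k); so e^(wS) y is bounded by e on
   a large disc and Cauchy's estimate bounds S y. *)
Lemma tp_iter_cube_approx (d : R) : 0 < d -> exists k, forall z, N z <= 1 ->
  N (iter k cube z - tp z z (iter k cube z)) <= d.
Proof.
move=> d0; pose A := (C + 1) ^+ 2 * expR (C + 1); pose L := expR 1 / d.
have L0 : 0 < L by rewrite divr_gt0 ?expR_gt0.
have A0 : 0 <= A by rewrite mulr_ge0 ?sqr_ge0 ?expR_ge0.
have AL0 : 0 <= A * L ^+ 2 by rewrite mulr_ge0 ?sqr_ge0.
have [k hk] := pow3_unbounded (2 * L + A * L ^+ 2).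
exists k => z z1; pose TM := tp_bop1 tpJ C1 tpC_bound z1.
pose S x := tp z z x + (- 1)%:C *: x.
pose SM := bop_shift TM (- 1).
have Sh := hermitian_shift (tp_hermitian tpJ z) (- 1).
set y := iter k cube z.
have key (s : R) : `|s| <= L -> N (opexp S s%:C y) <= expR 1.
  move=> sL; pose r := s / 3 ^+ k.
  have k0 : 0 < 3 ^+ k :> R by rewrite exprn_gt0.
  have rs : 3 ^+ k * r = s by rewrite mulrC divfK ?gt_eqF.
  have -> : N (opexp S s%:C y) = N (opexp S r%:C z) ^+ (3 ^ k).
    rewrite !(opexp_shift (- 1) TM) !rnormZr !ger0_norm ?expR_ge0// exprMn.
    rewrite (rnorm_opexp_pow tpJ C1 tpC_bound) -expRM_natl natrX rs.
    by rewrite mulrCA rs /y (iter_cube_tp tpJ C1 tpC_bound).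
  have r1 : `|r| <= 1 / 2.
    rewrite /r normrM normfV (gtr0_norm k0) ler_pdivrMr//; lra.
  have q := opexp_shift_small z1 r1; rewrite -/A in q.
  have Ar0 : 0 <= A * r ^+ 2 by rewrite mulr_ge0 ?sqr_ge0.
  apply: (@le_trans _ _ ((1 + A * r ^+ 2) ^+ (3 ^ k))).
    by rewrite lerXn2r ?nnegrE ?rnorm_ge0 ?addr_ge0.
  apply: le_trans (expr_1D_le _ Ar0) _; rewrite ler_expR natrX.
  have -> : 3 ^+ k * (A * r ^+ 2) = A * s ^+ 2 / 3 ^+ k.
    by rewrite -rs; field; rewrite gt_eqF.
  rewrite ler_pdivrMr// mul1r; apply: le_trans (_ : A * L ^+ 2 <= _); last lra.
  by rewrite ler_wpM2l// -[s ^+ 2]real_normK ?num_real// lerXn2r ?nnegrE ?(ltW L0).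
have := cauchy_estimate SM (x := y) (r := L) (K := expR 1) 1 L0.
rewrite /= (_ : 1`! = 1%N)// expr1 /S => h.
have -> : y - tp z z y = - (tp z z y + (- 1)%:C *: y).
  by rewrite rmorphN rmorph1 scaleN1r opprB.
rewrite rnormN; apply: le_trans (h _) _.
  move=> w wL; rewrite (opexp_norm_Re SM Sh); apply: key.
  rewrite ler_norml -wL Re_le_absc andbT.
  have := Re_le_absc (- w); rewrite raddfN /=.
  by rewrite /absc normrN; lra.
have e0 := expR_gt0 (1 : R).
by rewrite /L invf_div mul1r divfK ?gt_eqF.
Qed.

(** By polarization G = i (L(z,b) - L(b,z)) equals L(b + iz, b + iz) - L(b,b) - L(z,z) and is
    hermitian; moreover i G z = L(z,z) b - Q(z) b. [hermitian_upper] applies, with |G| <= 2 C. *)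
Lemma rnorm_tp_sub_quad z b (s : R) : N z <= 1 -> N b <= 1 ->
  N (z + s%:C *: (tp z z b - quad z b)) <= 1 + 4 * C ^+ 2 * s ^+ 2.
Proof.
move=> z1 b1; pose G x := 'i *: tp z b x - 'i *: tp b z x.
have c0 : 0 <= C by rewrite (le_trans ler01).
have GE x : G x = tp (b + 'i *: z) (b + 'i *: z) x - tp b b x - tp z z x.
  have ic : Num.conj ('i : R[i]) = - 'i by apply/eqP; rewrite eq_complex /= oppr0 !eqxx.
  rewrite /G !(tpE tpJ) !(tpZm tpJ) ic !scalerA mulrN -expr2 sqr_i opprK; clear; vring.
have Gh : Defs.hermitian G.
  move=> x f x1 fc f1 fx; rewrite GE.
  have fB u v : f (u - v) = f u - f v.
    case: fc => fl _; have := fl (-1) v u.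
    by rewrite scaleN1r mulN1r addrC => ->; rewrite addrC.
  rewrite !fB !rpredB//; exact: (tp_hermitian tpJ _ x1 fc f1 fx).
have GM : bounded_op G (2 * C).
  split=> [c x y||x].
  - by rewrite /G !(tpLr tpJ); clear; vring.
  - by rewrite mulr_ge0.
  - apply: le_trans (rnormB _ _) _; rewrite !rnormZ absci !mul1r.
    have := tp_le C1 tpC_bound z1 b1 (lexx (N x)).
    by have := tp_le C1 tpC_bound b1 z1 (lexx (N x)); lra.
have := hermitian_upper GM Gh s z.
have -> : (s%:C * 'i) *: G z = s%:C *: (tp z z b - quad z b).
  rewrite /G -scalerA; congr (_ *: _); rewrite -scalerBr scalerA -expr2 sqr_i scaleN1r opprB.
  by rewrite /quad (tpC tpJ b z z).
move=> /le_trans; apply.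
have : (1 + s ^+ 2 * (2 * C) ^+ 2) * N z <= (1 + s ^+ 2 * (2 * C) ^+ 2).
  by rewrite ler_piMr// addr_ge0// mulr_ge0 ?sqr_ge0.
by rewrite exprMn; lra.
Qed.
End KOne.

(** * Functionals that almost norm an element *)

Section DualBall.
Variable R : realType.
Variable V : completeNormedModType R[i].
Local Notation N := (@rnorm R V).

Definition dual_ball (f : V -> R) := real_linear_on setT f /\ forall x, f x <= N x.

Section Functional.
Variable f : V -> R.
Hypothesis fb : dual_ball f.

Lemma dbD x y : f (x + y) = f x + f y.
Proof. by case: fb => -[+ _] _; apply. Qed.

Lemma dbZ (r : R) x : f (r%:C *: x) = r * f x.
Proof. by case: fb => -[_ +] _; apply. Qed.

Lemma dbN x : f (- x) = - f x.
Proof. by case: fb => fl _; exact: (rlinN fl). Qed.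

Lemma dbB x y : f (x - y) = f x - f y. Proof. by rewrite dbD dbN. Qed.

Lemma db_le x : f x <= N x. Proof. by case: fb. Qed.

Lemma db_norm x : `|f x| <= N x.
Proof. by rewrite ler_norml db_le andbT lerNl -dbN -(rnormN x) db_le. Qed.
End Functional.

Lemma db_support x : exists2 f, dual_ball f & f x = N x.
Proof.
have [f [fl fN fx]] := support_functional x (rnorm_sublinear V).
by exists f.
Qed.

End DualBall.

Section Facial.
Variable R : realType.
Variable V : completeNormedModType R[i].
Variable tp : V -> V -> V -> V.
Hypothesis tpJ : is_JBstar_triple tp.
Local Notation N := (@rnorm R V).
Variable C : R.
Hypothesis C1 : 1 <= C.
Hypothesis tpC_bound : forall a b c, N (tp a b c) <= C * N a * N b * N c.
Local Notation quad := (quad tp).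
Local Notation cube := (cube tp).
Let C0 : 0 <= C. Proof. by rewrite (le_trans ler01). Qed.

Lemma tp_le1 a b c : N a <= 1 -> N b <= 1 -> N c <= 1 -> N (tp a b c) <= C.
Proof. by move=> a1 b1 c1; have := tp_le C1 tpC_bound a1 b1 c1; rewrite !mulr1. Qed.

Lemma rnorm_cube_le1 z : N z <= 1 -> N (cube z) <= 1.
Proof. by move=> z1; rewrite (rnorm_cube tpJ) exprn_ile1// rnorm_ge0. Qed.

(** For a unit vector u with f u = 1, the cubic estimate reads 1 + t (1 - f (u^3)) <= 1 + O(t^2);
    dividing by t gives f (u^3) >= 1. *)
Lemma cube_support f w : dual_ball f -> f w = N w -> N w ^+ 3 <= f (cube w).
Proof.
move=> fb fw; have [->|w0] := eqVneq w 0.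
  by rewrite rnorm0 expr0n /= /cube (tp0l tpJ) -(subrr 0) (dbB fb) subrr.
have n0 := rnorm_gt0 w0.
pose u := ((N w)^-1)%:C *: w.
have u1 : N u = 1 by rewrite rnormZr ger0_norm ?invr_ge0 ?(ltW n0)// mulVf ?gt_eqF.
have fu : f u = 1 by rewrite (dbZ fb) fw mulVf ?gt_eqF.
have fcu : 1 <= f (cube u).
  apply: (@le_of_le_small _ _ _ ((C + 1) ^+ 2 * expR (C + 1)) (1 / 2)).
    by rewrite divr_gt0.
  move=> e e0 e1.
  have u1' : N u <= 1 by rewrite u1.
  have := rnorm_sub_cube tpJ C1 tpC_bound u1' (ltW e0) e1.
  have := db_le fb (u + e%:C *: (u - cube u)).
  rewrite (dbD fb) (dbZ fb) (dbB fb) fu; set A := _ * expR _ => h1 h2.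
  have h3 : e * (1 - f (cube u)) <= e * (A * e) by lra.
  have := h3; rewrite ler_pM2l//; lra.
have -> : cube w = (N w ^+ 3)%:C *: cube u.
  rewrite /cube /u !(tpZl tpJ, tpZr tpJ, tpZmr tpJ) !scalerA -!rmorphM.
  have -> : N w ^+ 3 * (N w)^-1 * (N w)^-1 * (N w)^-1 = 1 by field; rewrite gt_eqF.
  by rewrite rmorph1 scale1r.
by rewrite (dbZ fb) ler_peMr// exprn_ge0// ltW.
Qed.

(* Compare the norm of q = w^3 + k w, w = z + s g, with the value at q of a functional f
   supporting q, which is forced to almost norm z as well. *)
Lemma facial_quad f z g (h : R) : dual_ball f -> N z <= 1 -> N g <= 1 ->
  0 < h -> h <= 1 -> 1 - h ^+ 4 <= f z ->
  f g <= N (quad z g) + 22 * C ^+ 2 * h.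
Proof.
move=> fb z1 g1 h0 h1 fz.
(* The scales: the defect h^4 = h s of f at z is negligible against the increment s, while the
   summand k w of q with k = h forces 1 - p z = O(h^2). *)
pose s := h ^+ 3; pose k := h.
have s0 : 0 < s by rewrite exprn_gt0.
have s1 : s <= 1 by rewrite exprn_ile1// ltW.
pose w := z + s%:C *: g; pose q := cube w + k%:C *: w.
have [p pb pq] := db_support q.
have [p' pb' pw'] := db_support w.
pose n := N w; have n0 : 0 <= n := rnorm_ge0 w.
have n3 := cube_support pb' pw'; rewrite -/n in n3 pw'.
have Nq : n ^+ 3 + k * n <= p q.
  rewrite pq; apply: le_trans (db_le pb' q).
  by rewrite (dbD pb') (dbZ pb') pw' lerD2r.
have nf : 1 - h ^+ 4 + s * f g <= n.
  by have := db_le fb w; rewrite (dbD fb) (dbZ fb) -/n; lra.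
have n32 : 3 * n - 2 <= n ^+ 3.
  have -> : n ^+ 3 = 3 * n - 2 + (n - 1) ^+ 2 * (n + 2) by ring.
  by rewrite lerDl mulr_ge0 ?sqr_ge0// addr_ge0.
pose T := tp z z g; pose Q := quad z g.
pose r := tp g g z + tp g g z + quad g z + s%:C *: cube g.
have qE : q = cube z + k%:C *: z + s%:C *: (T + T + Q + k%:C *: g) + (s ^+ 2)%:C *: r.
  have e2 : (s ^+ 2)%:C = s%:C * s%:C by rewrite -rmorphM.
  rewrite /q /w /r /T /Q /cube /quad !(tpE tpJ) e2.
  by rewrite (tpC tpJ g z z) (tpC tpJ z g g); clear; vring.
clearbody q.
have NT : p T <= C by apply: le_trans (db_le pb _) _; exact: tp_le1.
have NQ : p Q <= C by apply: le_trans (db_le pb _) _; exact: tp_le1.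
have Nr : p r <= 4 * C.
  have r1 := tp_le1 g1 g1 z1; have r2 := tp_le1 g1 z1 g1; have r3 := tp_le1 g1 g1 g1.
  have d1 := db_le pb (tp g g z); have d2 := db_le pb (quad g z).
  have d3 := db_le pb (cube g).
  have : s * p (cube g) <= 1 * C.
    apply: le_trans (_ : s * C <= _); last by rewrite ler_wpM2r.
    by rewrite ler_wpM2l ?(ltW s0)//; apply: le_trans d3 r3.
  rewrite /r !(dbD pb) (dbZ pb).
  move: r1 r2 d1 d2; rewrite /quad; lra.
clearbody r.
have pg := le_trans (db_le pb g) g1.
have pz := le_trans (db_le pb z) z1.
have pz3 := le_trans (db_le pb _) (rnorm_cube_le1 z1).
have fg : -1 <= f g by have := db_norm fb g; rewrite ler_norml => /andP[]; lra.
have fg1 := le_trans (db_le fb g) g1.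
move: Nq; rewrite qE !(dbD pb) !(dbZ pb) !(dbD pb) !(dbZ pb) => Nq.
have k2 := rnorm_tp_sub_quad tpJ C1 tpC_bound h z1 g1.
have := le_trans (db_le pb _) k2; rewrite (dbD pb) (dbZ pb) (dbB pb) -/T -/Q => {}k2.
have pQ := db_le pb Q; rewrite /Q in pQ.
rewrite -/Q in pQ *.
have h4 : h ^+ 4 = h * s by rewrite /s exprS.
have sh : s = h * h * h by rewrite /s; ring.
move: (f z) (f g) (p z) (p T) (p Q) (p r) (p g) (p (cube z)) (N Q) fz nf NT NQ Nr pg pz pz3 fg fg1 Nq k2 pQ n32.
rewrite h4 /k.
move=> Fz Fg Pz PT PQ Pr Pg Pc NQ' fz nf NT NQ Nr pg pz pz3 fg fg1 Nq k2 pQ n32.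
clear - h0 h1 C1 C0 s0 s1 n0 fz nf NT NQ Nr pg pz pz3 fg fg1 Nq k2 pQ n32 sh.
clearbody n s.
have CC : C <= C ^+ 2 by rewrite expr2 ler_peMl.
have hs : h * s <= s by rewrite ler_piMl// ltW.
have shh : s <= h.
  by rewrite sh -mulrA ler_piMr ?(ltW h0)// mulr_ile1// ltW.
have I1 : (3 + h) * (1 - h * s + s * Fg) - 2 <=
    Pc + h * Pz + s * (PT + PT + PQ + h * Pg) + s ^+ 2 * Pr.
  have : (3 + h) * (1 - h * s + s * Fg) <= (3 + h) * n by rewrite ler_wpM2l//; lra.
  lra.
have I2 : s ^+ 2 * Pr <= s * (4 * C * s).
  have -> : s ^+ 2 * Pr = s * (s * Pr) by ring.
  by rewrite ler_wpM2l ?(ltW s0)// mulrC ler_wpM2r ?(ltW s0).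
have hPg : h * Pg <= h by rewrite ler_piMr ?(ltW h0).
have hPz : h * Pz <= h by rewrite ler_piMr ?(ltW h0).
have b1 : h * (1 - Pz) <= h * (16 * C * (h * h)).
  have -> : h * (16 * C * (h * h)) = 16 * C * s by rewrite sh; ring.
  have c1 : s * (PT + PT + PQ + h * Pg) <= s * (3 * C + 1) by rewrite ler_wpM2l ?(ltW s0)//; lra.
  have c2 : s * (4 * C * s) <= s * (4 * C) by rewrite ler_wpM2l ?(ltW s0)// ler_piMr// mulr_ge0.
  have c3 : - (8 * s) <= (3 + h) * (- (h * s) + s * Fg).
    have sF : -1 * s <= Fg * s by rewrite ler_wpM2r ?(ltW s0).
    have : (3 + h) * (s + s) <= 4 * (s + s) by rewrite ler_wpM2r//; lra.
    have : (3 + h) * (- (s + s)) <= (3 + h) * (- (h * s) + s * Fg) by rewrite ler_wpM2l//; lra.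
    lra.
  have c4 : s <= C * s by rewrite ler_peMl// ltW.
  lra.
rewrite ler_pM2l// in b1.
(* The bound for the norm of z + h (T - Q) and 1 - p z = O(h^2) give p T <= p Q + O(h), so that |Q|
   controls the terms 2 T + Q of the expansion of q. *)
have b2 : h * (PT - PQ) <= h * (20 * C ^+ 2 * h).
  have : C * (h * h) <= C ^+ 2 * (h * h) by rewrite ler_wpM2r ?mulr_ge0 ?(ltW h0).
  lra.
rewrite ler_pM2l// in b2.
have b3 : s * ((3 + h) * (Fg - h)) <= s * (PT + PT + PQ + h + 4 * C * s).
  have : s * (h * Pg) <= s * h by rewrite ler_wpM2l ?(ltW s0).
  lra.
rewrite ler_pM2l// in b3.
have hF : - h <= h * Fg by rewrite -mulrN1 ler_wpM2l ?(ltW h0).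
have hh : h * h <= h by rewrite ler_piMr ?(ltW h0).
have Cs : C * s <= C ^+ 2 * h.
  by apply: ler_pM => //; exact: ltW.
have C21 : 1 <= C ^+ 2 by exact: le_trans CC.
have Ch : h <= C ^+ 2 * h by rewrite -[leLHS]mul1r ler_wpM2r ?(ltW h0).
lra.
Qed.

Lemma facial_cube (e : R) : 0 < e -> exists2 d : R, 0 < d &
  forall f z, dual_ball f -> N z <= 1 -> 1 - d <= f z -> 1 - e <= f (cube z).
Proof.
move=> e0; pose A := (C + 1) ^+ 2 * expR (C + 1).
have A0 : 0 <= A by rewrite mulr_ge0 ?sqr_ge0 ?expR_ge0.
pose t := Num.min (1 / 2) (e / (2 * (A + 1))).
have A1 : 0 < A + 1 by rewrite ltr_wpDl.
have t0 : 0 < t by rewrite lt_min !divr_gt0 ?mulr_gt0.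
have t1 : t <= 1 / 2 by rewrite ge_min lexx.
have tA : t * (2 * (A + 1)) <= e.
  by rewrite -ler_pdivlMr ?mulr_gt0// ge_min lexx orbT.
exists (t * e / 4); first by rewrite divr_gt0 ?mulr_gt0.
move=> f z fb z1 fz.
have := le_trans (db_le fb _) (rnorm_sub_cube tpJ C1 tpC_bound z1 (ltW t0) t1).
rewrite (dbD fb) (dbZ fb) (dbB fb) -/A => h.
have te : t * e <= 1 / 2 * e by rewrite ler_wpM2r ?(ltW e0).
have : t * (1 - e) <= t * f (cube z).
  have : t * (t * (2 * (A + 1))) <= t * e by rewrite ler_wpM2l ?(ltW t0).
  have : t * (1 - t * e / 4) <= t * f z by rewrite ler_wpM2l ?(ltW t0).
  have : t * (t * e) <= t * (1 / 2 * e) by rewrite ler_wpM2l ?(ltW t0).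
  have : 0 <= t * t by rewrite mulr_ge0 ?(ltW t0).
  have : 0 < t * e by rewrite mulr_gt0.
  clearbody A t; lra.
by rewrite ler_pM2l.
Qed.

Lemma facial_iter_cube k (e : R) : 0 < e -> exists2 d : R, 0 < d &
  forall f z, dual_ball f -> N z <= 1 -> 1 - d <= f z -> 1 - e <= f (iter k cube z).
Proof.
elim: k e => [|k IHk] e e0; first by exists e.
have [d1 d10 h1] := facial_cube e0.
have [d d0 h] := IHk _ d10.
exists d => // f z fb z1 fz; apply: h1 => //; last exact: h.
by rewrite (rnorm_iter_cube tpJ) exprn_ile1// rnorm_ge0.
Qed.

(** Let y be an iterated cube of z almost fixed by L(z,z), and u = b - L(z,z) b. Commutation of Q(y)
    with L(z,z) gives Q(y) u = {y - L(z,z) y, b, y}, which is small, and [facial_quad] at y bounds f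
    u. The depth k depends on e alone, whence the uniformity. *)
Lemma facial_tp (e : R) : 0 < e -> exists2 d : R, 0 < d &
  forall f z b, dual_ball f -> N z <= 1 -> N b <= 1 -> 1 - d <= f z ->
  `|f (b - tp z z b)| <= e.
Proof.
move=> e0; pose K := 88 * C ^+ 3 + 1.
have K0 : 0 < K by rewrite ltr_wpDl// mulr_ge0 ?exprn_ge0.
pose h := Num.min 1 (e / (2 * K)).
have h0 : 0 < h by rewrite lt_min ltr01 divr_gt0 ?mulr_gt0.
have h1 : h <= 1 by rewrite ge_min lexx.
have hK : h * (2 * K) <= e by rewrite -ler_pdivlMr ?mulr_gt0// ge_min lexx orbT.
pose a := e / (2 * C).
have C0' : 0 < C by rewrite (lt_le_trans ltr01).
have a0 : 0 < a by rewrite divr_gt0 ?mulr_gt0.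
have [k hk] := tp_iter_cube_approx tpJ C1 tpC_bound a0.
have [d d0 hd] := facial_iter_cube k (exprn_gt0 4 h0).
exists d => // f z b fb z1 b1 fz.
pose y := iter k cube z; pose u := b - tp z z b.
have y1 : N y <= 1 by rewrite (rnorm_iter_cube tpJ) exprn_ile1// rnorm_ge0.
have Qu : quad y u = tp (y - tp z z y) b y.
  have e1 := tp_quad_iter_cube tpJ z k b; rewrite -/y in e1.
  have := tp_jordan tpJ z z y b y; rewrite -[tp z z (tp y b y)]/(tp z z (quad y b)) e1.
  have -> : tp y b (tp z z y) = tp (tp z z y) b y by rewrite (tpC tpJ).
  rewrite -[tp y (tp z z b) y]/(quad y (tp z z b)); set p := quad y _; set q := tp _ b y.
  move=> pq; have {pq} pq : p = q.
    have : (2 : R[i]) *: (p - q) = 0.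
      have -> : (2 : R[i]) *: (p - q) = p - (q - p + q) by clear; vring.
      by rewrite -pq subrr.
    by move/eqP; rewrite scaler_eq0 pnatr_eq0 /= subr_eq0 => /eqP.
  rewrite /u /quad (tpDm tpJ) (tpNm tpJ) (tpDl tpJ) (tpNl tpJ).
  by rewrite -[tp y (tp z z b) y]/p pq.
have NQu : N (quad y u) <= e / 2.
  rewrite Qu; apply: le_trans (tp_le C1 tpC_bound (hk z z1) b1 y1) _.
  rewrite !mulr1 /a; have -> // : C * (e / (2 * C)) = e / 2.
  by field; rewrite gt_eqF.
have Nu : N u <= 2 * C.
  apply: le_trans (rnormB _ _) _; have -> : 2 * C = C + C by ring.
  by rewrite lerD ?(le_trans b1)// tp_le1.
have key v : N v <= 2 * C -> N (quad y v) <= e / 2 -> f v <= e.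
  (* Scaling v into the unit ball turns the error 22 C^2 h of [facial_quad] into 44 C^3 h. *)
  move=> Nv NQv; pose c := (2 * C)^-1.
  have c0 : 0 < c by rewrite invr_gt0 mulr_gt0.
  have g1 : N (c%:C *: v) <= 1.
    by rewrite rnormZr gtr0_norm// /c mulrC ler_pdivrMr ?mulr_gt0// mul1r.
  have := facial_quad fb y1 g1 h0 h1 (hd f z fb z1 fz).
  rewrite (dbZ fb) /quad (tpZmr tpJ) rnormZr (gtr0_norm c0) -/(quad y v) => q1.
  have : c * f v <= c * (N (quad y v) + 44 * C ^+ 3 * h).
    have -> : c * (N (quad y v) + 44 * C ^+ 3 * h) = c * N (quad y v) + 22 * C ^+ 2 * h.
      by rewrite /c; field; rewrite gt_eqF.
    exact: q1.
  rewrite ler_pM2l// => q2; move: hK NQv q2; rewrite /K; clear - e0 h0; clearbody h; lra.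
rewrite ler_norml -/u key// andbT lerNl -(dbN fb) key// ?rnormN//.
by rewrite /quad (tpNm tpJ) rnormN.
Qed.

(** For Q(z) b, evaluate f at z + s (L(z,z) b - Q(z) b) and z - s (L(z,z) b - Q(z) b), both of norm
    1 + O(s^2). With s proportional to e, the defect s e / 4 of f at z is still O(e) after division
    by s. *)
Lemma facial (e : R) : 0 < e -> exists2 d : R, 0 < d &
  forall f z b, dual_ball f -> N z <= 1 -> N b <= 1 -> 1 - d <= f z ->
  `|f (b - tp z z b)| <= e /\ `|f (b - quad z b)| <= e.
Proof.
move=> e0; have e20 : 0 < e / 2 by rewrite divr_gt0.
have [d d0 hd] := facial_tp e20.
have C20 : 0 < 8 * C ^+ 2 by rewrite mulr_gt0// exprn_gt0// (lt_le_trans ltr01).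
pose s := e / (2 * (8 * C ^+ 2)).
have s0 : 0 < s by apply: divr_gt0 => //; apply: mulr_gt0.
have sC : s * (4 * C ^+ 2) = e / 4 by rewrite /s; field; rewrite gt_eqF// (lt_le_trans ltr01).
exists (Num.min d (s * e / 4)); first by rewrite lt_min d0 divr_gt0// mulr_gt0.
move=> f z b fb z1 b1 fz.
have fz1 : 1 - d <= f z.
  by apply: le_trans fz; rewrite lerD2l lerN2 ge_min lexx.
have fz2 : 1 - s * e / 4 <= f z.
  by apply: le_trans fz; rewrite lerD2l lerN2 ge_min lexx orbT.
have h1 := hd f z b fb z1 b1 fz1.
split; first by apply: le_trans h1 _; lra.
have k (r : R) := le_trans (db_le fb _) (rnorm_tp_sub_quad tpJ C1 tpC_bound r z1 b1).
have h2 : `|f (tp z z b) - f (quad z b)| <= e / 2.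
  have k1 := k s; have k2 := k (- s).
  rewrite (dbD fb) (dbZ fb) (dbB fb) in k1.
  rewrite (dbD fb) (dbZ fb) (dbB fb) sqrrN in k2.
  have sq : 4 * C ^+ 2 * s ^+ 2 = s * (e / 4) by rewrite -sC; ring.
  rewrite sq in k1 k2; rewrite ler_norml; apply/andP; split.
    rewrite -(ler_pM2l s0); lra.
  rewrite -(ler_pM2l s0); lra.
have -> : b - quad z b = (b - tp z z b) + (tp z z b - quad z b) by rewrite addrA subrK.
rewrite (dbD fb); apply: le_trans (ler_normD _ _) _.
by rewrite [f (tp z z b - _)](dbB fb); lra.
Qed.
End Facial.

(** * Separation and dual norms *)

Section QuotientNorm.
Variable R : realType.
Variable W : lmodType R[i].
Variables (p : W -> R) (S : set W).
Hypotheses (ps : sublinear p) (p0 : forall x, 0 <= p x) (SS : real_sub S).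

(** The quotient seminorm of p modulo S; functionals dominated by it vanish on S. *)
Definition infdist u : R := inf [set p (u - k) | k in S].

Let lb u : lbound [set p (u - k) | k in S] 0. Proof. by move=> _ [k _ <-]. Qed.
Let ne u : [set p (u - k) | k in S] !=set0.
Proof. by exists (p (u - 0)); exists 0 => //; case: SS. Qed.

Lemma infdist_le u k : S k -> infdist u <= p (u - k).
Proof. by move=> Sk; apply: ge_inf; [exists 0; exact: lb|exists k]. Qed.

Lemma infdist_ge0 u : 0 <= infdist u.
Proof. by apply: lb_le_inf; [exact: ne|exact: lb]. Qed.

Lemma infdist_approx u (e : R) : 0 < e -> exists2 k, S k & p (u - k) <= infdist u + e.
Proof.
move=> e0; have [|_ [k Sk <-] h] := inf_adherent e0 (E := [set p (u - k) | k in S]).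
  by split; [exact: ne|exists 0; exact: lb].
by exists k => //; exact: ltW.
Qed.

Lemma infdist_le0 u : infdist u <= p u.
Proof. by rewrite -[u in p u]subr0; apply: infdist_le; case: SS. Qed.

Lemma infdist_sublinear : sublinear infdist.
Proof.
case: (ps) => pD pZ; case: (SS) => S0 SD SZ; split=> [x y|r x r0].
  apply/ler_addgt0Pr => e e0; have e20 : 0 < e / 2 by rewrite divr_gt0.
  have [k Sk hk] := infdist_approx x e20; have [l Sl hl] := infdist_approx y e20.
  apply: le_trans (infdist_le _ (SD _ _ Sk Sl)) _.
  rewrite opprD addrACA; apply: le_trans (pD _ _) _; lra.
have half s y : 0 < s -> infdist (s%:C *: y) <= s * infdist y.
  move=> s0; apply/ler_addgt0Pr => e e0.
  have es0 : 0 < e / s by rewrite divr_gt0.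
  have [k Sk hk] := infdist_approx y es0.
  apply: le_trans (infdist_le _ (SZ s _ Sk)) _.
  rewrite -scalerBr pZ ?(ltW s0)//.
  by apply: le_trans (ler_wpM2l (ltW s0) hk) _; rewrite mulrDr mulrC [s * (e / s)]mulrC divfK ?gt_eqF// mulrC.
have [->|rn0] := eqVneq r 0.
  rewrite scale0r mul0r; apply/eqP; rewrite eq_le infdist_ge0 andbT.
  by apply: le_trans (infdist_le0 _) _; rewrite -(scale0r 0) -(rmorph0 (real_complex R)) pZ// mul0r.
have rp : 0 < r by rewrite lt_def rn0.
apply/eqP; rewrite eq_le half//=.
rewrite mulrC -ler_pdivlMr// mulrC.
have := half r^-1 (r%:C *: x); rewrite invr_gt0 scalerA -rmorphM mulVf// rmorph1 scale1r.
exact.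
Qed.

Lemma infdist_S u : S u -> infdist u <= 0.
Proof.
move=> Su; apply: le_trans (infdist_le _ Su) _; rewrite subrr.
by case: ps => _ pZ; rewrite -(scale0r 0) -(rmorph0 (real_complex R)) pZ// mul0r.
Qed.

End QuotientNorm.

Section Separation.
Variable R : realType.
Variable V : completeNormedModType R[i].
Local Notation N := (@rnorm R V).

(** For f in the dual ball of V this says that the restriction of f to E has norm one. *)
Definition norming (E : set V) (f : V -> R) :=
  forall e : R, 0 < e -> exists x, [/\ E x, N x <= 1 & 1 - e <= f x].

Lemma real_linear_on_sub (A B : set V) f : A `<=` B ->
  real_linear_on B f -> real_linear_on A f.
Proof.
by move=> AB [fD fZ]; split=> [x y /AB Bx /AB By|r x /AB Bx]; [apply: fD|apply: fZ].
Qed.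

(** A functional supporting the distance to S at y vanishes on S, but its norm c on E may be smaller
    than on V. Its restriction to E is divided by c and extended again, so that the norm on V
    becomes one and is approached inside E. *)
Lemma db_separation (E S : set V) y : real_sub E -> real_sub S -> closed S ->
  E y -> ~ S y ->
  exists f, [/\ dual_ball f, norming E f, 0 < f y & forall x, E x -> S x -> f x = 0].
Proof.
move=> EE SS Sc Ey nSy.
have Np : sublinear N := rnorm_sublinear V.
have N0 : forall x : V, 0 <= N x by exact: rnorm_ge0.
have [g [gl gle gy]] := support_functional y (infdist_sublinear Np N0 SS).
have gb : dual_ball g.
  by split=> // x; apply: le_trans (gle x) _; exact: infdist_le0.
have gy0 : 0 < g y.
  rewrite gy lt_neqAle infdist_ge0// andbT; apply/negP => /eqP h; apply: nSy.
  apply: closed_rnorm Sc _ => e e0.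
  by have [k Sk hk] := infdist_approx N0 SS y e0; exists k => //; rewrite -h add0r in hk.
have gS x : S x -> g x = 0.
  move=> Sx; have h z : S z -> g z <= 0.
    by move=> Sz; apply: le_trans (gle z) _; exact: infdist_S.
  apply/eqP; rewrite eq_le h//= -oppr_le0 -(dbN gb) h//.
  exact: real_subN.
pose A := [set g x | x in [set x | E x /\ N x <= 1]].
have A0 : A 0 by exists 0; [split; [case: EE|rewrite rnorm0]|rewrite -(subrr 0) (dbB gb) subrr].
have Aub : ubound A 1 by move=> _ [x [_ x1] <-]; exact: le_trans (db_le gb x) x1.
have supA : has_sup A by split; [exists 0|exists 1].
pose c := sup A.
have le_c x : E x -> N x <= 1 -> g x <= c.
  by move=> Ex x1; apply: sup_upper_bound => //; exists x.
have ny : 0 < N y by apply: lt_le_trans gy0 (db_le gb y).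
have g_le x : E x -> g x <= c * N x.
  move=> Ex; have [->|xn0] := eqVneq x 0.
    by rewrite rnorm0 mulr0 -(subrr 0) (dbB gb) subrr.
  have nx := rnorm_gt0 xn0.
  rewrite -ler_pdivrMr// mulrC -(dbZ gb); apply: le_c.
    by case: EE => _ _; apply.
  by rewrite rnormZr gtr0_norm ?invr_gt0// mulVf// gt_eqF.
have c0 : 0 < c.
  by rewrite -(pmulr_lgt0 _ ny); apply: lt_le_trans gy0 (g_le y Ey).
have [f [fl fN fE]] : exists f, [/\ real_linear_on setT f, forall x, f x <= N x &
    forall x, E x -> f x = c^-1 * g x].
  apply: (hahn_banach Np EE) => [|x Ex].
    split=> [u v _ _|r u _]; first by rewrite (dbD gb) mulrDr.
    by rewrite (dbZ gb) mulrCA.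
  by rewrite mulrC ler_pdivrMr// mulrC g_le.
exists f; split => //.
- move=> e e0; have ce0 : 0 < c * e by rewrite mulr_gt0.
  have [_ [x [Ex x1] <-] h] := sup_adherent ce0 supA.
  exists x; split => //; rewrite fE// mulrC ler_pdivlMr//.
  by rewrite mulrBl mul1r mulrC; exact: ltW.
- by rewrite fE// mulr_gt0// invr_gt0.
- by move=> x Ex Sx; rewrite fE// gS// mulr0.
Qed.
End Separation.

Section DualSpace.
Variable R : realType.
Variable V : completeNormedModType R[i].
Local Notation N := (@rnorm R V).
Variable E : set V.
Hypothesis EE : real_sub E.
Implicit Types f g : V -> R.

Lemma dualP f : dual E f <-> [/\ forall x, ~ E x -> f x = 0, real_linear_on E f &
  exists K, forall x, E x -> `|f x| <= K * N x].
Proof.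
split=> [[f0 fD fZ fc]|[f0 [fD fZ] [K fK]]]; split=> //.
- have E0 : E 0 by case: EE.
  have fl : real_linear_on E f by split.
  have f00 : f 0 = 0 := rlin0 EE fl.
  have := (subspace_continuousP E f).1 fc 0 E0.
  move/cvgrPdist_lt => /(_ 1 ltr01); rewrite f00 /within /= => /nbhs_normP[e e0 he].
  have eE : e = (complex.Re e)%:C by rewrite RRe_real // gtr0_real.
  pose d := complex.Re e / 2.
  have re0 : 0 < complex.Re e by move: e0; rewrite /= {1}eE ltcR.
  have d0 : 0 < d by rewrite divr_gt0.
  exists d^-1 => x Ex; have [->|xn0] := eqVneq x 0.
    by rewrite f00 rnorm0 normr0 mulr0.
  have nx := rnorm_gt0 xn0.
  pose y := (d / N x)%:C *: x.
  have Ey : E y by case: EE => _ _; apply.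
  have : `|0 - f y| < 1.
    apply: he => //; rewrite /= sub0r normrN rnormE eE ltcR rnormZr.
    rewrite gtr0_norm ?divr_gt0// divfK ?gt_eqF// /d; lra.
  rewrite sub0r normrN fZ// normrM (gtr0_norm (divr_gt0 d0 nx)) => h.
  rewrite mulrC ler_pdivlMr//.
  have -> : `|f x| * d = d / N x * `|f x| * N x by field; rewrite gt_eqF.
  by rewrite -[leRHS]mul1r ler_pM2r// ltW.
- apply/subspace_continuousP => x Ex; apply/cvgrPdist_lt => e e0.
  have K0 : 0 < `|K| + 1 by rewrite ltr_wpDl.
  rewrite /within /=; apply/nbhs_normP; exists (e / (`|K| + 1))%:C => /=.
    by rewrite ltcR divr_gt0.
  move=> y; rewrite /= rnormE ltcR ltr_pdivlMr// => h Ey.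
  have fl : real_linear_on E f by split.
  rewrite -(rlinB EE fl)//; apply: le_lt_trans (fK _ (real_subB EE Ex Ey)) _.
  apply: le_lt_trans h; rewrite mulrC ler_wpM2l ?rnorm_ge0//.
  by have := ler_norm K; lra.
Qed.

Definition restr f x : R := if `[< E x >] then f x else 0.

Lemma restrE f x : E x -> restr f x = f x.
Proof. by move=> Ex; rewrite /restr asboolT. Qed.

Lemma dual_restr f (K : R) : real_linear_on E f -> (forall x, E x -> `|f x| <= K * N x) ->
  dual E (restr f).
Proof.
move=> [fD fZ] fK; case: (EE) => _ ED EZ; apply/dualP; split.
- by move=> x nEx; rewrite /restr asboolF.
- by split=> [x y Ex Ey|r x Ex]; rewrite !restrE ?fD ?fZ//; [apply: ED|apply: EZ].
- by exists K => x Ex; rewrite restrE// fK.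
Qed.

Lemma dual_linear f : dual E f -> real_linear_on E f.
Proof. by move/dualP => []. Qed.

Lemma dual_lincomb (r : R) f g : dual E f -> dual E g -> dual E (r *: f + g).
Proof.
move=> /dualP[f0 [fD fZ] [K fK]] /dualP[g0 [gD gZ] [L gL]].
have e x : (r *: f + g) x = r * f x + g x by [].
apply/dualP; split.
- by move=> x nEx; rewrite e f0// g0// mulr0 addr0.
- by split=> [x y Ex Ey|s x Ex]; rewrite !e ?fD ?gD ?fZ ?gZ//; ring.
- exists (`|r| * K + L) => x Ex; rewrite e.
  apply: le_trans (ler_normD _ _) _; rewrite normrM mulrDl -mulrA.
  by rewrite lerD ?gL// ler_wpM2l// fK.
Qed.

Lemma dual_sub f g : dual E f -> dual E g -> dual E (f - g).
Proof.
move=> fE gE; have -> : f - g = (-1) *: g + f by rewrite scaleN1r addrC.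
exact: dual_lincomb.
Qed.

Lemma dnorm_le f (K : R) : (forall x, E x -> N x <= 1 -> `|f x| <= K) -> dnorm E f <= K.
Proof.
move=> fK; apply: ge_sup; last by move=> _ [x [Ex x1] <-]; exact: fK.
by exists `|f 0|; exists 0 => //; split; [case: EE|rewrite rnorm0].
Qed.

Section Norm.
Variable f : V -> R.
Hypothesis fE : dual E f.

Let has_sup_f : has_sup [set `|f x| | x in [set x | E x /\ N x <= 1]].
Proof.
split; first by exists `|f 0|; exists 0 => //; split; [case: EE|rewrite rnorm0].
have /dualP[_ _ [K fK]] := fE; exists `|K| => _ [x [Ex x1] <-].
apply: le_trans (fK x Ex) _; apply: le_trans (ler_norm _) _.
by rewrite normrM ler_piMr// ger0_norm ?rnorm_ge0.
Qed.

Lemma le_dnorm1 x : E x -> N x <= 1 -> `|f x| <= dnorm E f.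
Proof. by move=> Ex x1; apply: sup_upper_bound => //; exists x. Qed.

Lemma dnorm_ge0 : 0 <= dnorm E f.
Proof.
apply: le_trans (le_dnorm1 (x := 0) _ _); first exact: normr_ge0.
  by case: EE.
by rewrite rnorm0.
Qed.

Lemma le_dnorm x : E x -> `|f x| <= dnorm E f * N x.
Proof.
move=> Ex; have [fD fZ] := dual_linear fE; have [->|xn0] := eqVneq x 0.
  by rewrite (rlin0 EE (dual_linear fE)) rnorm0 normr0 mulr0.
have nx := rnorm_gt0 xn0; rewrite -ler_pdivrMr//.
have -> : `|f x| / N x = `|f ((N x)^-1%:C *: x)|.
  by rewrite fZ// normrM gtr0_norm ?invr_gt0// mulrC.
apply: le_dnorm1; first by case: EE => _ _; apply.
by rewrite rnormZr gtr0_norm ?invr_gt0// mulVf ?gt_eqF.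
Qed.

Lemma dnorm_approx (e : R) : 0 < e -> exists x, [/\ E x, N x <= 1 & dnorm E f - e <= f x].
Proof.
move=> e0; have [_ [x [Ex x1] <-] h] := sup_adherent e0 has_sup_f.
have [fx|fx] := leP 0 (f x).
  by exists x; split => //; rewrite ger0_norm// in h; exact: ltW.
exists (- x); split; [exact: real_subN|by rewrite rnormN|].
by rewrite (rlinN (dual_linear fE))// -(ltr0_norm fx); exact: (ltW h).
Qed.
End Norm.
End DualSpace.

(** * M-ideals are triple ideals *)

Section MIdeal.
Variable R : realType.
Variable V : completeNormedModType R[i].
Local Notation N := (@rnorm R V).
Variables E M : set V.
Hypotheses (EE : real_sub E) (ME : is_M_ideal E M).

Let MM : real_sub M. Proof. by case: ME. Qed.
Let MsubE : M `<=` E. Proof. by case: ME. Qed.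

(* The claim is that p(u,v) = inf_(k in M) max(|u-k|,|v-k|) is at most 1 at
   (x+m,x-m). A functional l(u,v) = f u + g v supporting p there has
   |f| + |g| <= 1 and f + g in the polar of M, so that f x + g x is unchanged
   when f, g are replaced by Q f, Q g, while f m, g m only see f - Q f, g - Q g. *)
Lemma M_ideal_approx x m (e : R) : E x -> M m -> N x <= 1 -> N m <= 1 -> 0 < e ->
  exists k, [/\ M k, N (x - k + m) <= 1 + e & N (x - k - m) <= 1 + e].
Proof.
move=> Ex Mm x1 m1 e0; have [_ _ _ [Q [[Qd Ql QQ Qn] Qim]]] := ME.
pose p (u : V * V) := Num.max (N u.1) (N u.2).
have p0 u : 0 <= p u by rewrite le_max rnorm_ge0.
have ps : sublinear p.
  split=> [u v|r u r0].
    rewrite ge_max; apply/andP; split; apply: le_trans (rnormD _ _) _;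
      by rewrite lerD// le_max lexx ?orbT.
  by rewrite /p /= !rnormZr ger0_norm// maxr_pMr.
pose S := [set u : V * V | M u.1 /\ u.2 = u.1].
have SS : real_sub S.
  case: MM => M0 MD MZ; split=> [//|u v [Mu u2] [Mv v2]|r u [Mu u2]].
    by split; [exact: MD|rewrite /= u2 v2].
  by split; [exact: MZ|rewrite /= u2].
have [l [[lD lZ] lp lx]] := support_functional (x + m, x - m) (infdist_sublinear ps p0 SS).
have lle u : l u <= p u by apply: le_trans (lp u) _; exact: infdist_le0.
have pairD (a b c d : V) : (a, b) + (c, d) = (a + c, b + d) :> V * V by [].
have pairZ (r : R[i]) (a b : V) : r *: ((a, b) : V * V) = (r *: a, r *: b) by [].
pose f u := l (u, 0); pose g v := l (0, v).
have fg u v : l (u, v) = f u + g v.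
  by rewrite -lD// pairD addr0 add0r.
have fl : real_linear_on setT f.
  split=> [u v _ _|r u _].
    by rewrite /f -lD// pairD addr0.
  by rewrite /f -lZ// pairZ scaler0.
have gl : real_linear_on setT g.
  split=> [u v _ _|r u _].
    by rewrite /g -lD// pairD addr0.
  by rewrite /g -lZ// pairZ scaler0.
have fb : dual_ball f.
  split=> // u; apply: le_trans (lle _) _.
  by rewrite /p /= rnorm0 ge_max lexx rnorm_ge0.
have gb : dual_ball g.
  split=> // u; apply: le_trans (lle _) _.
  by rewrite /p /= rnorm0 ge_max lexx rnorm_ge0.
pose F := restr E f; pose G := restr E g.
have restr_dual h : dual_ball h -> dual E (restr E h).
  move=> hb; apply: (@dual_restr _ _ _ EE _ 1) => [|y _].
    exact: real_linear_on_sub (proj1 hb).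
  by rewrite mul1r db_norm.
have Fd : dual E F := restr_dual f fb.
have Gd : dual E G := restr_dual g gb.
(* As p is a maximum, the two norms can be approached at u and v independently. *)
have Fn : dnorm E F + dnorm E G <= 1.
  apply/ler_addgt0Pr => d d0; have d20 : 0 < d / 2 by rewrite divr_gt0.
  have [u [Eu u1 hu]] := dnorm_approx EE Fd d20.
  have [v [Ev v1 hv]] := dnorm_approx EE Gd d20.
  rewrite /F /G !restrE// in hu hv; rewrite -/F -/G in hu hv.
  have : f u + g v <= 1.
    by rewrite -fg; apply: le_trans (lle _) _; rewrite ge_max u1.
  lra.
have Qpol h k : dual E h -> M k -> Q h k = 0.
  move=> hd Mk; have : polar E M (Q h) by rewrite -Qim; exists h.
  by case=> _; apply.
have Qsum : F x + G x = Q F x + Q G x.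
  have : polar E M (1 *: F + G).
    split; first exact: dual_lincomb.
    move=> k Mk; have Ek := MsubE Mk.
    have -> : (1 *: F + G) k = f k + g k.
      by rewrite -[LHS]/(1 * F k + G k) mul1r /F /G !restrE.
    have h z : M z -> f z + g z <= 0.
      by move=> Mz; rewrite -fg; apply: le_trans (lp _) _; exact: infdist_S.
    apply/eqP; rewrite eq_le h//= -oppr_le0 opprD -(dbN fb) -(dbN gb) h//.
    exact: real_subN.
  rewrite -Qim => -[h hd hE].
  have : Q (1 *: F + G) = 1 *: F + G by rewrite -hE QQ.
  rewrite Ql// => /(congr1 (fun h => h x)).
  by rewrite -[LHS]/(1 * Q F x + Q G x) -[RHS]/(1 * F x + G x) !mul1r.
have Em := MsubE Mm.
have le1 h y : dual E h -> E y -> N y <= 1 -> h y <= dnorm E h.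
  by move=> hd Ey y1; apply: le_trans (ler_norm _) (le_dnorm1 EE hd Ey y1).
have QFd := Qd _ Fd; have QGd := Qd _ Gd.
have FQd := dual_sub EE Fd QFd; have GQd := dual_sub EE Gd QGd.
have value : l (x + m, x - m) <= 1.
  rewrite fg (dbD fb) (dbB gb).
  have a1 := le1 _ _ QFd Ex x1; have a2 := le1 _ _ QGd Ex x1.
  have a3 := le1 _ _ FQd Em m1.
  have a4 := le1 _ (- m) GQd (real_subN EE Em); rewrite rnormN in a4.
  have {}a4 := a4 m1.
  rewrite (rlinN (dual_linear EE GQd))// in a4.
  rewrite -[(F - Q F) m]/(F m - Q F m) Qpol// subr0 /F restrE// -/F in a3.
  rewrite -[(G - Q G) m]/(G m - Q G m) Qpol// subr0 /G restrE// -/G in a4.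
  rewrite {1}/F {1}/G !restrE// in Qsum.
  have n1 := Qn _ Fd; have n2 := Qn _ Gd.
  lra.
have [[k1 k2] [/= Mk k12] hk] := infdist_approx p0 SS (x + m, x - m) e0.
rewrite k12 in hk; exists k1.
have := hk; rewrite ge_max => /andP[/= h1 h2]; split => //.
- by rewrite addrAC; apply: le_trans h1 _; rewrite lerD2r -lx.
- by rewrite addrAC; apply: le_trans h2 _; rewrite lerD2r -lx.
Qed.

(** F stands for z -> {z,z,b} or z -> {z,b,z}. At s q, s (q + m) and s (q - m) the functional is
    near 1, so f o F is near f b at all three points, and the parallelogram law leaves 2 s^2 f (F m)
    small. The factor s = 1 / (1 + h) brings the points into the unit ball. *)
Lemma M_ideal_annihilates (b : V) (F : V -> V) f :
  (forall z m, F (z + m) + F (z - m) = F z + F m + (F z + F m)) ->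
  (forall (r : R) z, F (r%:C *: z) = (r ^+ 2)%:C *: F z) ->
  (forall e : R, 0 < e -> exists2 d : R, 0 < d &
    forall f z, dual_ball f -> N z <= 1 -> 1 - d <= f z -> `|f (b - F z)| <= e) ->
  dual_ball f -> norming E f -> (forall x, E x -> M x -> f x = 0) ->
  forall m, M m -> f (F m) = 0.
Proof.
move=> Fpar FZ Fb fb fE f0.
have key m : M m -> N m <= 1 -> f (F m) = 0.
  move=> Mm m1; apply/eqP; rewrite -normr_le0; apply/ler_addgt0Pr => /= e8 e80.
  (* Three approximations within e bound 2 s^2 f (F m) by 4 e, and s >= 1/2: hence the factor 8. *)
  pose e := e8 / 8; have e0 : 0 < e by rewrite divr_gt0.
  have [d d0 hd] := Fb e e0.
  pose h := Num.min 1 (d / 2).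
  have h0 : 0 < h by rewrite lt_min ltr01 divr_gt0.
  have h1 : h <= 1 by rewrite ge_min lexx.
  have h2 : h <= d / 2 by rewrite ge_min lexx orbT.
  have [x [Ex x1 fx]] := fE h h0.
  have [k [Mk ka kb]] := M_ideal_approx Ex Mm x1 m1 h0.
  set q := x - k in ka kb.
  have fq : f q = f x by rewrite (dbB fb) (f0 k) ?subr0//; exact: MsubE.
  have fm : f m = 0 by apply: f0 => //; exact: MsubE.
  have h10 : 0 < 1 + h by lra.
  pose s := (1 + h)^-1; have s0 : 0 < s by rewrite invr_gt0.
  have s2 : 1 / 2 <= s by rewrite /s div1r lef_pV2 ?posrE//; lra.
  have sz y : N y <= 1 + h -> f y = f x -> `|f (b - F (s%:C *: y))| <= e.
    move=> y1 fy; apply: hd => //.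
      by rewrite rnormZr gtr0_norm// /s mulrC ler_pdivrMr// mul1r.
    rewrite (dbZ fb) fy; apply: (@le_trans _ _ (s * (1 - h))).
      rewrite /s mulrC ler_pdivlMr//.
      have : d * h >= 0 by rewrite mulr_ge0// ltW.
      lra.
    by rewrite ler_wpM2l// ltW.
  have nq : N q <= 1 + h.
    have : N (2%:C *: q) <= (1 + h) + (1 + h).
      have -> : 2%:C *: q = (q + m) + (q - m) by rewrite rmorph_nat; clear; vring.
      by apply: le_trans (rnormD _ _) _; rewrite lerD.
    by rewrite rnormZr ger0_norm//; lra.
  clearbody q; have a0 := sz q nq fq.
  have a1 : `|f (b - F (s%:C *: (q + m)))| <= e by apply: sz => //; rewrite (dbD fb) fm addr0.
  have a2 : `|f (b - F (s%:C *: (q - m)))| <= e by apply: sz => //; rewrite (dbB fb) fm subr0.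
  have par : f (F (s%:C *: (q + m))) + f (F (s%:C *: (q - m))) =
      f (F (s%:C *: q)) + s ^+ 2 * f (F m) + (f (F (s%:C *: q)) + s ^+ 2 * f (F m)).
    have := congr1 f (Fpar (s%:C *: q) (s%:C *: m)).
    by rewrite [F (s%:C *: m)]FZ !(dbD fb) (dbZ fb) scalerDr scalerBr.
  rewrite (dbB fb) in a0; rewrite (dbB fb) in a1; rewrite (dbB fb) in a2.
  move: a0 a1 a2; rewrite !ler_norml => /andP[a0 a0'] /andP[a1 a1'] /andP[a2 a2'].
  have q1 : `|s ^+ 2 * f (F m)| <= 2 * e by rewrite ler_norml; lra.
  rewrite normrM ger0_norm ?sqr_ge0// in q1.
  have s4 : 1 / 4 <= s ^+ 2.
    have -> : 1 / 4 = (1 / 2) ^+ 2 :> R by field.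
    by rewrite lerXn2r ?nnegrE ?(ltW s0).
  have : 1 / 4 * `|f (F m)| <= s ^+ 2 * `|f (F m)| by rewrite ler_wpM2r.
  have ee : e8 = 8 * e by rewrite /e; field.
  rewrite -ler_norml add0r ee; move: q1; clear; clearbody e s; lra.
move=> m Mm; have c0 : 0 < N m + 1 by rewrite ltr_wpDl ?rnorm_ge0.
have -> : m = (N m + 1)%:C *: ((N m + 1)^-1%:C *: m).
  by rewrite scalerA -rmorphM mulfV ?gt_eqF// rmorph1 scale1r.
rewrite FZ (dbZ fb) key ?mulr0//.
  by case: MM => _ _; apply.
by rewrite rnormZr gtr0_norm ?invr_gt0// mulrC ler_pdivrMr// mul1r lerDl.
Qed.
End MIdeal.

Section MIdealIsIdeal.
Variable R : realType.
Variable V : completeNormedModType R[i].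
Variable tp : V -> V -> V -> V.
Hypothesis tpJ : is_JBstar_triple tp.
Local Notation N := (@rnorm R V).
Variable C : R.
Hypothesis C1 : 1 <= C.
Hypothesis tpC_bound : forall a b c, N (tp a b c) <= C * N a * N b * N c.
Local Notation quad := (quad tp).
Local Notation cube := (cube tp).

Lemma rnorm_closed (S : set V) :
  (forall x, (forall e : R, 0 < e -> exists2 y, S y & N (x - y) <= e) -> S x) -> closed S.
Proof.
move=> h x xS; apply: h => e e0.
have [|y [Sy xy]] := xS (ball x e%:C); first by apply: nbhsx_ballx; rewrite ltcR.
exists y => //; move: xy; rewrite -ball_normE /= rnormE ltcR; exact: ltW.
Qed.

(** A functional f that vanishes on S, hence on cubes, but is almost normed by some x in M would
    give (1 + t) f x <= 1 + A t^2 with f x near 1, which fails for small t. *)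
Lemma cube_dense (M S : set V) : real_sub M -> real_sub S -> closed S ->
  S `<=` M -> (forall u, M u -> S (cube u)) -> M `<=` S.
Proof.
move=> MM SS Sc SM cS y My; apply: contrapT => nSy.
have [f [fb fM fy fS]] := db_separation MM SS Sc My nSy.
pose A := (C + 1) ^+ 2 * expR (C + 1).
have h (t : R) : 0 < t -> t <= 1 / 2 -> 1 <= A * t.
  move=> t0 t1; have : 1 + t <= 1 + A * t ^+ 2.
    apply: (@le_of_le_small _ _ _ (1 + t) 1) => // e e0 _.
    have [x [Mx x1 fx]] := fM e e0.
    have := le_trans (db_le fb _) (rnorm_sub_cube tpJ C1 tpC_bound x1 (ltW t0) t1).
    rewrite (dbD fb) (dbZ fb) (dbB fb) (fS (cube x)) ?subr0; last 2 first.
    - exact/SM/cS.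
    - exact: cS.
    rewrite -/A.
    have : (1 + t) * (1 - e) <= (1 + t) * f x by rewrite ler_wpM2l//; lra.
    lra.
  by rewrite lerD2l expr2 mulrA -[X in X <= _]mul1r ler_pM2r.
suff : 1 <= 0 :> R by rewrite ler10.
by apply: (@le_of_le_small _ _ _ A (1 / 2)) => // e e0 e1; rewrite add0r h.
Qed.

(** Each term on the right is of the form {u,u,c} or {u,c,u}: on cubes, the ideal property reduces
    to these two products. *)
Lemma tp_triple_cube a b u : tp a b (cube u) =
  tp u u (tp a b u) + tp u u (tp a b u) - quad u (tp b a u).
Proof.
rewrite /cube (tp_jordan tpJ) (tpC tpJ (tp a b u) u u) addrAC; congr (_ + _).
Qed.

(** Reduces the middle position to the outer one: the first two terms contain {u,u,x} and {u,u,y} as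
    outer entries, and the third is of the form {u,u,c}. *)
Lemma tp_quad_cube x y u : tp x (cube u) y =
  tp (tp u u x) u y + tp x u (tp u u y) - tp u u (tp x u y).
Proof.
by rewrite (tp_jordan tpJ u u x u y) /cube opprD opprB; clear; vring.
Qed.

Lemma M_ideal_triple_ideal (E M : set V) : is_real_JBstar_triple tp E ->
  is_M_ideal E M -> is_triple_ideal tp E M.
Proof.
move=> [_ EE Ec Etp] ME; have [MM MsubE Mc _] := ME.
have [_ _ EZ] := EE; have [M0 MD MZ] := MM.
have sq m b : M m -> E b -> M (tp m m b) /\ M (quad m b).
  move=> Mm Eb.
  have c0 : 0 < N b + 1 by rewrite ltr_wpDl ?rnorm_ge0.
  pose b' := (N b + 1)^-1%:C *: b.
  have b'1 : N b' <= 1.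
    by rewrite rnormZr gtr0_norm ?invr_gt0// mulrC ler_pdivrMr// mul1r lerDl.
  have Eb' : E b' by exact: EZ.
  have bE : b = (N b + 1)%:C *: b'.
    by rewrite /b' scalerA -rmorphM mulfV ?gt_eqF// rmorph1 scale1r.
  have gen (F : V -> V) :
      (forall z m, F (z + m) + F (z - m) = F z + F m + (F z + F m)) ->
      (forall (r : R) z, F (r%:C *: z) = (r ^+ 2)%:C *: F z) ->
      (forall e : R, 0 < e -> exists2 d : R, 0 < d &
        forall f z, dual_ball f -> N z <= 1 -> 1 - d <= f z -> `|f (b' - F z)| <= e) ->
      E (F m) -> M (F m).
    move=> Fpar FZ Fb EF; apply: contrapT => nMF.
    have [f [fb fE fy fM]] := db_separation EE MM Mc EF nMF.
    by have := M_ideal_annihilates EE ME Fpar FZ Fb fb fE fM Mm => f0; rewrite f0 ltxx in fy.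
  have Em := MsubE _ Mm.
  split.
    rewrite bE (tpZr tpJ); apply: (MZ); apply: (gen (fun z => tp z z b')).
    - by move=> z k; rewrite !(tpE tpJ); clear; vring.
    - by move=> r z; rewrite (tpZl tpJ) (tpZmr tpJ) scalerA -rmorphM.
    - move=> e e0; have [d d0 hd] := facial tpJ C1 tpC_bound e0.
      by exists d => // f z fb z1 fz; have [] := hd f z b' fb z1 b'1 fz.
    - exact: Etp.
  rewrite bE /quad (tpZmr tpJ); apply: (MZ); apply: (gen (fun z => quad z b')).
  - by move=> z k; rewrite /quad !(tpE tpJ); clear; vring.
  - by move=> r z; rewrite /quad (tpZl tpJ) (tpZr tpJ) scalerA -rmorphM.
  - move=> e e0; have [d d0 hd] := facial tpJ C1 tpC_bound e0.
    by exists d => // f z fb z1 fz; have [] := hd f z b' fb z1 b'1 fz.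
  - exact: Etp.
(* G is the triple product with u in an outer or in the middle position. The u in M with the
   required property form a closed real subspace containing all cubes, hence all of M. *)
have closure (G : V -> V -> V -> V) :
    (forall a b x y, G a b (x + y) = G a b x + G a b y) ->
    (forall a b (r : R) x, G a b (r%:C *: x) = r%:C *: G a b x) ->
    (forall a b x, N (G a b x) <= C * N a * N b * N x) ->
    (forall a b u, E a -> E b -> M u -> M (G a b (cube u))) ->
    forall a b u, E a -> E b -> M u -> M (G a b u).
  move=> GD GZ GC Gcube.
  pose S := [set u | M u /\ forall a b, E a -> E b -> M (G a b u)].
  suff MS : M `<=` S by move=> a b u Ea Eb /MS[_]; apply.
  apply: cube_dense => //.
  - split.
    + by split=> // a b Ea Eb; rewrite -(scale0r 0) -(rmorph0 (real_complex R)) GZ rmorph0 scale0r.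
    + by move=> x y [Mx hx] [My hy]; split=> [|a b Ea Eb]; [exact: MD|rewrite GD; apply: (MD); [exact: hx|exact: hy]].
    + by move=> r x [Mx hx]; split=> [|a b Ea Eb]; [exact: MZ|rewrite GZ; apply: (MZ); exact: hx].
  - apply: rnorm_closed => x hx; split.
      by apply: closed_rnorm Mc _ => e e0; have [y [My _] xy] := hx e e0; exists y.
    move=> a b Ea Eb; apply: closed_rnorm Mc _ => e e0.
    pose K := C * N a * N b + 1.
    have K0 : 0 < K by rewrite ltr_wpDl// !mulr_ge0 ?rnorm_ge0// (le_trans ler01).
    have [y [My hy] xy] := hx (e / K) (divr_gt0 e0 K0).
    exists (G a b y); first exact: hy.
    have -> : G a b x - G a b y = G a b (x - y).
      have nN z : - z = (- 1)%:C *: z :> V by rewrite rmorphN rmorph1 scaleN1r.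
      by rewrite GD [- y]nN GZ -nN.
    apply: le_trans (GC _ _ _) _; apply: le_trans (_ : K * N (x - y) <= _).
      by rewrite ler_wpM2r ?rnorm_ge0// lerDl.
    by rewrite mulrC -ler_pdivlMr.
  - by move=> u [].
  - move=> u Mu; split; first by have [] := sq u u Mu (MsubE _ Mu).
    by move=> a b Ea Eb; exact: Gcube.
have left a b c : E a -> E b -> M c -> M (tp a b c).
  apply: (closure tp) => {a b c}.
  - by move=> a b x y; rewrite (tpDr tpJ).
  - by move=> a b r x; rewrite (tpZr tpJ).
  - exact: tpC_bound.
  - move=> a b u Ea Eb Mu; have Eu := MsubE _ Mu.
    rewrite tp_triple_cube; apply: (real_subB MM).
      by have [h _] := sq u (tp a b u) Mu (Etp _ _ _ Ea Eb Eu); apply: MD.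
    by have [_] := sq u (tp b a u) Mu (Etp _ _ _ Eb Ea Eu).
split => // a b c Ea Mb Ec0.
apply: (closure (fun x y u => tp x u y)) => // {a b c Ea Mb Ec0}.
- by move=> a b x y; rewrite (tpDm tpJ).
- by move=> a b r x; rewrite (tpZmr tpJ).
- by move=> a b x; have := tpC_bound a x b; rewrite -!mulrA [N b * _]mulrC.
- move=> x y u Ex Ey Mu; have Eu := MsubE _ Mu.
  rewrite tp_quad_cube; apply: (real_subB MM).
    apply: MD.
      by rewrite (tpC tpJ); apply: left => //; have [] := sq u x Mu Ex.
    by apply: left => //; have [] := sq u y Mu Ey.
  by have [] := sq u (tp x u y) Mu (Etp _ _ _ Ex Eu Ey).
Qed.
End MIdealIsIdeal.

(** * Triple ideals are M-ideals *)

Section Orthogonality.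
Variable R : realType.
Variable V : completeNormedModType R[i].
Variable tp : V -> V -> V -> V.
Hypothesis tpJ : is_JBstar_triple tp.
Local Notation N := (@rnorm R V).
Variable C : R.
Hypothesis C1 : 1 <= C.
Hypothesis tpC_bound : forall a b c, N (tp a b c) <= C * N a * N b * N c.
Local Notation quad := (quad tp).
Local Notation cube := (cube tp).
Let C0 : 0 <= C. Proof. by rewrite (le_trans ler01). Qed.
Let rnorm_cube1 := rnorm_cube_le1 tpJ.

Definition almost_orthogonal (k : R) a b :=
  forall y, N (tp a b y) <= k * N y /\ N (tp b a y) <= k * N y.

(** Two Jordan identities share the term L(e,e) {e,z,y}; eliminating it expresses L(e^3,z) through
    L(e,e) z and Q(e) z, so smallness of these two vectors suffices for almost orthogonality of e^3
    and z. *)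
Lemma tp_cube_left e z y : tp (cube e) z y =
  tp e (tp e e z) y + tp e (tp e e z) y - tp (quad e z) e y.
Proof.
have h1 := tp_jordan tpJ e z e e y; have h2 := tp_jordan tpJ e e e z y.
rewrite (tpC tpJ z e e) in h1; rewrite h1 -/(cube e) -/(quad e z) in h2.
set a := tp (cube e) z y in h2 *; set b := tp e (tp e e z) y in h2 *.
set c := tp (quad e z) e y in h2 *; set d := tp e e (tp e z y) in h2.
apply/eqP; rewrite -subr_eq0; apply/eqP.
have -> : a - (b + b - c) = (a - b + (c - b + d)) - d by clear; vring.
by rewrite -h2 subrr.
Qed.

Lemma tp_cube_middle e z y : tp z (cube e) y =
  tp (tp e e z) e y + tp (tp e e z) e y - tp e (quad e z) y.
Proof.
have h1 := tp_jordan tpJ e e z e y; have h2 := tp_jordan tpJ z e e e y.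
rewrite (tpC tpJ z e e) in h2; rewrite h2 -/(cube e) -/(quad e z) in h1.
set a := tp z (cube e) y in h1 *; set b := tp (tp e e z) e y in h1 *.
set c := tp e (quad e z) y in h1 *; set d := tp e e (tp z e y) in h1.
apply/eqP; rewrite -subr_eq0; apply/eqP.
have -> : a - (b + b - c) = d - (b - a + (b - c + d)) by clear; vring.
by rewrite -h1 subrr.
Qed.

Lemma almost_orthogonalC k a b : almost_orthogonal k a b -> almost_orthogonal k b a.
Proof. by move=> h y; have [] := h y. Qed.

Lemma almost_orthogonal_cube k e z : N e <= 1 ->
  N (tp e e z) <= k -> N (quad e z) <= k -> almost_orthogonal (3 * C * k) (cube e) z.
Proof.
move=> e1 Tz Qz y; have ny := lexx (N y).
have b1 := tp_le C1 tpC_bound e1 Tz ny; have b2 := tp_le C1 tpC_bound Qz e1 ny.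
have b3 := tp_le C1 tpC_bound Tz e1 ny; have b4 := tp_le C1 tpC_bound e1 Qz ny.
split.
  rewrite tp_cube_left; apply: le_trans (rnormB _ _) _.
  apply: le_trans (lerD (rnormD _ _) (lexx _)) _; lra.
rewrite tp_cube_middle; apply: le_trans (rnormB _ _) _.
apply: le_trans (lerD (rnormD _ _) (lexx _)) _; lra.
Qed.

Lemma almost_orthogonal_cubes k a b : 0 <= k -> N a <= 1 -> N b <= 1 ->
  almost_orthogonal k a b -> almost_orthogonal (9 * C ^+ 2 * k) (cube a) (cube b).
Proof.
have step c d l : 0 <= l -> N c <= 1 -> N d <= 1 -> almost_orthogonal l c d ->
    almost_orthogonal (3 * C * l) (cube c) d.
  move=> l0 c1 d1 h; have [h1 h2] := h c.
  have lc : l * N c <= l by rewrite ler_piMr.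
  apply: almost_orthogonal_cube => //; last exact: le_trans h1 lc.
  by rewrite (tpC tpJ); exact: le_trans h2 lc.
move=> k0 a1 b1 h; have h1 := step _ _ _ k0 a1 b1 h.
have k1 : 0 <= 3 * C * k by rewrite !mulr_ge0.
have := step _ _ _ k1 b1 (rnorm_cube1 a1) (almost_orthogonalC h1).
move/almost_orthogonalC; have -> // : 3 * C * (3 * C * k) = 9 * C ^+ 2 * k by ring.
Qed.

(** By the norm identity the left side is the norm of (a + b)^3, whose six mixed terms have norm at
    most k each. *)
Lemma rnorm_add_cubed k a b : 0 <= k -> N a <= 1 -> N b <= 1 ->
  almost_orthogonal k a b -> N (a + b) ^+ 3 <= N (cube a + cube b) + 6 * k.
Proof.
move=> k0 a1 b1 h; rewrite -(rnorm_cube tpJ).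
have le1 l : l <= 1 -> k * l <= k by move=> l1; rewrite ler_piMr.
have [h1 h2] := h a; have [h3 h4] := h b.
have {}h1 := le_trans h1 (le1 _ a1); have {}h2 := le_trans h2 (le1 _ a1).
have {}h3 := le_trans h3 (le1 _ b1); have {}h4 := le_trans h4 (le1 _ b1).
have -> : tp (a + b) (a + b) (a + b) = (cube a + cube b) +
    (tp a b a + tp b a a + tp b a a + tp a b b + tp a b b + tp b a b).
  rewrite /cube !(tpE tpJ) (tpC tpJ a a b) (tpC tpJ b b a); clear; vring.
apply: le_trans (rnormD _ _) _; rewrite lerD2l.
have s1 := rnormD (tp a b a + tp b a a + tp b a a + tp a b b + tp a b b) (tp b a b).
have s2 := rnormD (tp a b a + tp b a a + tp b a a + tp a b b) (tp a b b).
have s3 := rnormD (tp a b a + tp b a a + tp b a a) (tp a b b).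
have s4 := rnormD (tp a b a + tp b a a) (tp b a a).
have s5 := rnormD (tp a b a) (tp b a a).
lra.
Qed.

(** Passing to cubes halves the excess: if |a^3 + b^3| <= 1 + d, then |a + b|^3 <= 1 + d + 6 l <= 1
    + 3 (d/2) <= (1 + d/2)^3. Cubes of almost orthogonal elements are again almost orthogonal, with
    a larger constant. *)
Lemma rnorm_add_orthogonal n : exists2 k : R, 0 < k & forall a b, N a <= 1 -> N b <= 1 ->
  almost_orthogonal k a b -> N (a + b) <= 1 + (2 ^+ n)^-1.
Proof.
elim: n => [|n [k k0 IHn]].
  exists 1 => // a b a1 b1 _; rewrite expr0 invr1.
  by apply: le_trans (rnormD _ _) _; rewrite lerD.
set d := (2 ^+ n)^-1 in IHn *; have d0 : 0 < d by rewrite invr_gt0 exprn_gt0.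
have C20 : 0 < 9 * C ^+ 2 by rewrite mulr_gt0// exprn_gt0// (lt_le_trans ltr01).
pose l := Num.min (k / (9 * C ^+ 2)) (d / 12).
have l0 : 0 < l by rewrite lt_min !divr_gt0.
have lk : 9 * C ^+ 2 * l <= k by rewrite mulrC -ler_pdivlMr// ge_min lexx.
have ld : 12 * l <= d by rewrite mulrC -ler_pdivlMr// ge_min lexx orbT.
exists l => // a b a1 b1 h.
have h3 : almost_orthogonal k (cube a) (cube b).
  move=> y; have [q1 q2] := almost_orthogonal_cubes (ltW l0) a1 b1 h y.
  have : 9 * C ^+ 2 * l * N y <= k * N y by rewrite ler_wpM2r ?rnorm_ge0.
  by move=> q; split; [exact: le_trans q1 q|exact: le_trans q2 q].
have := rnorm_add_cubed (ltW l0) a1 b1 h.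
have := IHn _ _ (rnorm_cube1 a1) (rnorm_cube1 b1) h3 => h1 h2.
have h4 : N (a + b) ^+ 3 <= (1 + d / 2) ^+ 3.
  have : 1 + 3%:R * (d / 2) <= (1 + d / 2) ^+ 3 by rewrite bernoulli// divr_ge0// ltW.
  clearbody l d; lra.
rewrite exprS invfM -/d mulrC.
move: h4; rewrite ler_pXn2r// nnegrE ?rnorm_ge0//.
by rewrite addr_ge0// divr_ge0// ltW.
Qed.

(** [opexp_decay] gives L e^(-tL) the bound 1/t. For the other map, Q(e) e^(-tL) = Q(y) with y =
    e^(-(t/2)L) e, and |y|^3 = |e^(-(3t/2)L) L e| is at most 1 / (3t/2). *)
Lemma opexp_quad_decay e (d : R) : N e <= 1 -> 0 < d -> exists2 t : R, 0 <= t & forall x,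
  N (tp e e (opexp (tp e e) (- t)%:C x)) <= d * N x /\
  N (quad e (opexp (tp e e) (- t)%:C x)) <= d * N x.
Proof.
move=> e1 d0; have C0' : 0 < C by rewrite (lt_le_trans ltr01).
pose c := Num.min 1 (d / C).
have c0 : 0 < c by rewrite lt_min ltr01 divr_gt0.
have c1 : c <= 1 by rewrite ge_min lexx.
have cC : C * c <= d by rewrite mulrC -ler_pdivlMr// ge_min lexx orbT.
pose s := (c ^+ 3)^-1; have s0 : 0 < s by rewrite invr_gt0 exprn_gt0.
have [t t0 [ts td]] : exists2 t : R, 0 < t & s <= t / 2 /\ d^-1 <= t.
  exists (2 * s + d^-1); last first.
    have d'0 : 0 < d^-1 by rewrite invr_gt0.
    by split; move: (d^-1) d'0 => d' d'0; clear - s0 d'0; clearbody s; lra.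
  by apply: addr_gt0; [exact: mulr_gt0|rewrite invr_gt0].
exists t => [|x]; first exact: ltW.
split.
  have := opexp_decay tpJ C1 tpC_bound e 1 x t0; rewrite /= (_ : 1`! = 1%N)// expr1 div1r.
  move/le_trans; apply; rewrite ler_wpM2r ?rnorm_ge0//.
  by rewrite -[d]invrK lef_pV2 ?posrE ?invr_gt0.
pose y := opexp (tp e e) (- (t / 2))%:C e.
have -> : quad e (opexp (tp e e) (- t)%:C x) = quad y x.
  have -> : - t = 2 * - (t / 2) by field.
  by rewrite -(quad_at_opexp tpJ C1 tpC_bound).
have ny : N y <= c.
  have r0 : 0 < 3 * (t / 2) by rewrite mulr_gt0// divr_gt0.
  rewrite -(@ler_pXn2r _ 3)// ?nnegrE ?rnorm_ge0 ?(ltW c0)//.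
  have := rnorm_opexp_pow tpJ C1 tpC_bound e 1 (- (t / 2)).
  rewrite expn1 expr1 -/y => ->.
  have -> : 3 * - (t / 2) = - (3 * (t / 2)) :> R by ring.
  rewrite (_ : iter _ _ _ = tp e e e)// -(opexpT (tp_bop tpJ C1 tpC_bound e e)).
  have := opexp_decay tpJ C1 tpC_bound e 1 e r0; rewrite /= (_ : 1`! = 1%N)// expr1 div1r.
  move/le_trans; apply.
  apply: (@le_trans _ _ (3 * (t / 2))^-1).
    by rewrite ler_piMr// invr_ge0 ltW.
  rewrite -[c ^+ 3]invrK -/s lef_pV2 ?posrE//; lra.
apply: le_trans (tp_le C1 tpC_bound ny (lexx (N x)) ny) _.
have -> : C * c * N x * c = (C * c * c) * N x by ring.
rewrite ler_wpM2r ?rnorm_ge0//; apply: le_trans cC.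
by rewrite ler_piMr// mulr_ge0// ltW.
Qed.

Section Ideal.
Variables E I : set V.
Hypotheses (EE : real_sub E) (II : is_triple_ideal tp E I).

Lemma ideal_opexp e x (t : R) : I e -> E x -> I (opexp (tp e e) t%:C x - x).
Proof.
have [[I0 ID IZ] IE Ic I1 _] := II; move=> Ie Ex.
pose TM := tp_bop tpJ C1 tpC_bound e e.
apply: closed_rnorm Ic _ => d d0.
have [m hm] := opexp_lim TM t%:C x d0.
exists (pexp (tp e e) t%:C m.+1 x - x); last first.
  by rewrite opprB addrA subrK; exact: hm.
have Ik k : I (iter k.+1 (tp e e) x).
  elim: k => [|k IHk]; first by rewrite /= (tpC tpJ); apply: I1 => //; exact: IE.
  by rewrite iterS; apply: I1 => //; exact: IE.
have cr k : t%:C ^+ k / k`!%:R = (t ^+ k / k`!%:R)%:C :> R[i].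
  by rewrite rmorphM fmorphV rmorphXn rmorph_nat.
rewrite /pexp big_nat_recl// expr0 fact0 divr1 scale1r addrAC subrr add0r.
by apply: big_ind => // k _; rewrite cr; apply: (IZ); exact: Ik.
Qed.

(** A further semigroup S = e^(-tL(w,w)) could spoil what is already small against the other e i.
    The automorphism property gives Q(y) S z = S^-1 Q(S y) z, so the induction runs on the elements
    S (e i) with the tolerance divided by a bound G for the inverse of S. *)
Lemma ideal_quad_small n (e : 'I_n -> V) (d : R) x : E x -> 0 < d ->
  (forall i, I (e i) /\ N (e i) <= 1) ->
  exists z, [/\ E z, I (z - x), N z <= N x & forall i, N (quad (e i) z) <= d].
Proof.
have [Isub IE _ _ _] := II; have [I0 ID _] := Isub.
have [_ ED _] := EE; move=> Ex.
elim: n e d => [|n IHn] e d d0 he.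
  by exists x; split; rewrite ?subrr// => -[].
pose w := e ord0; have [Iw w1] := he ord0; rewrite -/w in Iw w1.
pose nx := N x + 1; have nx0 : 0 < nx by rewrite ltr_wpDl ?rnorm_ge0.
have [t t0 ht] := opexp_quad_decay w1 (divr_gt0 d0 nx0).
pose TM := tp_bop tpJ C1 tpC_bound w w.
pose S y := opexp (tp w w) (- t)%:C y.
have SN y : N (S y) <= N y.
  by apply: (opexp_contraction tpJ C1 tpC_bound); rewrite /= oppr_le0.
pose G := expR (absc t%:C * (C * N w * N w)).
have G0 : 0 < G := expR_gt0 _.
have SI y : E y -> I (S y - y) by exact: ideal_opexp.
have he' i : I (S (e (lift ord0 i))) /\ N (S (e (lift ord0 i))) <= 1.
  have [Ii ni] := he (lift ord0 i); split; last exact: le_trans (SN _) ni.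
  by rewrite -[S _](subrK (e (lift ord0 i))); apply: (ID) => //; apply/SI/IE.
have [z [Ez zx zN hz]] := IHn _ _ (divr_gt0 d0 G0) he'.
exists (S z); split.
- by rewrite -[S z](subrK z); apply: (ED) => //; exact/IE/SI.
- by rewrite -[S z](subrK z) -addrA; apply: (ID) => //; exact: SI.
- exact: le_trans (SN z) zN.
- move=> i; have [j ->|->] := unliftP ord0 i; last first.
    have [_ h] := ht z; apply: le_trans h _.
    rewrite mulrAC ler_pdivrMr// ler_wpM2l ?(ltW d0)//.
    by apply: le_trans zN _; rewrite lerDl.
  set y := e _.
  have -> : quad y (S z) = opexp (tp w w) t%:C (quad (S y) z).
    rewrite /quad (opexp_automorphism tpJ C1 tpC_bound).
    have tK v : opexp (tp w w) t%:C (S v) = v by rewrite /S rmorphN (opexpNK TM).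
    by rewrite tK.
  apply: le_trans (bop_bound (opexp_bop TM _) _) _.
  by rewrite mulrC -ler_pdivlMr//; exact: hz.
Qed.
End Ideal.
End Orthogonality.

(** * Norm-preserving extensions and the L-projection *)

Section IdealIsMIdeal.
Variable R : realType.
Variable V : completeNormedModType R[i].
Variable tp : V -> V -> V -> V.
Hypothesis tpJ : is_JBstar_triple tp.
Local Notation N := (@rnorm R V).
Variable C : R.
Hypothesis C1 : 1 <= C.
Hypothesis tpC_bound : forall a b c, N (tp a b c) <= C * N a * N b * N c.
Local Notation quad := (quad tp).
Local Notation cube := (cube tp).
Variables E I : set V.
Hypotheses (EE : real_sub E) (II : is_triple_ideal tp E I).

Let Isub : real_sub I. Proof. by case: II. Qed.
Let IE : I `<=` E. Proof. by case: II. Qed.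

Definition ideal_norm (f : V -> R) := dnorm I (restr I f).

Definition norm_extension (f g : V -> R) :=
  [/\ real_linear_on setT g, forall x, g x <= ideal_norm f * N x
    & forall x, I x -> g x = f x].

Lemma dual_restr_ideal f : dual E f -> dual I (restr I f).
Proof.
move=> /(dualP EE)[_ fl [K fK]].
apply: (dual_restr Isub (K := K)); first exact: real_linear_on_sub fl.
by move=> x /IE; exact: fK.
Qed.

Lemma norm_extension_exists f : dual E f -> exists g, norm_extension f g.
Proof.
move=> fd; have fI := dual_restr_ideal fd.
have c0 := dnorm_ge0 Isub fI.
have ps : sublinear (fun x : V => ideal_norm f * N x).
  split=> [x y|r x r0]; first by rewrite -mulrDr ler_wpM2l// rnormD.
  by rewrite rnormZr ger0_norm// mulrCA.
have fle x : I x -> f x <= ideal_norm f * N x.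
  move=> Ix; apply: le_trans (ler_norm _) _; rewrite -(restrE f Ix).
  exact: le_dnorm.
have fl := real_linear_on_sub IE (dual_linear EE fd).
by have [g [gl gle gf]] := hahn_banach ps Isub fl fle; exists g; split.
Qed.

Lemma norm_extension_norming f g : dual E f -> norm_extension f g -> 0 < ideal_norm f ->
  dual_ball (fun x => (ideal_norm f)^-1 * g x) /\
  norming I (fun x => (ideal_norm f)^-1 * g x).
Proof.
move=> fd [[gD gZ] gle gf] c0; split.
  split=> [|x]; last by rewrite mulrC ler_pdivrMr// mulrC.
  by split=> [x y _ _|r x _]; [rewrite gD// mulrDr|rewrite gZ// mulrCA].
move=> e e0; have [x [Ix x1 hx]] := dnorm_approx Isub (dual_restr_ideal fd) (mulr_gt0 c0 e0).
exists x; split => //; rewrite mulrC ler_pdivlMr// mulrBl mul1r mulrC gf//.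
by rewrite -(restrE f Ix).
Qed.

Lemma norm_extension_zero f g : norm_extension f g -> ideal_norm f <= 0 -> forall x, g x = 0.
Proof.
move=> [gl gle _] c0 x.
have h y : g y <= 0.
  by apply: le_trans (gle y) _; rewrite mulr_le0_ge0 ?rnorm_ge0.
by apply/eqP; rewrite eq_le h//= -oppr_le0 -(rlinN gl)// h.
Qed.

(** Take e in I almost norming f on I. By (K) the normalized g is almost equal at z and at Q(e) z,
    hence small wherever Q(e) z is small. *)
Lemma norm_extension_small f g (d : R) : dual E f -> norm_extension f g -> 0 < d ->
  exists e, [/\ I e, N e <= 1 & exists2 h : R, 0 < h &
    forall z, N z <= 1 -> N (quad e z) <= h -> `|g z| <= d].
Proof.
move=> fd fg d0; have [c0|c0] := leP (ideal_norm f) 0.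
  exists 0; split; [by case: Isub|by rewrite rnorm0|].
  by exists 1 => // z _ _; rewrite (norm_extension_zero fg)// normr0 ltW.
have [fb fI] := norm_extension_norming fd fg c0; set F := fun x => _ in fb fI.
pose a := d / (2 * ideal_norm f); have a0 : 0 < a by rewrite divr_gt0 ?mulr_gt0.
have [r r0 hr] := facial tpJ C1 tpC_bound a0.
have [e [Ie e1 Fe]] := fI r r0.
exists e; split => //; exists a => // z z1 qz.
have [_] := hr F e z fb e1 z1 Fe.
rewrite (dbB fb) => h1; have h2 := le_trans (db_norm fb (quad e z)) qz.
have h3 : `|F z| <= a + a.
  by rewrite -[F z](subrK (F (quad e z))); apply: le_trans (ler_normD _ _) _; rewrite lerD.
have gF : g z = ideal_norm f * F z by rewrite mulVKf// gt_eqF.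
rewrite gF normrM gtr0_norm// mulrC -ler_pdivlMr//; apply: le_trans h3 _.
by rewrite le_eqVlt; apply/orP; left; apply/eqP; rewrite /a; field; rewrite gt_eqF.
Qed.

(** Replace x by z in x + I small against three elements of I, one for each functional. All three
    extensions are then small at z, while at x - z in I they agree with f1, f2, f3, where the
    relation holds. Linearity and uniqueness on E come together. *)
Lemma norm_extension_lincomb (r : R) f1 f2 f3 g1 g2 g3 : dual E f1 -> dual E f2 -> dual E f3 ->
  (forall x, f3 x = r * f1 x + f2 x) ->
  norm_extension f1 g1 -> norm_extension f2 g2 -> norm_extension f3 g3 ->
  forall x, E x -> g3 x = r * g1 x + g2 x.
Proof.
move=> fd1 fd2 fd3 f123 fg1 fg2 fg3.
have [gl1 _ gf1] := fg1; have [gl2 _ gf2] := fg2; have [gl3 _ gf3] := fg3.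
have [[gD1 gZ1] [gD2 gZ2]] := (gl1, gl2); have [gD3 gZ3] := gl3.
have unit_ball x : E x -> N x <= 1 -> g3 x = r * g1 x + g2 x.
  move=> Ex x1; apply/eqP; rewrite -subr_eq0 -normr_le0; apply/ler_addgt0Pr => /= e e0.
  have r0 : 0 < 2 + `|r| by rewrite ltr_wpDr.
  pose d := e / (2 + `|r|); have d0 : 0 < d by rewrite divr_gt0.
  have [e1 [I1 n1 [h1 h10 k1]]] := norm_extension_small fd1 fg1 d0.
  have [e2 [I2 n2 [h2 h20 k2]]] := norm_extension_small fd2 fg2 d0.
  have [e3 [I3 n3 [h3 h30 k3]]] := norm_extension_small fd3 fg3 d0.
  pose h := Num.min h1 (Num.min h2 h3).
  have h0 : 0 < h by rewrite !lt_min h10 h20 h30.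
  pose es (i : 'I_3) := nth 0 [:: e1; e2; e3] i.
  have hes i : I (es i) /\ N (es i) <= 1 by case: i => -[|[|[|//]]].
  have [z [Ez zx zN hz]] := ideal_quad_small tpJ C1 tpC_bound EE II Ex h0 hes.
  have z1 := le_trans zN x1.
  have q1 := hz (Ordinal (isT : (0 < 3)%N)); have q2 := hz (Ordinal (isT : (1 < 3)%N)).
  have q3 := hz (Ordinal (isT : (2 < 3)%N)); rewrite /es /= in q1 q2 q3.
  have {}k1 : `|g1 z| <= d by apply: k1 => //; apply: le_trans q1 _; rewrite ge_min lexx.
  have {}k2 : `|g2 z| <= d by apply: k2 => //; apply: le_trans q2 _; rewrite !ge_min lexx orbT.
  have {}k3 : `|g3 z| <= d by apply: k3 => //; apply: le_trans q3 _; rewrite !ge_min lexx !orbT.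
  have Ixz : I (x - z) by rewrite -opprB; exact: real_subN.
  have e1E : g1 x = f1 (x - z) + g1 z by rewrite -gf1// -gD1// subrK.
  have e2E : g2 x = f2 (x - z) + g2 z by rewrite -gf2// -gD2// subrK.
  have e3E : g3 x = f3 (x - z) + g3 z by rewrite -gf3// -gD3// subrK.
  have -> : g3 x - (r * g1 x + g2 x) = g3 z - r * g1 z - g2 z.
    by rewrite e1E e2E e3E f123; ring.
  rewrite add0r; apply: le_trans (ler_normB _ _) _.
  apply: le_trans (lerD (ler_normB _ _) (lexx _)) _; rewrite normrM.
  have rd : `|r| * `|g1 z| <= `|r| * d by rewrite ler_wpM2l.
  have de : d * (2 + `|r|) = e by rewrite divfK ?gt_eqF.
  by rewrite -de (_ : d * _ = d + `|r| * d + d) ?lerD//; ring.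
move=> x Ex; have c0 : 0 < N x + 1 by rewrite ltr_wpDl ?rnorm_ge0.
have xE : x = (N x + 1)%:C *: ((N x + 1)^-1%:C *: x).
  by rewrite scalerA -rmorphM mulfV ?gt_eqF// rmorph1 scale1r.
rewrite xE gZ1// gZ2// gZ3// unit_ball; first ring.
  by case: EE => _ _; apply.
by rewrite rnormZr gtr0_norm ?invr_gt0// mulrC ler_pdivrMr// mul1r lerDl.
Qed.

Lemma norm_extension_dual f g : dual E f -> norm_extension f g -> dual E (restr E g).
Proof.
move=> fd [gl gle _]; have c0 := dnorm_ge0 Isub (dual_restr_ideal fd).
apply: (dual_restr EE (K := ideal_norm f)) => [|x _]; first exact: real_linear_on_sub gl.
by rewrite ler_norml gle andbT lerNl -(rlinN gl)// -(rnormN x).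
Qed.

(** Evaluate f = p + g at e^3 + z, where e almost norms f on I and z in x + I, x almost norming p.
    As p vanishes on I, it takes the value p x there; g contributes nearly its full norm through
    e^3, and almost nothing through z, because Q(e) z is small. *)
Lemma norm_extension_dnorm f g : dual E f -> norm_extension f g ->
  dnorm E f = dnorm E (f - restr E g) + dnorm E (restr E g).
Proof.
move=> fd fg; have gd := norm_extension_dual fd fg.
have pd := dual_sub EE fd gd; set p := f - restr E g in pd *.
have [gl gle gf] := fg; have [gD gZ] := gl.
have c0 : 0 <= ideal_norm f := dnorm_ge0 Isub (dual_restr_ideal fd).
have pE x : E x -> p x = f x - g x by move=> Ex; rewrite -(restrE g Ex).
have pl := dual_linear EE pd.
apply/eqP; rewrite eq_le; apply/andP; split.
  apply: dnorm_le => // x Ex x1.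
  have -> : f x = p x + restr E g x by rewrite -[p x]/(f x - restr E g x) subrK.
  by apply: le_trans (ler_normD _ _) _; rewrite lerD// le_dnorm1.
have gn : dnorm E (restr E g) <= ideal_norm f.
  apply: dnorm_le => // x Ex x1; rewrite restrE//.
  have gx y : N y <= 1 -> g y <= ideal_norm f.
    by move=> y1; apply: le_trans (gle y) _; rewrite ler_piMr.
  by rewrite ler_norml gx// andbT lerNl -(rlinN gl)// gx// rnormN.
apply: le_trans (lerD (lexx _) gn) _.
have [c00|cp] := leP (ideal_norm f) 0.
  have -> : p = f.
    apply/funext => x; rewrite -[LHS]/(f x - restr E g x) /restr.
    by rewrite (norm_extension_zero fg)// if_same subr0.
  by rewrite -[leRHS]addr0 lerD.
have [fb fI] := norm_extension_norming fd fg cp; set F := fun x => _ in fb fI.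
apply: (@le_of_le_small _ _ _ (1 + 4 * ideal_norm f + dnorm E f) 1) => // d d0 d1.
have [n hn] : exists n, (2 ^+ n)^-1 <= d.
  have [n [_ hn]] := archi_nat d^-1; exists n.
  rewrite -[d]invrK lef_pV2 ?posrE ?invr_gt0 ?exprn_gt0//; apply: le_trans hn _.
  by rewrite -natrX ler_nat ltnW// ltn_expl.
have [k k0 hk] := rnorm_add_orthogonal tpJ C1 tpC_bound n.
have C0' : 0 < 3 * C by rewrite mulr_gt0// (lt_le_trans ltr01).
pose h := Num.min d (k / (3 * C)).
have h0 : 0 < h by rewrite lt_min d0 divr_gt0.
have hd : h <= d by rewrite ge_min lexx.
have hC : 3 * C * h <= k by rewrite mulrC -ler_pdivlMr// ge_min lexx orbT.
have [r1 r10 hr1] := facial tpJ C1 tpC_bound d0.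
have [r2 r20 hr2] := facial_cube tpJ C1 tpC_bound d0.
have [e [Ie e1 Fe]] : exists x, [/\ I x, N x <= 1 & 1 - Num.min r1 r2 <= F x].
  by apply: fI; rewrite lt_min r10.
have Fe1 : 1 - r1 <= F e by apply: le_trans Fe; rewrite lerD2l lerN2 ge_min lexx.
have Fe2 : 1 - r2 <= F e by apply: le_trans Fe; rewrite lerD2l lerN2 ge_min lexx orbT.
have Fa := hr2 F e fb e1 Fe2.
have [x [Ex x1 px]] := dnorm_approx EE pd d0.
have [t t0 ht] := opexp_quad_decay tpJ C1 tpC_bound e1 h0.
set z := opexp (tp e e) (- t)%:C x.
have Izx : I (z - x) := ideal_opexp tpJ C1 tpC_bound II (- t) Ie Ex.
have Ez : E z by case: EE => _ ED _; rewrite -(subrK x z); apply: (ED) => //; exact: IE.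
have z1 : N z <= 1.
  by apply: le_trans (opexp_contraction tpJ C1 tpC_bound _ _ _) x1; rewrite /= oppr_le0.
have [Tz Qz] := ht x; rewrite -/z in Tz Qz.
have hx : h * N x <= h by rewrite ler_piMr// ltW.
have {}Tz := le_trans Tz hx; have {}Qz := le_trans Qz hx.
have orth := almost_orthogonal_cube tpJ C1 tpC_bound e1 Tz Qz.
have ca1 := rnorm_cube_le1 tpJ e1.
have Naz : N (cube e + z) <= 1 + d.
  apply: le_trans (hk _ _ ca1 z1 _) _; last by rewrite lerD2l.
  move=> y; have [q1 q2] := orth y.
  have ky : 3 * C * h * N y <= k * N y by rewrite ler_wpM2r ?rnorm_ge0.
  by split; [exact: le_trans q1 ky|exact: le_trans q2 ky].
have Ia : I (cube e) by case: II => _ _ _ + _; apply => //; exact: IE.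
have Ea := IE Ia.
have [_ Fz] := hr1 F e z fb e1 z1 Fe1.
rewrite (dbB fb) in Fz; have FQ := le_trans (db_norm fb (quad e z)) Qz.
have Eaz : E (cube e + z) by case: EE => _ ED _; exact: ED.
have up : f (cube e + z) <= dnorm E f * (1 + d).
  apply: le_trans (ler_norm _) _; apply: le_trans (le_dnorm EE fd Eaz) _.
  by rewrite ler_wpM2l// dnorm_ge0.
have gF y : g y = ideal_norm f * F y by rewrite mulVKf// gt_eqF.
have low : f (cube e + z) = p x + ideal_norm f * (F (cube e) + F z).
  have [fD _] := dual_linear EE fd.
  have px_z : p z = p x.
    apply/eqP; rewrite -subr_eq0 -(rlinB EE pl)// pE; last exact: IE.
    by rewrite gf// subrr.
  have fz : f z = p z + g z by rewrite pE// subrK.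
  by rewrite fD// fz px_z -(gf _ Ia) !gF; ring.
have Fsum : 1 - 3 * d <= F (cube e) + F z.
  move: Fz FQ; rewrite !ler_norml => /andP[Fz _] /andP[FQ _]; lra.
have : ideal_norm f * (1 - 3 * d) <= ideal_norm f * (F (cube e) + F z) by rewrite ler_wpM2l.
have cd : 0 <= ideal_norm f * d by rewrite mulr_ge0// ltW.
lra.
Qed.

Lemma triple_ideal_M_ideal : is_M_ideal E I.
Proof.
have [_ _ Ic _ _] := II.
split=> //; pose ext f := xget (fun=> 0) [set g | norm_extension f g].
have extP f : dual E f -> norm_extension f (ext f).
  move=> fd; have [g fg] := norm_extension_exists fd.
  exact: (xgetPex _ (ex_intro _ g fg)).
(* On E the extension is determined by f according to [norm_extension_lincomb], so the choice made
   in [ext] does not disturb linearity. *)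
pose Q f := f - restr E (ext f).
have QE f x : E x -> Q f x = f x - ext f x by move=> Ex; rewrite -(restrE (ext f) Ex).
have Qoff f x : dual E f -> ~ E x -> Q f x = 0.
  move=> /(dualP EE)[f0 _ _] nEx.
  by rewrite -[LHS]/(f x - restr E (ext f) x) f0// /restr asboolF// subr0.
have Qd f : dual E f -> dual E (Q f).
  by move=> fd; apply: dual_sub => //; exact: norm_extension_dual (extP f fd).
have QI f x : dual E f -> I x -> Q f x = 0.
  move=> fd Ix; have [_ _ gf] := extP f fd.
  by rewrite QE ?gf ?subrr//; exact: IE.
have Qid f : dual E f -> (forall x, I x -> f x = 0) -> Q f = f.
  move=> fd f0; apply/funext => x; rewrite -[LHS]/(f x - restr E (ext f) x).
  suff e0 : forall y, ext f y = 0 by rewrite /restr e0 if_same subr0.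
  apply: norm_extension_zero (extP f fd) _.
  by apply: dnorm_le => // y Iy _; rewrite restrE// f0// normr0.
exists Q; split; first split => //.
- move=> r f g fd gd; have fgd := dual_lincomb EE r fd gd; apply/funext => x.
  rewrite -[RHS]/(r * Q f x + Q g x).
  have [Ex|nEx] := EM (E x); last by rewrite !Qoff// mulr0 addr0.
  have := norm_extension_lincomb (r := r) fd gd fgd (fun=> erefl) (extP _ fd) (extP _ gd) (extP _ fgd) Ex.
  rewrite !QE// => ->; rewrite -[(r *: f + g) x]/(r * f x + g x); ring.
- by move=> f fd; apply: Qid (Qd f fd) _ => x; exact: QI.
- move=> f fd; rewrite {1}(norm_extension_dnorm fd (extP f fd)) -/(Q f).
  by congr (_ + dnorm E _); rewrite /Q opprB addrC subrK.
apply/seteqP; split => [_ [f fd <-]|f [fd f0]].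
  by split; [exact: Qd|move=> m; exact: QI].
by exists f => //; exact: Qid.
Qed.
End IdealIsMIdeal.

Theorem theorem5p5 (R : realType) (V : completeNormedModType R[i])
    (tp : V -> V -> V -> V) (E : set V) :
  is_real_JBstar_triple tp E ->
  forall M : set V, real_subspace M -> M `<=` E ->
    (is_M_ideal E M <-> is_triple_ideal tp E M).
Proof.
move=> Etriple M _ _; have [tpJ EE _ Etp] := Etriple.
have [C [C1 tpC_bound]] := tp_bound tpJ.
split; first exact: M_ideal_triple_ideal tpJ _ C1 tpC_bound _ _ Etriple.
exact: triple_ideal_M_ideal tpJ _ C1 tpC_bound _ _ EE.
Qed.
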